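(* Let $u_0\in\mathcal{M}$. There exists a constant $C_\alpha\in(0,1]$, depending only on $\mathcal{D}$, $d$, $\beta$, $V$, $\Omega$ and $\|u_0\|_{H_0^1}$, such that for any sequence of step sizes with $0<\alpha_{\min}\le\alpha_n\le\alpha_{\max}\le C_\alpha$, the sequence $\{u_n\}_{n=0}^\infty$ generated from $u_0$ by the $a_0$ scheme $u_{n+1}=R\big(u_n-\alpha_n\nabla^{\mathcal{R}}_{a_0}E(u_n)\big)$ has the following property: every weak limit point $u^*$ of $\{u_n\}$ in $H_0^1(\mathcal{D})$ is a stationary point of the constrained problem $\min_{u\in\mathcal{M}}E(u)$, and $\{u_n\}$ has a subsequence that converges strongly to $u^*$ in the $a_0$ norm.
   Context: Setting: $\mathcal{D}\subseteq\mathbb{R}^d$ ($d=2,3$) is a bounded domain; points are written $r=(x,y)$ or $r=(x,y,z)$. $V\in L^\infty(\mathcal{D};\mathbb{R}_{\ge0})$, $\beta>0$, $\Omega\ge0$, $L_z=-\mathrm{i}(x\partial_y-y\partial_x)$. Standing assumption: there is a constant $K>0$ with $V(r)\ge\frac{1+K}{4}\Omega^2(x^2+y^2)$ for all $r\in\mathcal{D}$. All function spaces are complex valued; $(v,w)_{L^2}=\int_{\mathcal{D}}\overline{v}w\,dr$ and $\|v\|_{H_0^1}=\|\nabla v\|_{L^2}$. $\Re$ denotes the real part. Energy: $E(u)=\int_{\mathcal{D}}\big(\frac12|\nabla u|^2+\frac12V|u|^2+\frac\beta4|u|^4-\frac\Omega2\overline{u}L_zu\big)dr$ for $u\in H_0^1(\mathcal{D})$.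 Constraint manifold: $\mathcal{M}=\{u\in H_0^1(\mathcal{D};\mathbb{C}):\|u\|_{L^2}=1\}$. The real Fréchet derivative is $\langle E'(u),v\rangle=\Re(\nabla u,\nabla v)_{L^2}+\Re(Vu+\beta|u|^2u-\Omega L_zu,v)_{L^2}$. A stationary point of the constrained problem is $u\in\mathcal{M}$ such that for some $\lambda\in\mathbb{R}$, $\langle E'(u),v\rangle=\lambda\Re(u,v)_{L^2}$ for all $v\in H_0^1(\mathcal{D})$ (equivalently, the projected gradient defined below vanishes at $u$). A weak limit point of a sequence is the weak limit in $H_0^1(\mathcal{D})$ of some subsequence. $a_0$ inner product: $(v,w)_{a_0}=\int_{\mathcal{D}}(\nabla\overline{v}\cdot\nabla w+V\overline{v}w-\Omega\overline{v}L_zw)\,dr$, with induced norm $\|\cdot\|_{a_0}$ (an inner product on $H_0^1(\mathcal{D})$ whose norm is equivalent to $\|\cdot\|_{H_0^1}$ under the standing assumption). With $X=a_0$: the Sobolev gradient $\nabla_XE(u)\in H_0^1(\mathcal{D})$ is the unique function with $\Re(\nabla_XE(u),h)_X=\langle E'(u),h\rangle$ for all $h\in H_0^1(\mathcal{D})$; $\mathcal{G}_X$ is defined by $(\mathcal{G}_Xw,h)_X=(w,h)_{L^2}$ for all $h\in H_0^1(\mathcal{D})$; the projected gradient is $\nabla^{\mathcal{R}}_XE(u)=\mathcal{P}_{u,X}(\nabla_XE(u))$, where $\mathcal{P}_{u,X}w=w-\frac{\Re(w,\mathcal{G}_Xu)_X}{\|\mathcal{G}_Xu\|_X^2}\mathcal{G}_Xu$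 is the $X$-orthogonal projection onto $T_u\mathcal{M}=\{v\in H_0^1(\mathcal{D}):\Re(u,v)_{L^2}=0\}$. Retraction: $R(v)=v/\|v\|_{L^2}$ for $v\in H_0^1(\mathcal{D})\setminus\{0\}$. *)

(* Defs.v *)
From HB Require Import structures.
From mathcomp Require Import all_boot all_order all_algebra.
From mathcomp Require Import all_classical all_reals all_analysis.
From mathcomp Require Import complex.

Set Implicit Arguments.
Unset Strict Implicit.
Unset Printing Implicit Defensive.
Import Order.TTheory GRing.Theory Num.Theory.
Import numFieldNormedType.Exports.
Import Normc.

Local Open Scope classical_set_scope.
Local Open Scope ring_scope.

(* The sigma-algebra on 'rV[R]_n is generated by the coordinates, i.e., it is
   the Borel one. Lebesgue measure is the iterated product of the Lebesgue
   measure on the line, starting from the unit mass on the point 'rV[R]_0. *)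

Fact rV_display : measure_display.
Proof. exact: default_measure_display. Qed.

Section rV_measurable.
Context (R : realType) (n : nat).

Let coor (i : 'I_n) (v : 'rV[R]_n) : R := v ord0 i.

Let rV_set0 : g_sigma_preimage coor set0.
Proof. exact: sigma_algebra0. Qed.

Let rV_setC A : g_sigma_preimage coor A -> g_sigma_preimage coor (~` A).
Proof. exact: sigma_algebraC. Qed.

Let rV_bigcup (F : (set 'rV[R]_n)^nat) :
  (forall i, g_sigma_preimage coor (F i)) ->
  g_sigma_preimage coor (\bigcup_i F i).
Proof. exact: sigma_algebra_bigcup. Qed.

HB.instance Definition _ :=
  @isMeasurable.Build rV_display 'rV[R]_n
    (g_sigma_preimage coor) rV_set0 rV_setC rV_bigcup.

Lemma measurable_coor (i : 'I_n) :
  measurable_fun [set: 'rV[R]_n] (fun v => v ord0 i : R).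
Proof.
move=> _ Y mY; rewrite setTI; apply: sub_sigma_algebra => /=.
rewrite -bigcup_seq/=; exists i => /=; first by rewrite mem_index_enum.
by exists Y => //; rewrite setTI.
Qed.

Lemma measurable_fun_rV d (T : measurableType d) (f : T -> 'rV[R]_n) :
  (forall i, measurable_fun [set: T] (fun x => f x ord0 i : R)) ->
  measurable_fun [set: T] f.
Proof.
move=> mf _ Y mY; rewrite setTI; move: Y mY.
apply: smallest_sub => [|Y]; first split => [|A mA|F mF].
- by rewrite preimage_set0; exact: measurable0.
- by rewrite setTD preimage_setC; exact: measurableC.
- by rewrite preimage_bigcup; exact: bigcupT_measurable.
- rewrite -bigcup_seq => -[i _ [B mB <-]].
  by rewrite setTI -[X in measurable X]setTI; exact: (mf i).
Qed.

End rV_measurable.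

Section lebesgue_measure_rV.
Context (R : realType).

Definition cons_rV n (p : measurableTypeR R * 'rV[R]_n) : 'rV[R]_n.+1 :=
  \row_i if unlift ord0 i is Some j then p.2 ord0 j else p.1.

Lemma measurable_cons_rV n :
  measurable_fun [set: measurableTypeR R * 'rV[R]_n] (@cons_rV n).
Proof.
apply: measurable_fun_rV => i.
under eq_fun do rewrite mxE; case: unliftP => [j _|_].
  exact: (measurableT_comp (measurable_coor j) measurable_snd).
exact: measurable_fst.
Qed.

Section cons_measure.
Local Open Scope ereal_scope.
Context (n : nat) (m : {sigma_finite_measure set 'rV[R]_n -> \bar R}).

Definition cons_measure : set 'rV[R]_n.+1 -> \bar R :=
  pushforward (@lebesgue_measure R \x m) (@cons_rV n).

Let mcons := @measurable_cons_rV n.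
Let cons_measure0 : cons_measure set0 = 0.
Proof. exact: measure0. Qed.

Let cons_measure_ge0 A : 0 <= cons_measure A.
Proof. exact: measure_ge0. Qed.

Let cons_measure_sigma_additive : semi_sigma_additive cons_measure.
Proof. exact: measure_semi_sigma_additive. Qed.

HB.instance Definition _ := isMeasure.Build _ _ _ cons_measure
  cons_measure0 cons_measure_ge0 cons_measure_sigma_additive.

Let cons_measure_sigma_finite : sigma_finite setT cons_measure.
Proof.
have /sigma_finiteP[F [FT ndF Foo]] := sigma_finiteT (@lebesgue_measure R).
have /sigma_finiteP[G [GT ndG Goo]] := sigma_finiteT m.
pose uncons (v : 'rV[R]_n.+1) : measurableTypeR R * 'rV[R]_n :=
  (v ord0 ord0, \row_j v ord0 (lift ord0 j)).
have unconsK : cancel (@cons_rV n) uncons.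
  move=> [x v]; rewrite /uncons mxE unlift_none; congr pair.
  by apply/rowP => j; rewrite !mxE liftK.
have muncons : measurable_fun [set: 'rV[R]_n.+1] uncons.
  apply/measurable_fun_pairP; split => /=; first exact: measurable_coor.
  apply: measurable_fun_rV => i; under eq_fun do rewrite mxE.
  exact: measurable_coor.
exists (fun k => uncons @^-1` (F k `*` G k)).
  rewrite -preimage_bigcup -[LHS](preimage_setT uncons); congr (_ @^-1` _).
  apply/esym/seteqP; split=> [//|[x v] _].
  have [i _ Fix] : (\bigcup_i F i) x by rewrite -FT.
  have [j _ Gjv] : (\bigcup_i G i) v by rewrite -GT.
  exists (maxn i j) => //; split => /=.
  - by move: x Fix; exact/subsetPset/ndF/leq_maxl.
  - by move: v Gjv; exact/subsetPset/ndG/leq_maxr.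
move=> k; have [mF Fk] := Foo k; have [mG Gk] := Goo k; split.
  by rewrite -[X in measurable X]setTI; apply: muncons => //; exact: measurableX.
rewrite /cons_measure /pushforward -comp_preimage.
rewrite (_ : uncons \o _ = id); last by apply/funext => p /=; rewrite unconsK.
by rewrite preimage_id product_measure1E// lte_mul_pinfty// ge0_fin_numE.
Qed.

HB.instance Definition _ := Measure_isSigmaFinite.Build _ _ _ cons_measure
  cons_measure_sigma_finite.

End cons_measure.

Fixpoint lebesgue_measure_rV n :
    {sigma_finite_measure set 'rV[R]_n -> \bar R} :=
  if n is k.+1 then cons_measure (lebesgue_measure_rV k)
  else @dirac _ 'rV[R]_0 0 R.

End lebesgue_measure_rV.

Section function_spaces.
Local Open Scope complex_scope.
Context (R : realType) (d : nat).
Local Notation E := 'rV[R]_d.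
Local Notation leb := (lebesgue_measure_rV R d).

Definition domain (D : set E) := [/\ D !=set0, open D & connected D].

Definition Linfty (D : set E) (V : E -> R) :=
  measurable_fun D V /\ finite_norm leb +oo%E (V \_ D).

Definition cintegral (D : set E) (f : E -> R[i]) : R[i] :=
  (\int[leb]_(r in D) complex.Re (f r)) +i*
  (\int[leb]_(r in D) complex.Im (f r)).

(* Elements of L^2 and of the Sobolev spaces below are represented by
   functions E -> R[i]; their values outside D are irrelevant. *)
Definition L2 (D : set E) : set (E -> R[i]) := [set f : E -> R[i] |
  [/\ measurable_fun D (fun r => complex.Re (f r)),
      measurable_fun D (fun r => complex.Im (f r)) &
      (\int[leb]_(r in D) ((normc (f r)) ^+ 2)%:E < +oo)%E]].

Definition L2dot (D : set E) (v w : E -> R[i]) : R[i] :=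
  cintegral D (fun r => (v r)^* * w r).

Definition L2norm (D : set E) (v : E -> R[i]) : R :=
  Num.sqrt (complex.Re (L2dot D v v)).

Definition evec (i : 'I_d) : E := delta_mx ord0 i.

Fixpoint Ck (k : nat) (f : E -> R) : Prop :=
  if k is k'.+1 then
    (forall i r, derivable f r (evec i)) /\
    (forall i, Ck k' (fun r => 'D_(evec i) f r))
  else continuous f.

Definition smooth (f : E -> R) := forall k, Ck k f.

Definition partial (i : 'I_d) (phi : E -> R[i]) : E -> R[i] := fun r =>
  'D_(evec i) (fun s => complex.Re (phi s)) r +i*
  'D_(evec i) (fun s => complex.Im (phi s)) r.

(* C_c^oo(D; C) *)
Definition test_function (D : set E) : set (E -> R[i]) := [set phi : E -> R[i] |
  [/\ smooth (fun r => complex.Re (phi r)),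
      smooth (fun r => complex.Im (phi r)) &
      exists K, [/\ compact K, K `<=` D & forall r, ~ K r -> phi r = 0]]].

Definition weak_partial (D : set E) (i : 'I_d) (u : E -> R[i]) :
    set (E -> R[i]) := [set g : E -> R[i] | L2 D g /\
  forall phi, test_function D phi ->
    cintegral D (fun r => u r * partial i phi r) =
    - cintegral D (fun r => g r * phi r)].

Definition H1 (D : set E) : set (E -> R[i]) :=
  [set u : E -> R[i] | L2 D u /\ forall i, weak_partial D i u !=set0].

(* Weak derivatives are unique up to equality almost everywhere on D. *)
Definition wpartial (D : set E) (i : 'I_d) (u : E -> R[i]) : E -> R[i] :=
  xget (fun=> 0) (weak_partial D i u).

Definition H1norm (D : set E) (u : E -> R[i]) : R :=
  Num.sqrt (L2norm D u ^+ 2 + \sum_(i < d) L2norm D (wpartial D i u) ^+ 2).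

Definition H01 (D : set E) : set (E -> R[i]) := [set u : E -> R[i] | H1 D u /\
  forall eps, 0 < eps -> exists2 phi, test_function D phi &
    H1norm D (fun r => u r - phi r) < eps].

Definition H01norm (D : set E) (u : E -> R[i]) : R :=
  Num.sqrt (\sum_(i < d) L2norm D (wpartial D i u) ^+ 2).

Definition H01_dual (D : set E) (F : (E -> R[i]) -> R[i]) :=
  [/\ forall u v, H01 D u -> H01 D v -> F (fun r => u r + v r) = F u + F v,
      forall (c : R[i]) u, H01 D u -> F (fun r => c * u r) = c * F u &
      exists c : R, forall u, H01 D u -> normc (F u) <= c * H01norm D u].

Definition weak_cvg_H01 (D : set E) (u : nat -> E -> R[i]) (us : E -> R[i]) :=
  H01 D us /\
  forall F, H01_dual D F -> normc (F (u n) - F us) @[n --> \oo] --> 0.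

Definition weak_limit_point (D : set E) (u : nat -> E -> R[i])
    (us : E -> R[i]) :=
  exists s : nat -> nat, {homo s : m n / (m < n)%N} /\
    weak_cvg_H01 D (fun n => u (s n)) us.

Definition manifold (D : set E) : set (E -> R[i]) :=
  [set u : E -> R[i] | H01 D u /\ L2norm D u = 1].

Definition retraction (D : set E) (v : E -> R[i]) : E -> R[i] :=
  fun r => ((L2norm D v)^-1)%:C * v r.

End function_spaces.

(* The space dimension is d.+2, so that a point r always has the coordinates
   x = r 0 0 and y = r 0 1. *)
Section rotating_gpe.
Local Open Scope complex_scope.
Context (R : realType) (d : nat).
Local Notation E := 'rV[R]_d.+2.
Context (D : set E) (V : E -> R) (beta Omega : R).
Implicit Types u v w g h : E -> R[i].

Definition Lz u : E -> R[i] := fun r =>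
  - 'i * ((r 0 0)%:C * wpartial D 1 u r - (r 0 1)%:C * wpartial D 0 u r).

Definition energy u : R := complex.Re (cintegral D (fun r =>
  (\sum_(i < d.+2) normc (wpartial D i u r) ^+ 2 / 2
   + V r * normc (u r) ^+ 2 / 2 + beta / 4 * normc (u r) ^+ 4)%:C
  - (Omega / 2)%:C * ((u r)^* * Lz u r))).

(* The real Frechet derivative of energy on H01 D. *)
Definition dE u v : R :=
  complex.Re (\sum_(i < d.+2) L2dot D (wpartial D i u) (wpartial D i v)) +
  complex.Re (L2dot D (fun r => (V r)%:C * u r
    + (beta * normc (u r) ^+ 2)%:C * u r - Omega%:C * Lz u r) v).

Definition stationary u := manifold D u /\ exists lambda : R,
  forall v, H01 D v -> dE u v = lambda * complex.Re (L2dot D u v).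

Definition a0dot v w : R[i] := cintegral D (fun r =>
  \sum_(i < d.+2) (wpartial D i v r)^* * wpartial D i w r
  + (V r)%:C * (v r)^* * w r - Omega%:C * (v r)^* * Lz w r).

Definition a0norm v : R := Num.sqrt (complex.Re (a0dot v v)).

(* The Sobolev gradient and G_{a0} are the Riesz representatives of E'(u) and
   of (w, .)_{L^2}; they are unique up to equality almost everywhere on D, so
   they are specified by predicates. *)
Definition is_sobolev_gradient u g :=
  H01 D g /\ forall h, H01 D h -> complex.Re (a0dot g h) = dE u h.

Definition is_G w g :=
  H01 D g /\ forall h, H01 D h -> a0dot g h = L2dot D w h.

(* P_{u,a0} w, where g = G_{a0} u *)
Definition a0_projection g w : E -> R[i] := fun r =>
  w r - (complex.Re (a0dot w g) / a0norm g ^+ 2)%:C * g r.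

Definition is_projected_gradient u p := exists g w,
  [/\ is_G u g, is_sobolev_gradient u w & p = a0_projection g w].

Definition a0_scheme (alpha : nat -> R) (u : nat -> E -> R[i]) :=
  forall n, exists2 p, is_projected_gradient (u n) p &
    u n.+1 = retraction D (fun r => u n r - (alpha n)%:C * p r).

End rotating_gpe.

(* Main.v *)
(* The projected gradient p_n is tangent to the sphere, so that
   |u_n - alpha p_n|^2 = 1 + alpha^2 |p_n|^2 >= 1 in L^2: the retraction multiplies
   by a factor at most 1 and does not increase E(u) = |u|_a0^2/2 + beta/4 |u|_4^4.
   Since <E'(u_n), p_n> = |p_n|_a0^2, expanding E along - p_n gives
   E(u_{n+1}) <= E(u_n) - alpha_n/2 |p_n|_a0^2 for steps at most Calpha, a constant
   that depends on a bound of E(u_0). Hence |p_n|_a0 tends to 0 and u_n is bounded.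

   Write p_n in the form E'(u_n) - gamma_n u_n, in the dual sense. Along a weakly
   convergent subsequence, u_n converges strongly in L^2 by the Rellich theorem, and
   then in L^4 because |v|_4^8 <= C |v|_2^2 |grad v|_2^6 in dimensions 2 and 3.
   Testing p_n with u* shows that gamma_n converges, testing with a fixed h gives the
   stationarity of u*, and testing with u_n gives |u_n|_a0 -> |u*|_a0, which
   together with weak convergence yields strong convergence.

   The Sobolev inequalities are proved for test functions by integrating along
   lines, and extended by density. For the Rellich theorem, u is compared with its
   averages over cubes of side h: the L^2 distance is at most C h |grad u|_2, and
   the averages of a weakly null sequence tend to 0 boundedly and pointwise. *)

Require Import Defs.
From mathcomp Require Import all_boot all_order all_algebra.
From mathcomp Require Import all_classical all_reals all_analysis.
From mathcomp Require Import complex.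
From mathcomp Require Import measurable_realfun ess_sup_inf.
From mathcomp Require Import ring lra.

Set Implicit Arguments.
Unset Strict Implicit.
Unset Printing Implicit Defensive.
Import Order.TTheory GRing.Theory Num.Theory.
Import numFieldNormedType.Exports.
Import Normc.

Local Open Scope classical_set_scope.
Local Open Scope ring_scope.

(** * Lebesgue measure on row vectors *)

(** [wpartial] selects one weak derivative among those that agree almost everywhere, so even the
    additivity of the gradient holds only almost everywhere. The estimates are therefore phrased
    through the real forms [rdot], [gdot], [form] and [quad], which ignore null sets, and the
    descent argument runs in an abstract space that knows nothing but such forms. Besides linearity,
    symmetry, positivity and the two kinds of convergence, it receives three inequalities: Poincare
    in the form b <= Cb a, the L^4 bound q^2 <= Cq b a^3, and Cauchy-Schwarz for the four-linear
    form. The constants are explicit, so the step bound can be fixed from |grad u_0| before the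
    sequence is given. Two points need care. The fourth power of a function of H^1_0 is not
    integrable by definition, so the L^4 bound has to produce integrability as well. The angular
    momentum is symmetric only when one argument vanishes at the boundary in the H^1_0 sense, and
    its sign is indefinite: coercivity comes from balancing it against the trap and a fraction of
    the gradient. *)

Section boxes.
Context {R : realType} {n : nat}.
Implicit Types (a b : 'rV[R]_n) (A : set 'rV[R]_n).

Definition open_box a b : set 'rV[R]_n :=
  [set r | forall i, a ord0 i < r ord0 i < b ord0 i].

Definition closed_box a b : set 'rV[R]_n :=
  [set r | forall i, a ord0 i <= r ord0 i <= b ord0 i].

Lemma open_boxW a b : open_box a b `<=` closed_box a b.
Proof. by move=> r abr i; have /andP[/ltW-> /ltW->] := abr i. Qed.

Lemma compact_closed_box a b : compact (closed_box a b).
Proof.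
have -> : closed_box a b =
    [set v : 'rV[R]_n | forall i, `[a ord0 i, b ord0 i]%classic (v ord0 i)].
  by apply/seteqP; split => r /= h i; have := h i; rewrite in_itv.
apply: (@rV_compact _ _ (fun i => `[a ord0 i, b ord0 i]%classic)) => i.
exact: segment_compact.
Qed.

Lemma measurable_bigcap_coor (I : 'I_n -> set R) :
  (forall i, measurable (I i)) ->
  measurable [set r : 'rV[R]_n | forall i, I i (r ord0 i)].
Proof.
move=> mI.
have -> : [set r : 'rV[R]_n | forall i, I i (r ord0 i)] =
    \bigcap_(i in [set: 'I_n]) [set r : 'rV[R]_n | I i (r ord0 i)].
  by apply/seteqP; split => r /= h i => [_|]; exact: h.
apply: fin_bigcap_measurable => // i _.
by rewrite -[X in measurable X]setTI; apply: measurable_coor.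
Qed.

Lemma measurable_closed_box a b : measurable (closed_box a b).
Proof.
have -> : closed_box a b =
    [set v : 'rV[R]_n | forall i, `[a ord0 i, b ord0 i]%classic (v ord0 i)].
  by apply/seteqP; split => r /= h i; have := h i; rewrite in_itv.
apply: (@measurable_bigcap_coor (fun i => `[a ord0 i, b ord0 i]%classic)) => i.
exact: measurable_itv.
Qed.

Lemma measurable_open_box a b : measurable (open_box a b).
Proof.
have -> : open_box a b =
    [set v : 'rV[R]_n | forall i, `]a ord0 i, b ord0 i[%classic (v ord0 i)].
  by apply/seteqP; split => r /= h i; have := h i; rewrite in_itv.
apply: (@measurable_bigcap_coor (fun i => `]a ord0 i, b ord0 i[%classic)) => i.
exact: measurable_itv.
Qed.

Definition rat_box (q : 'rV[rat]_n * 'rV[rat]_n) :=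
  (open_box (map_mx ratr q.1) (map_mx ratr q.2),
   closed_box (map_mx ratr q.1) (map_mx ratr q.2) : set 'rV[R]_n).

(** Keeping only boxes whose closure lies in [A] leaves room for compactly supported bumps. Rational
    corners make the family countable, which serves both the measurability of open sets and the
    almost-everywhere argument of [fundamental_lemma]. *)
Lemma open_rat_boxes A : open A ->
  A = \bigcup_(q in [set q | (rat_box q).2 `<=` A]) (rat_box q).1.
Proof.
move=> oA; apply/seteqP; split; last first.
  by move=> r [q /= qA qr]; apply/qA/open_boxW.
move=> r Ar; have /nbhs_ballP[e /= e0 eA] : nbhs r A by exact: open_nbhs_nbhs.
have hl i : {q : rat | r ord0 i - e / 2 < ratr q < r ord0 i}.
  apply/cid; have [q] := @rat_in_itvoo R (r ord0 i - e / 2) (r ord0 i)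
    ltac:(by rewrite ltrBlDr ltrDl divr_gt0).
  by rewrite in_itv => /= ?; exists q.
have hr i : {q : rat | r ord0 i < ratr q < r ord0 i + e / 2}.
  apply/cid; have [q] := @rat_in_itvoo R (r ord0 i) (r ord0 i + e / 2)
    ltac:(by rewrite ltrDl divr_gt0).
  by rewrite in_itv => /= ?; exists q.
exists (\row_i sval (hl i), \row_i sval (hr i)) => /=.
- move=> s sb; apply: eA; split => // i j; rewrite ord1 => {i}.
  have := sb j; rewrite !mxE /ball/=.
  case: (hl j) => /= q /andP[q1 q2]; case: (hr j) => /= p /andP[p1 p2].
  move=> /andP[s1 s2]; rewrite ltr_norml.
  by apply/andP; split; lra.
- move=> i; rewrite !mxE.
  case: (hl i) => /= q /andP[q1 q2]; case: (hr i) => /= p /andP[p1 p2].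
  by rewrite q2 p1.
Qed.

Lemma open_measurable_rV A : open A -> measurable A.
Proof.
move=> /open_rat_boxes ->; rewrite bigcup_mkcond.
apply: countable_bigcupT_measurable => [|q]; first exact: countableP.
by case: ifP => _; [exact: measurable_open_box|exact: measurable0].
Qed.

Lemma continuous_measurable_rV (f : 'rV[R]_n -> R) :
  continuous f -> measurable_fun [set: 'rV[R]_n] f.
Proof.
move=> /continuousP cf; apply: (measurability _ (RGenOpens.measurableE R)).
move=> _ [_ [a [b ->] <-]]; rewrite setTI; apply: open_measurable_rV.
exact/cf/interval_open.
Qed.

Lemma coor_le_norm (r : 'rV[R]_n) i : `|r ord0 i| <= `|r|.
Proof.
by rewrite [leRHS]/Num.norm /= mx_normrE; apply/bigmax_geP; right => /=; exists (ord0, i).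
Qed.

(** Open boxes are stable under intersection ([setI_closed_open_boxes]), so this generating family
    suits Dynkin's theorem in [ae_eq0_pi_system]. *)
Lemma measurable_open_boxesE :
  @measurable _ 'rV[R]_n = <<s [set open_box ab.1 ab.2 | ab in setT] >>.
Proof.
apply/seteqP; split; last first.
  apply: smallest_sub; first exact: sigma_algebra_measurable.
  by move=> _ [ab _ <-]; exact: measurable_open_box.
set G := [set open_box ab.1 ab.2 | ab in setT].
have mid : measurable_fun [set: g_sigma_algebraType G]
    (fun r : g_sigma_algebraType G => r : 'rV[R]_n).
  apply: measurable_fun_rV => i.
  apply: (measurability _ (RGenOpens.measurableE R)).
  move=> _ [_ [a [b ->] <-]]; rewrite setTI.
  (* A slab in one coordinate is unbounded; it is exhausted by boxes whose other sides are ]-k,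
     k[. *)
  pose B (k : nat) : set 'rV[R]_n := open_box
    (\row_j if j == i then a else - k%:R) (\row_j if j == i then b else k%:R).
  rewrite (_ : _ @^-1` _ = \bigcup_k B k).
    apply: bigcupT_measurable => k; apply: sub_sigma_algebra.
    by exists (\row_j if j == i then a else - k%:R,
               \row_j if j == i then b else k%:R).
  apply/seteqP; split => [r /= ari|r [k _] /= /(_ i)]; last first.
    by rewrite !mxE eqxx in_itv.
  move: ari; rewrite in_itv /= => ari.
  exists (Num.truncn `|r|).+1 => // j; rewrite !mxE; case: eqP => [-> //|_].
  rewrite -ltr_norml; apply: le_lt_trans (truncnS_gt _).
  exact: coor_le_norm.
move=> A mA; have := mid (@measurableT _ _) A mA; rewrite setTI.
exact.
Qed.

Lemma open_boxI a b a' b' : exists c e,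
  open_box a b `&` open_box a' b' = open_box c e /\
  closed_box c e `<=` closed_box a b.
Proof.
exists (\row_i Num.max (a ord0 i) (a' ord0 i)), (\row_i Num.min (b ord0 i) (b' ord0 i)).
split; last first.
  move=> r h i; have := h i.
  by rewrite !mxE ge_max le_min => /andP[/andP[h1 h2] /andP[h3 h4]]; apply/andP.
apply/seteqP; split => r /= => [[h h'] i|h].
  by rewrite !mxE gt_max lt_min; have /andP[-> ->] := h i; have /andP[-> ->] := h' i.
by split => i; have := h i; rewrite !mxE gt_max lt_min
  => /andP[/andP[h1 h2] /andP[h3 h4]]; apply/andP.
Qed.

Lemma setI_closed_open_boxes :
  setI_closed [set open_box ab.1 ab.2 | ab in setT].
Proof.
move=> _ _ [[a b] _ <-] [[a' b'] _ <-] /=.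
by have [c [e [-> _]]] := open_boxI a b a' b'; exists (c, e).
Qed.

End boxes.

Section tonelli.
Context {R : realType}.
Local Open Scope ereal_scope.

Lemma tonelli_rV n (f : 'rV[R]_n.+1 -> \bar R) :
  measurable_fun setT f -> (forall r, 0 <= f r) ->
  \int[lebesgue_measure_rV R n.+1]_r f r =
  \int[lebesgue_measure]_x \int[lebesgue_measure_rV R n]_v f (cons_rV (x, v)).
Proof.
move=> mf f0.
have mc := @measurable_cons_rV R n.
rewrite [LHS](ge0_integral_pushforward mc)// preimage_setT.
apply: (fubini_tonelli1 (f \o @cons_rV R n)); last by move=> x; exact: f0.
exact: measurableT_comp.
Qed.

Lemma tonelli_rV_swap n (f : 'rV[R]_n.+1 -> \bar R) :
  measurable_fun setT f -> (forall r, 0 <= f r) ->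
  \int[lebesgue_measure_rV R n.+1]_r f r =
  \int[lebesgue_measure_rV R n]_v \int[lebesgue_measure]_x f (cons_rV (x, v)).
Proof.
move=> mf f0; rewrite tonelli_rV//.
apply: (fubini_tonelli (f \o @cons_rV R n)); last by move=> x; exact: f0.
apply: measurableT_comp => //; exact: measurable_cons_rV.
Qed.

Lemma lebesgue_measure_closed_box n (a b : 'rV[R]_n) :
  lebesgue_measure_rV R n (closed_box a b) < +oo.
Proof.
elim: n a b => [|n IH] a b; first by rewrite /= diracE ltry.
pose a' := \row_j a ord0 (lift ord0 j); pose b' := \row_j b ord0 (lift ord0 j).
rewrite /= /cons_measure /pushforward.
rewrite (_ : _ @^-1` _ = `[a ord0 ord0, b ord0 ord0]%classic `*`
    closed_box a' b'); last first.
  apply/seteqP; split => [[x v]/= h|[x v]/= [xL vL] i].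
    split; first by have := h ord0; rewrite mxE unlift_none in_itv.
    by move=> i; have := h (lift ord0 i); rewrite !mxE liftK.
  rewrite mxE; case: unliftP => [j ->|->].
    by have := vL j; rewrite !mxE.
  by move: xL; rewrite in_itv.
rewrite product_measure1E//; last exact: measurable_closed_box.
apply: lte_mul_pinfty; [exact: measure_ge0| |exact: IH].
have abfin : (@lebesgue_measure R) `[a ord0 ord0, b ord0 ord0]%classic < +oo.
  by rewrite lebesgue_measure_itv/=; case: ifP => _; rewrite ?ltry.
by rewrite ge0_fin_numE.
Qed.

End tonelli.

(** * Inequalities for compactly supported functions of class C1 *)

Section cauchy_schwarz.
Context {d : measure_display} {T : measurableType d} {R : realType}.
Variable mu : {measure set T -> \bar R}.
Local Open Scope ereal_scope.

Lemma poweR2 (y : \bar R) : 0 <= y -> y `^ 2%R = y * y.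
Proof.
case: y => [r|_|//]; last by rewrite poweRyr// mulyy.
by rewrite lee_fin => r0; rewrite poweR_EFin powR_mulrn// expr2 EFinM.
Qed.

(** Stated with products in the extended reals, without roots, so that infinite integrals are
    covered. *)
Lemma cauchy_schwarz_integral (f g : T -> R) :
  measurable_fun setT f -> measurable_fun setT g ->
  (\int[mu]_x `|f x * g x|%:E) * (\int[mu]_x `|f x * g x|%:E) <=
  (\int[mu]_x (f x ^+ 2)%:E) * (\int[mu]_x (g x ^+ 2)%:E).
Proof.
move=> mf mg.
have N2 (h : T -> R) : 'N[mu]_2%:E[EFin \o h] * 'N[mu]_2%:E[EFin \o h] =
    \int[mu]_x (h x ^+ 2)%:E.
  rewrite -poweR2 ?Lnorm_ge0// poweR_Lnorm//; apply: eq_integral => x _ /=.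
  by rewrite powR_mulrn// -normrX ger0_norm// sqr_ge0.
have h2 : (2^-1 + 2^-1 = 1 :> R)%R by lra.
have lt02 : (0 < 2 :> R)%R by [].
have := hoelder mu mf mg lt02 lt02 h2; rewrite Lnorm1 => H.
rewrite -!N2 muleACA; apply: lee_pmul => //; exact: integral_ge0.
Qed.

End cauchy_schwarz.

Section pointwise_derivatives.
Context {R : realType} {W : normedModType R}.
Implicit Types (f g : W -> R) (x v : W).

Lemma derivable_mul f g x v : derivable f x v -> derivable g x v ->
  derivable (fun y => f y * g y) x v.
Proof. exact: derivableM. Qed.

Lemma derive_mul f g x v : derivable f x v -> derivable g x v ->
  'D_v (fun y => f y * g y) x = f x * 'D_v g x + g x * 'D_v f x.
Proof. exact: deriveM. Qed.

Lemma derivable_add f g x v : derivable f x v -> derivable g x v ->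
  derivable (fun y => f y + g y) x v.
Proof. exact: derivableD. Qed.

Lemma derive_add f g x v : derivable f x v -> derivable g x v ->
  'D_v (fun y => f y + g y) x = 'D_v f x + 'D_v g x.
Proof. exact: deriveD. Qed.

End pointwise_derivatives.

Section slices.
Context {R : realType}.

Lemma cons_rV_shift_head n (h x : R) (v : 'rV[R]_n) :
  cons_rV (h *: 1 + x, v) = h *: evec R ord0 + cons_rV (x, v).
Proof.
apply/rowP => i; rewrite !mxE eqxx/=.
by case: unliftP => [j ->|->] /=; rewrite ?mulr0 ?add0r.
Qed.

Lemma cons_rV_shift_tail n (h x : R) (j : 'I_n) (v : 'rV[R]_n) :
  cons_rV (x, h *: evec R j + v) = h *: evec R (lift ord0 j) + cons_rV (x, v).
Proof.
apply/rowP => i; rewrite !mxE eqxx/=.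
case: unliftP => [k ->|->] /=; last by rewrite mulr0 add0r.
by rewrite !mxE eqxx /= (inj_eq lift_inj).
Qed.

Lemma continuous_cons_head n (v : 'rV[R]_n) :
  continuous (fun x : R => cons_rV (x, v)).
Proof.
move=> x; apply/cvg_ballP => e e0; apply/nbhs_ballP; exists e => //= y xy.
by split=> // i j; rewrite !mxE; case: unliftP => [k _|_] //=; exact: ballxx.
Qed.

Lemma continuous_cons_tail n (x : R) :
  continuous (fun v : 'rV[R]_n => cons_rV (x, v)).
Proof.
move=> v A /nbhs_ballP[e /= e0 eA]; apply/nbhs_ballP; exists e => //= w [_ vw].
apply: eA.
split=> // i j; rewrite !mxE; case: unliftP => [k _|_] /=; last exact: ballxx.
exact: vw.
Qed.

Lemma continuous_slice_tail n (h : 'rV[R]_n.+1 -> R) x :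
  continuous h -> continuous (fun v => h (cons_rV (x, v))).
Proof.
by move=> ch v; apply: (continuous_comp (@continuous_cons_tail n x v) (ch _)).
Qed.

Lemma continuous_slice_head n (h : 'rV[R]_n.+1 -> R) v :
  continuous h -> continuous (fun x : R => h (cons_rV (x, v))).
Proof.
by move=> ch x; apply: (continuous_comp (@continuous_cons_head n v x) (ch _)).
Qed.

(** Moving the slice variable is moving the point along a basis vector: both difference quotients
    are the same function, so derivability and the value of the derivative transfer together. *)
Lemma derive_head_quotient n (f : 'rV[R]_n.+1 -> R) x v :
  (fun h : R => h^-1 *: ((f (cons_rV (h *: 1 + x, v))) - f (cons_rV (x, v)))) =
  (fun h : R => h^-1 *: ((f \o shift (cons_rV (x, v))) (h *: evec R ord0)
     - f (cons_rV (x, v)))).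
Proof. by apply/funext => h; rewrite cons_rV_shift_head. Qed.

Lemma derive_tail_quotient n (f : 'rV[R]_n.+1 -> R) x v j :
  (fun h : R => h^-1 *: ((f (cons_rV (x, h *: evec R j + v))) - f (cons_rV (x, v)))) =
  (fun h : R => h^-1 *: ((f \o shift (cons_rV (x, v))) (h *: evec R (lift ord0 j))
     - f (cons_rV (x, v)))).
Proof. by apply/funext => h; rewrite cons_rV_shift_tail. Qed.

Lemma derivable_slice_head n (f : 'rV[R]_n.+1 -> R) x v :
  derivable f (cons_rV (x, v)) (evec R ord0) ->
  derivable (fun y : R => f (cons_rV (y, v))) x 1.
Proof. by rewrite /derivable -derive_head_quotient. Qed.

Lemma derive_slice_head n (f : 'rV[R]_n.+1 -> R) x v :
  'D_1 (fun y : R => f (cons_rV (y, v))) x = 'D_(evec R ord0) f (cons_rV (x, v)).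
Proof. by rewrite /derive -derive_head_quotient. Qed.

Lemma derivable_slice_tail n (f : 'rV[R]_n.+1 -> R) x v j :
  derivable f (cons_rV (x, v)) (evec R (lift ord0 j)) ->
  derivable (fun w : 'rV[R]_n => f (cons_rV (x, w))) v (evec R j).
Proof. by rewrite /derivable -derive_tail_quotient. Qed.

Lemma derive_slice_tail n (f : 'rV[R]_n.+1 -> R) x v j :
  'D_(evec R j) (fun w : 'rV[R]_n => f (cons_rV (x, w))) v =
  'D_(evec R (lift ord0 j)) f (cons_rV (x, v)).
Proof. by rewrite /derive -derive_tail_quotient. Qed.

Definition pderiv n (i : 'I_n) (f : 'rV[R]_n -> R) : 'rV[R]_n -> R :=
  fun r => 'D_(evec R i) f r.

(** Support in a cube, expressed one coordinate at a time: fixing the first coordinate preserves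
    every clause ([C1c_slice]), which permits induction on [n]. In dimension 0 the support clauses
    are void. *)
Definition C1c (L : R) n (f : 'rV[R]_n -> R) :=
  [/\ continuous f,
      forall i r, derivable f r (evec R i),
      forall i, continuous (pderiv i f),
      forall (r : 'rV[R]_n) j, L <= `|r ord0 j| -> f r = 0 &
      forall i (r : 'rV[R]_n) j, L <= `|r ord0 j| -> pderiv i f r = 0].

Lemma pderiv_slice_tail n (f : 'rV[R]_n.+1 -> R) x j :
  pderiv j (fun w : 'rV[R]_n => f (cons_rV (x, w))) =
  fun w => pderiv (lift ord0 j) f (cons_rV (x, w)).
Proof. by apply/funext => w; exact: derive_slice_tail. Qed.

Lemma C1c_slice L n (f : 'rV[R]_n.+1 -> R) x :
  C1c L f -> C1c L (fun v => f (cons_rV (x, v))).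
Proof.
have hl (v : 'rV[R]_n) j : cons_rV (x, v) ord0 (lift ord0 j) = v ord0 j.
  by rewrite mxE liftK.
move=> [cf df cdf sf sdf]; split.
- exact: continuous_slice_tail.
- by move=> i r; apply: derivable_slice_tail; exact: df.
- move=> i; rewrite pderiv_slice_tail; exact: continuous_slice_tail.
- by move=> r j rj; apply: (sf _ (lift ord0 j)); rewrite hl.
- move=> i r j rj; rewrite pderiv_slice_tail.
  by apply: (sdf _ _ (lift ord0 j)); rewrite hl.
Qed.

Lemma C1c_measurable L n (f : 'rV[R]_n -> R) : C1c L f -> measurable_fun setT f.
Proof. by move=> [cf _ _ _ _]; exact: continuous_measurable_rV. Qed.

Lemma C1c_measurable_derive L n (f : 'rV[R]_n -> R) i :
  C1c L f -> measurable_fun setT (pderiv i f).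
Proof. by move=> [_ _ cf _ _]; exact: continuous_measurable_rV. Qed.

End slices.

Section line.
Context {R : realType}.
Implicit Type g : R -> R.
Local Notation mu := (@lebesgue_measure R).

Lemma ftc_line g g' (a b : R) : a <= b ->
  (forall x, derivable g x 1) -> (forall x, 'D_1 g x = g' x) -> continuous g' ->
  (\int[mu]_(x in `[a, b]) (g' x)%:E = (g b)%:E - (g a)%:E)%E.
Proof.
move=> + dg Dg cg; rewrite le_eqVlt => /predU1P[->|ab].
  by rewrite set_itv1 integral_set1 subee.
have cg1 : continuous g.
  by move=> x; apply/differentiable_continuous/derivable1_diffP.
apply: continuous_FTC2 => //.
- by apply: continuous_subspaceT => x; exact: cg.
- split; first by move=> x _; exact: dg.
  + by apply: cvg_at_right_filter; exact: cg1.
  + by apply: cvg_at_left_filter; exact: cg1.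
- by move=> x _; rewrite derive1E.
Qed.

(** Enlarging the domain to [A] frees the bound from the position of the endpoints: [A] is the whole
    line in [sqr_le_integral_line] and a window in [sqr_increment_le]. *)
Lemma ftc_line_abs g g' (a b : R) (A : set R) : a <= b ->
  (forall x, derivable g x 1) -> (forall x, 'D_1 g x = g' x) -> continuous g' ->
  measurable A -> `[a, b]%classic `<=` A ->
  (`|g b - g a|%:E <= \int[mu]_(x in A) `|g' x|%:E)%E.
Proof.
move=> ab dg Dg cg mA abA.
have mg : measurable_fun setT g'.
  exact: continuous_measurable_fun.
have -> : (`|g b - g a|%:E = `| \int[mu]_(x in `[a, b]) (g' x)%:E |)%E.
  by rewrite (ftc_line ab dg Dg cg) -EFinB.
apply: (le_trans (le_abse_integral _ _ _)) => //.
  by apply/measurable_EFinP; exact: measurable_funTS.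
apply: ge0_subset_integral => //.
by apply/measurable_EFinP/measurable_funTS/measurableT_comp.
Qed.

End line.

Section cauchy_schwarz_set.
Context {d : measure_display} {T : measurableType d} {R : realType}.
Variable mu : {measure set T -> \bar R}.
Local Open Scope ereal_scope.

Lemma cauchy_schwarz_integral_set (D : set T) (f g : T -> R) : measurable D ->
  measurable_fun D f -> measurable_fun D g ->
  (\int[mu]_(x in D) `|f x * g x|%:E) * (\int[mu]_(x in D) `|f x * g x|%:E) <=
  (\int[mu]_(x in D) (f x ^+ 2)%:E) * (\int[mu]_(x in D) (g x ^+ 2)%:E).
Proof.
move=> mD mf mg.
have mfD : measurable_fun setT (f \_ D) by exact: (measurable_restrictT f mD).1 mf.
have mgD : measurable_fun setT (g \_ D) by exact: (measurable_restrictT g mD).1 mg.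
have h1 : \int[mu]_(x in D) `|f x * g x|%:E =
    \int[mu]_x `|(f \_ D) x * (g \_ D) x|%:E.
  rewrite [LHS]integral_mkcond; apply: eq_integral => x _.
  by rewrite !patchE; case: ifP => _; rewrite ?mul0r ?normr0.
have h2 (h : T -> R) : \int[mu]_(x in D) (h x ^+ 2)%:E =
    \int[mu]_x ((h \_ D) x ^+ 2)%:E.
  rewrite [LHS]integral_mkcond; apply: eq_integral => x _.
  by rewrite !patchE; case: ifP => _; rewrite ?expr0n.
by rewrite h1 !h2; exact: cauchy_schwarz_integral.
Qed.

End cauchy_schwarz_set.

Section sobolev.
Context {R : realType}.
Local Notation mu := (@lebesgue_measure R).
Local Open Scope ereal_scope.

Lemma measurable_slice_head d (T : measurableType d) n (f : 'rV[R]_n.+1 -> T) v :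
  measurable_fun setT f ->
  measurable_fun setT (fun x : measurableTypeR R => f (cons_rV (x, v))).
Proof.
move=> mf; apply: (measurableT_comp mf).
by apply: (measurableT_comp (@measurable_cons_rV R n)); exact: measurable_pair2.
Qed.

(** 2 f f' is the derivative of f^2, which vanishes at - L; the integral is then extended to the
    whole line. *)
Lemma sqr_le_integral_line L n (f : 'rV[R]_n.+1 -> R) x v : C1c L f ->
  (f (cons_rV (x, v)) ^+ 2)%:E <=
  \int[mu]_t (2 * `|f (cons_rV (t, v)) * pderiv ord0 f (cons_rV (t, v))|)%:E.
Proof.
move=> fC; have [cf df cdf sf sdf] := fC.
pose f0 := fun t : R => f (cons_rV (t, v)).
have dg t : derivable f0 t 1%R by exact/derivable_slice_head/df.
(* To the left of the support no interval starting at - L reaches [x], but there [f] itself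
   vanishes. *)
have [xL|xL] := leP (x : R) (- L)%R.
  rewrite [X in (X ^+ 2)%R](sf _ ord0).
    by rewrite expr0n; apply: integral_ge0 => t _; rewrite lee_fin mulr_ge0.
  by rewrite mxE unlift_none/= ler_normr lerNr xL orbT.
pose g := fun t => (f0 t * f0 t)%R.
pose g' := fun t : R => (2 * (f0 t * pderiv ord0 f (cons_rV (t, v))))%R.
have dg2 t : derivable g t 1%R by apply: derivable_mul; exact: dg.
have Dg2 t : 'D_1%R g t = g' t.
  rewrite derive_mul; try exact: dg.
  rewrite derive_slice_head /g' /pderiv; ring.
have cg' : continuous g'.
  move=> t; apply: cvgM; first exact: cvg_cst.
  by apply: cvgM; exact: continuous_slice_head.
have := @ftc_line_abs _ g g' (- L)%R x setT (ltW xL) dg2 Dg2 cg' measurableT (@subsetT _ _).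
rewrite {1 2}/g /f0 (sf (cons_rV (- L, v)) ord0)%R; last first.
  by rewrite mxE unlift_none/= normrN ler_norm.
rewrite mulr0 subr0 -expr2 ger0_norm ?sqr_ge0// => /le_trans; apply.
by under eq_integral do rewrite /g' normrM (ger0_norm (ler0n _ 2)).
Qed.

(** Cauchy-Schwarz against the constant 1 produces the factor [h]. The integral runs over the full
    window and not only up to [t], so one bound serves all [t] of the window. *)
Lemma sqr_increment_le L n (f : 'rV[R]_n.+1 -> R) (h s t : R) v : C1c L f ->
  (s <= t <= s + h)%R ->
  ((f (cons_rV (s, v)) - f (cons_rV (t, v))) ^+ 2)%:E <=
  h%:E * \int[mu]_(x in `[s, (s + h)%R]) (pderiv ord0 f (cons_rV (x, v)) ^+ 2)%:E.
Proof.
move=> fC /andP[st tsh]; have [cf df cdf sf sdf] := fC.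
have h0 : (0 <= h)%R by rewrite -(lerDl s) (le_trans st).
have sh : (s <= s + h)%R by rewrite lerDl.
have := @ftc_line_abs _ (fun x : R => f (cons_rV (x, v)))
  (fun x : R => pderiv ord0 f (cons_rV (x, v))) s t `[s, (s + h)%R] st
  (fun x => derivable_slice_head (df _ _)) (fun x => derive_slice_head _ _ _)
  (continuous_slice_head (cdf ord0)) (measurable_itv _).
have sub : `[s, t]%classic `<=` `[s, (s + h)%R]%classic.
  by move=> y /=; rewrite !in_itv/= => /andP[-> /le_trans]; apply.
move=> /(_ sub) H.
have mp : measurable_fun `[s, (s + h)%R] (fun x => pderiv ord0 f (cons_rV (x, v))).
  apply: measurable_funTS.
  exact: (measurable_slice_head v (C1c_measurable_derive ord0 fC)).
have := @cauchy_schwarz_integral_set _ _ _ mu `[s, (s + h)%R]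
  (fun x => pderiv ord0 f (cons_rV (x, v))) (cst 1%R) (measurable_itv _) mp
  (measurable_cst _).
under eq_integral do rewrite mulr1.
rewrite [X in _ <= _ * X](_ : _ = h%:E); last first.
  under eq_integral do rewrite expr1n.
  rewrite integral_cst//= mul1e lebesgue_measure_itv/= lte_fin.
  case: ltP => [_|]; first by rewrite -EFinB addrC addKr.
  rewrite -[leRHS]addr0 lerD2l => h0'.
  by congr EFin; apply/eqP; rewrite eq_le h0.
rewrite muleC => /(le_trans _); apply.
rewrite -real_normK ?num_real// distrC expr2 EFinM.
by apply: lee_pmul.
Qed.

End sobolev.

(** * L^4 inequalities of Ladyzhenskaya type *)

Section ladyzhenskaya.
Context {R : realType}.
Local Notation mu := (@lebesgue_measure R).
Local Notation leb := (lebesgue_measure_rV R).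
Local Open Scope ereal_scope.

Lemma measurable_integral_tail n (F : 'rV[R]_n.+1 -> \bar R) :
  measurable_fun setT F -> (forall r, 0 <= F r) ->
  measurable_fun setT (fun x : measurableTypeR R => \int[leb n]_v F (cons_rV (x, v))).
Proof.
move=> mF F0.
apply: (@measurable_fun_fubini_tonelli_F _ _ _ _ _ (leb n) (F \o @cons_rV R n)).
  by apply: measurableT_comp => //; exact: measurable_cons_rV.
by move=> x; exact: F0.
Qed.

Lemma measurable_integral_head n (F : 'rV[R]_n.+1 -> \bar R) :
  measurable_fun setT F -> (forall r, 0 <= F r) ->
  measurable_fun setT (fun v : 'rV[R]_n => \int[mu]_x F (cons_rV (x, v))).
Proof.
move=> mF F0.
apply: (@measurable_fun_fubini_tonelli_G _ _ _ _ _ mu (F \o @cons_rV R n)).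
  by apply: measurableT_comp => //; exact: measurable_cons_rV.
by move=> x; exact: F0.
Qed.

Lemma measurable_slice_tail d (T : measurableType d) n (F : 'rV[R]_n.+1 -> T) (x : R) :
  measurable_fun setT F -> measurable_fun setT (fun v : 'rV[R]_n => F (cons_rV (x, v))).
Proof.
move=> mF; apply: (measurableT_comp mF).
by apply: (measurableT_comp (@measurable_cons_rV R n)); exact: measurable_pair1.
Qed.

Lemma emeasurable_fun_scale d (T : measurableType d) (k : \bar R) (g : T -> \bar R) :
  measurable_fun setT g -> measurable_fun setT (fun x => k * g x).
Proof.
by move=> mg; apply: (@emeasurable_funM _ _ _ _ (cst k) g) => //; exact: measurable_cst.
Qed.

(** The two numbers are compared instead of completing a square, because either may be infinite. *)
Lemma mule_le_sqrD (a b : \bar R) : 0 <= a -> 0 <= b -> a * b <= b * b + a * a.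
Proof.
move=> a0 b0; have [ab|/ltW ba] := leP a b.
  by apply: (@le_trans _ _ (b * b)); [exact: lee_wpmul2r|rewrite leeDl// mule_ge0].
by apply: (@le_trans _ _ (a * a)); [exact: lee_wpmul2l|rewrite leeDr// mule_ge0].
Qed.

(* Dominates the integral over the remaining coordinates of the supremum of
   [f ^ 2] along the lines of direction [i]. *)
Definition flux n (i : 'I_n) (f : 'rV[R]_n -> R) : \bar R :=
  \int[leb n]_r (2 * `|f r * pderiv i f r|)%:E.

Definition nsq n (f : 'rV[R]_n -> R) : \bar R := \int[leb n]_r (f r ^+ 2)%:E.

Lemma flux_ge0 n i (f : 'rV[R]_n -> R) : 0 <= flux i f.
Proof. by apply: integral_ge0 => r _; rewrite lee_fin mulr_ge0. Qed.

Lemma nsq_ge0 n (f : 'rV[R]_n -> R) : 0 <= nsq f.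
Proof. by apply: integral_ge0 => r _; rewrite lee_fin sqr_ge0. Qed.

Lemma flux_sq_le L n i (f : 'rV[R]_n -> R) : C1c L f ->
  flux i f * flux i f <= 4%:E * (nsq f * nsq (pderiv i f)).
Proof.
move=> fC; have mf := C1c_measurable fC; have mdf := C1c_measurable_derive i fC.
have -> : flux i f = 2%:E * \int[leb n]_r `|f r * pderiv i f r|%:E.
  rewrite /flux -ge0_integralZl_EFin//.
  by apply/measurable_EFinP/measurableT_comp => //; exact: measurable_funM.
rewrite muleACA -EFinM; have -> : (2 * 2 = 4 :> R)%R by ring.
by apply: lee_pmul => //; [apply: mule_ge0; exact: integral_ge0|exact: cauchy_schwarz_integral].
Qed.

Lemma measurable_flux_density L n i (f : 'rV[R]_n -> R) : C1c L f ->
  measurable_fun setT (fun r => (2 * `|f r * pderiv i f r|)%:E).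
Proof.
move=> fC; apply/measurable_EFinP/measurable_funM => //.
apply: measurableT_comp => //; apply: measurable_funM.
  exact: (C1c_measurable fC).
exact: (C1c_measurable_derive i fC).
Qed.

(** Each point of the slice is bounded by the integral over its line, which does not involve [x].
    This controls the supremum over all slices. *)
Lemma slice_nsq_le_flux L n (f : 'rV[R]_n.+1 -> R) x : C1c L f ->
  nsq (fun v => f (cons_rV (x, v))) <= flux ord0 f.
Proof.
move=> fC; have mF := measurable_flux_density ord0 fC.
rewrite /flux tonelli_rV_swap//.
apply: ge0_le_integral; first by [].
- by move=> v _; rewrite lee_fin sqr_ge0.
- apply/measurable_EFinP/measurable_funX.
  exact: (measurable_slice_tail x (C1c_measurable fC)).
- by apply: (measurable_integral_head mF) => r; rewrite lee_fin mulr_ge0.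
- by move=> v _; exact: sqr_le_integral_line fC.
Qed.

(** Only slices with |x| <= L carry mass, and each has mass at most the flux. Combined with
    [flux_sq_le] this becomes the Poincare inequality. *)
Lemma nsq_le_flux L n (f : 'rV[R]_n.+1 -> R) : (0 <= L)%R -> C1c L f ->
  nsq f <= (2 * L)%:E * flux ord0 f.
Proof.
move=> L0 fC; have mF := C1c_measurable fC; have [_ _ _ sf _] := fC.
rewrite /nsq tonelli_rV//; last 2 first.
  by apply/measurable_EFinP/measurable_funX.
  by move=> r; rewrite lee_fin sqr_ge0.
rewrite (_ : (fun _ => _) = (fun x => nsq (fun v => f (cons_rV (x, v)))))//.
have -> : \int[mu]_x nsq (fun v => f (cons_rV (x, v))) =
    \int[mu]_(x in `[(- L)%R, L]) nsq (fun v => f (cons_rV (x, v))).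
  rewrite [RHS]integral_mkcond; apply: eq_integral => x _.
  rewrite patchE; case: ifPn => //; rewrite notin_setE/= in_itv/= -ler_norml => /negP.
  rewrite -ltNge => /ltW xL; rewrite /nsq integral0_eq// => v _.
  by rewrite (sf _ ord0) ?expr0n// mxE unlift_none.
apply: (@le_trans _ _ (\int[mu]_(x in `[(- L)%R, L]) flux ord0 f)).
  apply: ge0_le_integral; first by [].
  - by move=> x _; exact: nsq_ge0.
  - apply: measurable_funTS; apply: (@measurable_integral_tail n (fun r => (f r ^+ 2)%:E)).
      exact/measurable_EFinP/measurable_funX.
    by move=> r; rewrite lee_fin sqr_ge0.
  - exact: measurable_cst.
  - by move=> x _; exact: slice_nsq_le_flux fC.
rewrite integral_cst//= lebesgue_measure_itv/= muleC lte_fin.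
case: ltP => [_|_]; last by rewrite mul0e mule_ge0 ?flux_ge0// lee_fin mulr_ge0.
by rewrite -EFinB opprK mulr_natl mulr2n.
Qed.

(** One factor f^2 is replaced by a bound that is constant on the slice; the other is integrated
    over the slice, uniformly in [x], by [slice_nsq_le_flux]. *)
Lemma integral4_le L n (f : 'rV[R]_n.+1 -> R) (B : R -> \bar R) : C1c L f ->
  measurable_fun setT B ->
  (forall x v, (f (cons_rV (x, v)) ^+ 2)%:E <= B x) ->
  \int[leb n.+1]_r (f r ^+ 4)%:E <= (\int[mu]_x B x) * flux ord0 f.
Proof.
move=> fC mB fB; have mf := C1c_measurable fC.
have B0 x : 0 <= B x.
  by apply: le_trans (fB x 0%R); rewrite lee_fin sqr_ge0.
have e4 (y : R) : (0 <= y ^+ 4)%R by rewrite -[4%N]/(2 * 2)%N exprM sqr_ge0.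
rewrite tonelli_rV; last 2 first.
  by apply/measurable_EFinP/measurable_funX.
  by move=> r; rewrite lee_fin.
rewrite muleC -ge0_integralZl//; last exact: flux_ge0.
apply: ge0_le_integral; first by [].
- by move=> x _; apply: integral_ge0 => v _; rewrite lee_fin.
- apply: (@measurable_integral_tail n (fun r => (f r ^+ 4)%:E)).
    exact/measurable_EFinP/measurable_funX.
  by move=> r; rewrite lee_fin.
- exact: emeasurable_fun_scale.
move=> x _; rewrite muleC.
apply: (@le_trans _ _ (B x * nsq (fun v => f (cons_rV (x, v))))).
  have msq : measurable_fun setT (fun v : 'rV[R]_n => (f (cons_rV (x, v)) ^+ 2)%:E).
    apply/measurable_EFinP/measurable_funX.
    exact: (measurable_slice_tail x mf).
  rewrite /nsq -ge0_integralZl//; last by move=> v _; rewrite lee_fin sqr_ge0.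
  apply: ge0_le_integral; first by [].
  - by move=> v _; rewrite lee_fin.
  - by apply/measurable_EFinP/measurable_funX; exact: (measurable_slice_tail x mf).
  - exact: emeasurable_fun_scale.
  - move=> v _; rewrite -[4%N]/(2 + 2)%N exprD EFinM lee_pmul// ?lee_fin ?sqr_ge0//.
by apply: lee_pmul => //; [exact: nsq_ge0|exact: slice_nsq_le_flux fC].
Qed.

Lemma sqr_le_flux1 L (f : 'rV[R]_1 -> R) r : C1c L f ->
  (f r ^+ 2)%:E <= flux ord0 f.
Proof.
move=> fC.
have -> : r = cons_rV (r ord0 ord0, 0%R : 'rV[R]_0).
  by apply/rowP => i; rewrite mxE ord1 unlift_none.
apply: (le_trans (sqr_le_integral_line _ _ fC)).
rewrite /flux tonelli_rV//.
- apply: ge0_le_integral; first by [].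
  + by move=> x _; rewrite lee_fin mulr_ge0.
  + have /measurable_EFinP m2 := measurable_flux_density ord0 fC.
    apply/measurable_EFinP. exact: (measurable_slice_head (0%R:'rV[R]_0) m2).
  + by apply: (measurable_integral_tail (measurable_flux_density ord0 fC)) => q; rewrite lee_fin mulr_ge0.
  + move=> x _.
    rewrite [leRHS]/= integral_dirac//; first by rewrite diracE in_setT mul1e.
    exact: (measurable_slice_tail x (measurable_flux_density ord0 fC)).
- exact: measurable_flux_density fC.
Qed.

(** In the plane a slice is a function of one variable, whose squared supremum is at most its own
    flux; these fluxes integrate to the flux of [f] in the second direction. *)
Lemma integral4_le2 L (f : 'rV[R]_2 -> R) : C1c L f ->
  \int[leb 2]_r (f r ^+ 4)%:E <= flux (lift ord0 ord0) f * flux ord0 f.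
Proof.
move=> fC; have mF := measurable_flux_density (lift ord0 ord0) fC.
have F0 (r : 'rV[R]_2) : 0 <= (2 * `|f r * pderiv (lift ord0 ord0) f r|)%:E.
  by rewrite lee_fin mulr_ge0.
apply: (le_trans (integral4_le (B := fun x => flux ord0 (fun v : 'rV[R]_1 => f (cons_rV (x, v)))) fC _ _)).
- rewrite /flux; under eq_fun do rewrite pderiv_slice_tail.
  exact: (measurable_integral_tail mF F0).
- by move=> x v; exact: sqr_le_flux1 (C1c_slice x fC).
- apply: lee_pmul => //; [by apply: integral_ge0 => x _; exact: flux_ge0|exact: flux_ge0|].
  suff -> : flux (lift ord0 ord0) f =
      \int[mu]_x flux ord0 (fun v : 'rV[R]_1 => f (cons_rV (x, v))) by [].
  rewrite [LHS](tonelli_rV mF F0); apply: eq_integral => x _.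
  by rewrite /flux pderiv_slice_tail.
Qed.

(** The planar inequality on a slice yields a product of two fluxes, hence the mass of the slice
    times its gradient energy. The mass is at most the flux across the slices, and the gradient
    energies integrate to the two other derivatives. *)
Lemma integral4_le3 L (f : 'rV[R]_3 -> R) : C1c L f ->
  \int[leb 3]_r (f r ^+ 4)%:E <= 4%:E * flux ord0 f *
   (nsq (pderiv (lift ord0 ord0) f) + nsq (pderiv (lift ord0 (lift ord0 ord0)) f)).
Proof.
move=> fC; have mf := C1c_measurable fC.
have md i := C1c_measurable_derive i fC.
have e4 (y : R) : (0 <= y ^+ 4)%R by rewrite -[4%N]/(2 * 2)%N exprM sqr_ge0.
pose G i x := nsq (fun v => pderiv (lift ord0 i) f (cons_rV (x, v))).
have mG i : measurable_fun setT (G i).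
  apply: (@measurable_integral_tail 2 (fun r => (pderiv (lift ord0 i) f r ^+ 2)%:E)).
    by apply/measurable_EFinP/measurable_funX; exact: md.
  by move=> r; rewrite lee_fin sqr_ge0.
have G0 i x : 0 <= G i x by exact: nsq_ge0.
have nsqG i : nsq (pderiv (lift ord0 i) f) = \int[mu]_x G i x.
  rewrite /nsq tonelli_rV//; first by apply/measurable_EFinP/measurable_funX; exact: md.
  by move=> r; rewrite lee_fin sqr_ge0.
rewrite !nsqG -ge0_integralD// -ge0_integralZl//; last 3 first.
- exact: emeasurable_funD.
- by move=> x _; exact: adde_ge0.
- by apply: mule_ge0 => //; exact: flux_ge0.
rewrite tonelli_rV; last 2 first.
  by apply/measurable_EFinP/measurable_funX.
  by move=> r; rewrite lee_fin.
apply: ge0_le_integral; first by [].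
- by move=> x _; apply: integral_ge0 => v _; rewrite lee_fin.
- apply: (@measurable_integral_tail 2 (fun r => (f r ^+ 4)%:E)).
    exact/measurable_EFinP/measurable_funX.
  by move=> r; rewrite lee_fin.
- by apply: emeasurable_fun_scale; exact: emeasurable_funD.
move=> x _; have fxC := C1c_slice x fC.
apply: (le_trans (integral4_le2 fxC)).
apply: (le_trans (mule_le_sqrD (flux_ge0 _ _) (flux_ge0 _ _))).
apply: (le_trans (leeD (flux_sq_le _ fxC) (flux_sq_le _ fxC))).
rewrite !pderiv_slice_tail -/(G ord0 x) -/(G (lift ord0 ord0) x).
set N := nsq _.
have N0 : 0 <= N by exact: nsq_ge0.
rewrite -ge0_muleDr ?mule_ge0// -ge0_muleDr// -muleA.
apply: lee_wpmul2l => //; apply: lee_wpmul2r; first exact: adde_ge0.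
exact: (slice_nsq_le_flux x fC).
Qed.

End ladyzhenskaya.

(** * Mean square increments over windows *)

Section window_kernel.
Context {R : realType}.
Local Notation mu := (@lebesgue_measure R).
Local Notation leb := (lebesgue_measure_rV R).
Variable h : R.
Hypothesis h0 : 0 < h.

Definition window (s t : R) : R := if s <= t <= s + h then h^-1 else 0.

(* The density in [w] of the uniform law on the cube [v + [0, h]^n]. *)
Definition window_rV n (v w : 'rV[R]_n) : R :=
  \prod_(i < n) window (v ord0 i) (w ord0 i).

Lemma window_ge0 s t : 0 <= window s t.
Proof. by rewrite /window; case: ifP => // _; rewrite invr_ge0 ltW. Qed.

Lemma window_rV_ge0 n (v w : 'rV[R]_n) : 0 <= window_rV v w.
Proof. by apply: prodr_ge0 => i _; exact: window_ge0. Qed.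

Lemma window_rV_cons n s t (v w : 'rV[R]_n) :
  window_rV (cons_rV (s, v)) (cons_rV (t, w)) = window s t * window_rV v w.
Proof.
rewrite /window_rV big_ord_recl !mxE unlift_none; congr (_ * _).
by apply: eq_bigr => i _; rewrite !mxE liftK.
Qed.

Lemma measurable_window d (T : measurableType d) (a b : T -> R) :
  measurable_fun setT a -> measurable_fun setT b ->
  measurable_fun setT (fun x => window (a x) (b x)).
Proof.
move=> ma mb; apply: measurable_fun_ifT => //.
apply: measurable_and; first exact: measurable_fun_ler.
by apply: measurable_fun_ler => //; exact: measurable_funD.
Qed.

Lemma measurable_window_rV d (T : measurableType d) n (a b : T -> 'rV[R]_n) :
  measurable_fun setT a -> measurable_fun setT b ->
  measurable_fun setT (fun x => window_rV (a x) (b x)).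
Proof.
move=> ma mb; apply: measurable_prod => i _; apply: measurable_window.
  exact: (measurableT_comp (measurable_coor i) ma).
exact: (measurableT_comp (measurable_coor i) mb).
Qed.

Local Open Scope ereal_scope.

Lemma integral_window_l s (G : R -> \bar R) :
  \int[mu]_t ((window s t)%:E * G t) = \int[mu]_(t in `[s, (s + h)%R]) (h^-1%:E * G t).
Proof.
rewrite [RHS]integral_mkcond; apply: eq_integral => t _; rewrite patchE /window.
case: ifPn => st; first by rewrite ifT// inE/= in_itv.
by rewrite mul0e ifF//; apply/negP; rewrite inE/= in_itv/=; exact/negP.
Qed.

Lemma lebesgue_measure_window (s : R) : mu `[s, (s + h)%R]%classic = h%:E.
Proof.
by rewrite lebesgue_measure_itv/= lte_fin ltrDl h0 -EFinB addrC addKr.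
Qed.

Lemma integral_window s : \int[mu]_t (window s t)%:E = 1.
Proof.
transitivity (\int[mu]_t ((window s t)%:E * cst 1 t)).
  by apply: eq_integral => t _; rewrite mule1.
rewrite (integral_window_l s (cst 1)) /=; under eq_integral do rewrite mule1.
rewrite integral_cst//=.
by rewrite [X in _ * X]lebesgue_measure_window -EFinM mulVf// gt_eqF.
Qed.

(** As a function of [s], [window s t] is the window that starts at t - h. *)
Lemma integral_window_swap t : \int[mu]_s (window s t)%:E = 1.
Proof.
rewrite -(integral_window (t - h)); apply: eq_integral => s _; congr EFin.
rewrite /window; congr (if _ then _ else _).
by rewrite subrK lerBlDr andbC.
Qed.

Lemma integral_window_rV n (v : 'rV[R]_n) : \int[leb n]_w (window_rV v w)%:E = 1.
Proof.
elim: n v => [|n IH] v.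
  rewrite integral_dirac//; last by apply/measurable_EFinP; exact: measurable_window_rV.
  by rewrite diracE in_setT /window_rV big_ord0 mule1.
have -> : v = cons_rV (v ord0 ord0, \row_j v ord0 (lift ord0 j)).
  by apply/rowP => i; rewrite mxE; case: unliftP => [j ->|->]; rewrite ?mxE.
rewrite tonelli_rV; last 2 first.
- by apply/measurable_EFinP/measurable_window_rV.
- by move=> r; rewrite lee_fin window_rV_ge0.
rewrite -(integral_window (v ord0 ord0)); apply: eq_integral => t _.
under eq_integral do rewrite window_rV_cons EFinM.
rewrite ge0_integralZl//.
- by rewrite IH mule1.
- by apply/measurable_EFinP/measurable_window_rV.
- by move=> w _; rewrite lee_fin window_rV_ge0.
- by rewrite lee_fin window_ge0.
Qed.

Lemma integral_window_transport (G : R -> \bar R) :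
  measurable_fun setT G -> (forall t, 0 <= G t) ->
  \int[mu]_s \int[mu]_t ((window s t)%:E * G t) = \int[mu]_t G t.
Proof.
move=> mG G0.
rewrite (fubini_tonelli (m1 := mu) (m2 := mu) (fun p => (window p.1 p.2)%:E * G p.2)).
- apply: eq_integral => t _ /=; rewrite ge0_integralZr//.
  + by rewrite integral_window_swap mul1e.
  + by apply/measurable_EFinP/measurable_window.
  + by move=> s _; rewrite lee_fin window_ge0.
- apply: emeasurable_funM; first exact/measurable_EFinP/measurable_window.
  exact: (measurableT_comp mG).
- by move=> p; rewrite mule_ge0// lee_fin window_ge0.
Qed.

(** One factor h comes from [sqr_increment_le]. The other appears when the integral over [s, s + h]
    is written as h times a window average, whose integral in [s] is the full integral. *)
Lemma window_increment_line L n (f : 'rV[R]_n.+1 -> R) v : C1c L f ->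
  \int[mu]_s \int[mu]_t
    (window s t * (f (cons_rV (s, v)) - f (cons_rV (t, v))) ^+ 2)%:E <=
  (h ^+ 2)%:E * \int[mu]_x (pderiv ord0 f (cons_rV (x, v)) ^+ 2)%:E.
Proof.
move=> fC.
pose G x := (pderiv ord0 f (cons_rV (x, v)) ^+ 2)%:E.
have G0 x : 0 <= G x by rewrite lee_fin sqr_ge0.
have mp : measurable_fun setT (fun x : measurableTypeR R => pderiv ord0 f (cons_rV (x, v))).
  exact: (measurable_slice_head v (C1c_measurable_derive ord0 fC)).
have mf : measurable_fun setT (fun x : measurableTypeR R => f (cons_rV (x, v))).
  exact: (measurable_slice_head v (C1c_measurable fC)).
have mG : measurable_fun setT G by exact/measurable_EFinP/measurable_funX.
have -> : \int[mu]_x (pderiv ord0 f (cons_rV (x, v)) ^+ 2)%:E =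
    \int[mu]_s \int[mu]_t ((window s t)%:E * G t).
  by rewrite integral_window_transport.
have mK : measurable_fun setT (fun s : measurableTypeR R =>
    \int[mu]_t ((window s t)%:E * G t)).
  apply: (@measurable_fun_fubini_tonelli_F _ _ _ _ _ mu
      (fun p : measurableTypeR R * measurableTypeR R => (window p.1 p.2)%:E * G p.2)).
    apply: emeasurable_funM; first exact/measurable_EFinP/measurable_window.
    exact: (measurableT_comp mG).
  by move=> p; rewrite mule_ge0// lee_fin window_ge0.
rewrite -ge0_integralZl ?lee_fin ?sqr_ge0//; last first.
  by move=> s _; apply: integral_ge0 => t _; rewrite mule_ge0// lee_fin window_ge0.
apply: ge0_le_integral; first by [].
- move=> s _; apply: integral_ge0 => t _.
  by rewrite lee_fin mulr_ge0 ?window_ge0 ?sqr_ge0.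
- apply: (@measurable_fun_fubini_tonelli_F _ _ _ _ _ mu
    (fun p : measurableTypeR R * measurableTypeR R => (window p.1 p.2 *
    (f (cons_rV (p.1, v)) - f (cons_rV (p.2, v))) ^+ 2)%:E)).
    apply/measurable_EFinP/measurable_funM; first exact: measurable_window.
    apply/measurable_funX/measurable_funB.
      exact: (measurableT_comp mf).
    exact: (measurableT_comp mf).
  by move=> p; rewrite lee_fin mulr_ge0 ?window_ge0 ?sqr_ge0.
- exact: emeasurable_fun_scale.
move=> s _; rewrite integral_window_l.
set I := \int[mu]_(x in `[s, (s + h)%R]) G x.
have -> : (h ^+ 2)%:E * \int[mu]_(t in `[s, (s + h)%R]) (h^-1%:E * G t) = h%:E * I.
  rewrite ge0_integralZl//.
  - by rewrite muleA -EFinM expr2 mulfK ?gt_eqF.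
  - exact: measurable_funTS.
  - by rewrite lee_fin invr_ge0 ltW.
have I0 : 0 <= I by exact: integral_ge0.
(* On the window the squared increment is at most h I, off the window the kernel is 0; the mass 1 of
   the kernel then removes the integral. *)
apply: (@le_trans _ _ (\int[mu]_t ((h%:E * I) * (window s t)%:E))).
  apply: ge0_le_integral; first by [].
  - by move=> t _; rewrite lee_fin mulr_ge0 ?window_ge0 ?sqr_ge0.
  - apply/measurable_EFinP/measurable_funM; first exact: measurable_window.
    by apply/measurable_funX/measurable_funB.
  - by apply: emeasurable_fun_scale; exact/measurable_EFinP/measurable_window.
  - move=> t _; rewrite EFinM muleC /window; case: ifPn => [st|_]; last by rewrite !mule0.
    apply: lee_wpmul2r.
      by rewrite lee_fin invr_ge0 ltW.
    exact: (sqr_increment_le v fC st).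
rewrite ge0_integralZl//.
- by rewrite integral_window mule1.
- exact/measurable_EFinP/measurable_window.
- by move=> t _; rewrite lee_fin window_ge0.
- by rewrite mule_ge0// lee_fin ltW.
Qed.

End window_kernel.

Section window_increment.
Context {R : realType}.
Local Notation mu := (@lebesgue_measure R).
Local Notation leb := (lebesgue_measure_rV R).
Variable h : R.
Hypothesis h0 : 0 < h.
Local Notation window := (window h).
Local Notation window_rV := (window_rV h).
Local Open Scope ereal_scope.

Definition window_energy n (f : 'rV[R]_n -> R) : \bar R :=
  \int[leb n]_v \int[leb n]_w (window_rV v w * (f v - f w) ^+ 2)%:E.

Lemma measurable_window_density d (T : measurableType d) n
    (a b : T -> 'rV[R]_n) (p q : T -> R) :
  measurable_fun setT p -> measurable_fun setT q ->
  measurable_fun setT a -> measurable_fun setT b ->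
  measurable_fun setT (fun x => (window_rV (a x) (b x) * (p x - q x) ^+ 2)%:E).
Proof.
move=> mp mq ma mb; apply/measurable_EFinP/measurable_funM.
  exact: measurable_window_rV.
by apply/measurable_funX/measurable_funB.
Qed.

Lemma measurable_comp_cons d (T : measurableType d) n (f : 'rV[R]_n.+1 -> R)
    (a : T -> measurableTypeR R) (b : T -> 'rV[R]_n) :
  measurable_fun setT f -> measurable_fun setT a -> measurable_fun setT b ->
  measurable_fun setT (fun x => f (cons_rV (a x, b x))).
Proof.
move=> mf ma mb; apply: (measurableT_comp mf).
apply: (measurableT_comp (@measurable_cons_rV R n)).
exact/measurable_fun_pairP.
Qed.

(** The increment from (s, v) to (t, w) is split at (t, v): one part moves the first coordinate
    only, the other stays in the slice at [t]. The squares cost a factor 2. *)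
Lemma window_inner_le L n (f : 'rV[R]_n.+1 -> R) s t v : C1c L f ->
  \int[leb n]_w (window_rV (cons_rV (s, v)) (cons_rV (t, w)) *
    (f (cons_rV (s, v)) - f (cons_rV (t, w))) ^+ 2)%:E <=
  2%:E * (window s t * (f (cons_rV (s, v)) - f (cons_rV (t, v))) ^+ 2)%:E +
  2%:E * ((window s t)%:E * \int[leb n]_w
    (window_rV v w * (f (cons_rV (t, v)) - f (cons_rV (t, w))) ^+ 2)%:E).
Proof.
move=> fC; have mf := C1c_measurable fC.
have mft : measurable_fun setT (fun w : 'rV[R]_n => f (cons_rV (t, w))).
  exact: measurable_slice_tail.
set a := f (cons_rV (s, v)); set b := f (cons_rV (t, v)).
have W0 := window_ge0 h0 s t.
have mk : measurable_fun setT (fun w : 'rV[R]_n => window_rV v w).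
  exact: measurable_window_rV.
have mD : measurable_fun setT
    (fun w : 'rV[R]_n => (window_rV v w * (b - f (cons_rV (t, w))) ^+ 2)%:E).
  exact: measurable_window_density.
apply: (@le_trans _ _ (\int[leb n]_w (
    (2 * (window s t * (a - b) ^+ 2))%:E * (window_rV v w)%:E +
    (2 * window s t)%:E * (window_rV v w * (b - f (cons_rV (t, w))) ^+ 2)%:E))).
  apply: ge0_le_integral; first by [].
  - move=> w _.
    by rewrite lee_fin mulr_ge0 ?window_rV_ge0 ?sqr_ge0.
  - apply: measurable_window_density => //.
    exact: (measurable_slice_tail t (F := @id 'rV[R]_n.+1)).
  - apply: emeasurable_funD; apply: emeasurable_fun_scale => //.
    exact/measurable_EFinP.
  - move=> w _; rewrite window_rV_cons -!EFinM -EFinD lee_fin.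
    set c := f _; set k := window_rV v w.
    have k0 : (0 <= k)%R by exact: window_rV_ge0.
    have Wk : (0 <= window s t * k)%R by exact: mulr_ge0.
    (* (a - 2 b + c)^2 is exactly 2 (a - b)^2 + 2 (b - c)^2 - (a - c)^2. *)
    have : (0 <= window s t * k * (a - 2 * b + c) ^+ 2)%R by rewrite mulr_ge0// sqr_ge0.
    nra.
rewrite ge0_integralD//.
- rewrite ge0_integralZl//.
  + rewrite integral_window_rV// mule1 leeD//.
    rewrite ge0_integralZl//.
    * by rewrite EFinM muleA.
    * by move=> w _; rewrite lee_fin mulr_ge0 ?window_rV_ge0 ?sqr_ge0.
    * by rewrite lee_fin mulr_ge0.
  + exact/measurable_EFinP.
  + by move=> w _; rewrite lee_fin window_rV_ge0.
  + by rewrite lee_fin mulr_ge0// mulr_ge0// sqr_ge0.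
- by move=> w _; rewrite mule_ge0// lee_fin ?window_rV_ge0// mulr_ge0// mulr_ge0// sqr_ge0.
- by apply: emeasurable_fun_scale; exact/measurable_EFinP.
- by move=> w _; rewrite mule_ge0// lee_fin mulr_ge0// ?window_rV_ge0// sqr_ge0.
- exact: emeasurable_fun_scale.
Qed.

Lemma nsq_slice L n (f : 'rV[R]_n.+1 -> R) (i : 'I_n) : C1c L f ->
  \int[mu]_t nsq (pderiv i (fun v => f (cons_rV (t, v)))) =
  nsq (pderiv (lift ord0 i) f).
Proof.
move=> fC; rewrite [RHS](@tonelli_rV _ _ (fun r => (pderiv (lift ord0 i) f r ^+ 2)%:E)).
- by apply: eq_integral => t _; rewrite pderiv_slice_tail.
- by apply/measurable_EFinP/measurable_funX; exact: (C1c_measurable_derive (lift ord0 i) fC).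
- by move=> r; rewrite lee_fin sqr_ge0.
Qed.

Lemma measurable_nsq_slice L n (f : 'rV[R]_n.+1 -> R) (i : 'I_n) : C1c L f ->
  measurable_fun setT (fun t : measurableTypeR R => nsq (pderiv i (fun v => f (cons_rV (t, v))))).
Proof.
move=> fC; under eq_fun do rewrite pderiv_slice_tail.
apply: (@measurable_integral_tail _ _ (fun r => (pderiv (lift ord0 i) f r ^+ 2)%:E)).
  by apply/measurable_EFinP/measurable_funX; exact: (C1c_measurable_derive (lift ord0 i) fC).
by move=> r; rewrite lee_fin sqr_ge0.
Qed.

(** The coordinates are moved one at a time, and each split of the increment doubles the bound,
    whence 2^n. The power of h stays at 2 because the kernel has mass 1 in the coordinates that are
    not moved. *)
Lemma window_energy_le L n (f : 'rV[R]_n -> R) : C1c L f ->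
  window_energy f <= (2 ^+ n * h ^+ 2)%:E * \sum_(i < n) nsq (pderiv i f).
Proof.
elim: n f => [|n IH] f fC.
  rewrite big_ord0 mule0 /window_energy integral0_eq// => v _.
  rewrite integral0_eq// => w _.
  by rewrite (_ : v = w) ?subrr ?expr0n ?mulr0//; apply/rowP => -[].
have mf := C1c_measurable fC.
have mft t : measurable_fun setT (fun w : 'rV[R]_n => f (cons_rV (t, w))).
  exact: measurable_slice_tail.
have mfs (v : 'rV[R]_n) : measurable_fun setT (fun s : measurableTypeR R => f (cons_rV (s, v))).
  exact: measurable_slice_head.
pose H t v := \int[leb n]_w
    (window_rV v w * (f (cons_rV (t, v)) - f (cons_rV (t, w))) ^+ 2)%:E.
have H0 t v : 0 <= H t v.
  by apply: integral_ge0 => w _; rewrite lee_fin mulr_ge0 ?window_rV_ge0 ?sqr_ge0.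
have mH : measurable_fun setT (fun p : measurableTypeR R * 'rV[R]_n => H p.1 p.2).
  apply: (@measurable_fun_fubini_tonelli_F _ _ _ _ _ (leb n)
    (fun p : (measurableTypeR R * 'rV[R]_n) * 'rV[R]_n => (window_rV p.1.2 p.2 *
    (f (cons_rV (p.1.1, p.1.2)) - f (cons_rV (p.1.1, p.2))) ^+ 2)%:E)); last first.
    by move=> p; rewrite lee_fin mulr_ge0 ?window_rV_ge0 ?sqr_ge0.
  apply: measurable_window_density.
  - apply: measurable_comp_cons => //.
      exact: (measurableT_comp measurable_fst measurable_fst).
    exact: (measurableT_comp measurable_snd measurable_fst).
  - apply: measurable_comp_cons => //.
    exact: (measurableT_comp measurable_fst measurable_fst).
  - exact: (measurableT_comp measurable_snd measurable_fst).
  - exact: measurable_snd.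
have mHt v : measurable_fun setT (fun t : measurableTypeR R => H t v).
  exact: (measurableT_comp mH (measurable_pair2 v)).
pose K v s t := (window s t * (f (cons_rV (s, v)) - f (cons_rV (t, v))) ^+ 2)%:E.
have K0 v s t : 0 <= K v s t.
  by rewrite lee_fin mulr_ge0 ?window_ge0 ?sqr_ge0.
have mK : measurable_fun setT (fun p : ('rV[R]_n * measurableTypeR R) * measurableTypeR R =>
    K p.1.1 p.1.2 p.2).
  apply/measurable_EFinP/measurable_funM.
    apply: measurable_window; last exact: measurable_snd.
    exact: (measurableT_comp measurable_snd measurable_fst).
  apply/measurable_funX/measurable_funB.
    apply: measurable_comp_cons => //.
      exact: (measurableT_comp measurable_snd measurable_fst).
    exact: (measurableT_comp measurable_fst measurable_fst).
  apply: measurable_comp_cons => //.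
  exact: (measurableT_comp measurable_fst measurable_fst).
have mKvs v s : measurable_fun setT (fun t : measurableTypeR R => K v s t).
  exact: (measurableT_comp mK (measurable_pair1 (v, s))).
(* [B1] collects the increments in the first coordinate, [B2] those inside the slice at [t],
   averaged over [t]. *)
pose B1 v s := \int[mu]_t K v s t.
pose B2 v s := \int[mu]_t ((window s t)%:E * H t v).
have mB1 : measurable_fun setT (fun p : 'rV[R]_n * measurableTypeR R => B1 p.1 p.2).
  exact: (@measurable_fun_fubini_tonelli_F _ _ _ _ _ mu _ mK (fun _ => K0 _ _ _)).
have mB2 v : measurable_fun setT (fun s : measurableTypeR R => B2 v s).
  apply: (@measurable_fun_fubini_tonelli_F _ _ _ _ _ mu
    (fun p : measurableTypeR R * measurableTypeR R => (window p.1 p.2)%:E * H p.2 v)).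
    apply: emeasurable_funM; first exact/measurable_EFinP/measurable_window.
    exact: (measurableT_comp (mHt v) measurable_snd).
  by move=> p; rewrite mule_ge0// lee_fin window_ge0.
have B10 v s : 0 <= B1 v s by exact: integral_ge0.
have B20 v s : 0 <= B2 v s.
  by apply: integral_ge0 => t _; rewrite mule_ge0// lee_fin window_ge0.
have inner_le s v : \int[leb n.+1]_r (window_rV (cons_rV (s, v)) r *
    (f (cons_rV (s, v)) - f r) ^+ 2)%:E <= 2%:E * B1 v s + 2%:E * B2 v s.
  have mr : measurable_fun setT (fun r => (window_rV (cons_rV (s, v)) r *
      (f (cons_rV (s, v)) - f r) ^+ 2)%:E) by exact: measurable_window_density.
  have r0 r : 0 <= (window_rV (cons_rV (s, v)) r * (f (cons_rV (s, v)) - f r) ^+ 2)%:E.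
    by rewrite lee_fin mulr_ge0 ?window_rV_ge0 ?sqr_ge0.
  have mWH : measurable_fun setT (fun t : measurableTypeR R => (window s t)%:E * H t v).
    by apply: emeasurable_funM => //; exact/measurable_EFinP/measurable_window.
  have WH0 t : 0 <= (window s t)%:E * H t v by rewrite mule_ge0// lee_fin window_ge0.
  rewrite tonelli_rV// -!ge0_integralZl// -ge0_integralD//; last 4 first.
  - by move=> t _; exact: mule_ge0.
  - exact: emeasurable_fun_scale.
  - by move=> t _; exact: mule_ge0.
  - exact: emeasurable_fun_scale.
  apply: ge0_le_integral; first by [].
  - by move=> t _; apply: integral_ge0.
  - exact: (measurable_integral_tail mr r0).
  - by apply: emeasurable_funD; exact: emeasurable_fun_scale.
  - by move=> t _; exact: (window_inner_le s t v fC).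
pose A v := \int[mu]_x (pderiv ord0 f (cons_rV (x, v)) ^+ 2)%:E.
have A0 v : 0 <= A v by apply: integral_ge0 => x _; rewrite lee_fin sqr_ge0.
have mA : measurable_fun setT A.
  apply: (@measurable_integral_head _ _ (fun r => (pderiv ord0 f r ^+ 2)%:E)).
    by apply/measurable_EFinP/measurable_funX; exact: (C1c_measurable_derive ord0 fC).
  by move=> r; rewrite lee_fin sqr_ge0.
pose M v := \int[mu]_t H t v.
have M0 v : 0 <= M v by exact: integral_ge0.
have mM : measurable_fun setT M.
  exact: (@measurable_fun_fubini_tonelli_G _ _ _ _ _ mu _ mH (fun _ => H0 _ _)).
have outer_le : window_energy f <=
    \int[leb n]_v (2%:E * ((h ^+ 2)%:E * A v) + 2%:E * M v).
  have mD : measurable_fun setT (fun p : 'rV[R]_n.+1 * 'rV[R]_n.+1 =>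
      (window_rV p.1 p.2 * (f p.1 - f p.2) ^+ 2)%:E).
    apply: measurable_window_density; try exact: measurable_fst; try exact: measurable_snd.
      exact: (measurableT_comp mf measurable_fst).
    exact: (measurableT_comp mf measurable_snd).
  have D0 (p : 'rV[R]_n.+1 * 'rV[R]_n.+1) : 0 <= (window_rV p.1 p.2 * (f p.1 - f p.2) ^+ 2)%:E.
    by rewrite lee_fin mulr_ge0 ?window_rV_ge0 ?sqr_ge0.
  have mI : measurable_fun setT (fun r : 'rV[R]_n.+1 => \int[leb n.+1]_q
      (window_rV r q * (f r - f q) ^+ 2)%:E).
    exact: (@measurable_fun_fubini_tonelli_F _ _ _ _ _ (leb n.+1) _ mD D0).
  have I0 (r : 'rV[R]_n.+1) : 0 <= \int[leb n.+1]_q (window_rV r q * (f r - f q) ^+ 2)%:E.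
    by apply: integral_ge0 => q _; exact: (D0 (r, q)).
  rewrite /window_energy (tonelli_rV_swap mI I0).
  apply: ge0_le_integral; first by [].
  - by move=> v _; apply: integral_ge0.
  - exact: (measurable_integral_head mI I0).
  - apply: emeasurable_funD; apply: emeasurable_fun_scale => //.
    exact: emeasurable_fun_scale.
  move=> v _.
  have mB1v : measurable_fun setT (fun s : measurableTypeR R => B1 v s).
    exact: (measurableT_comp mB1 (measurable_pair1 v)).
  apply: (@le_trans _ _ (\int[mu]_s (2%:E * B1 v s + 2%:E * B2 v s))).
    apply: ge0_le_integral; first by [].
    - by [].
    - exact: (measurable_slice_head v mI).
    - by apply: emeasurable_funD; exact: emeasurable_fun_scale.
    - by move=> s _; exact: inner_le.
  rewrite ge0_integralD//; last 4 first.
  - by move=> s _; exact: mule_ge0.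
  - exact: emeasurable_fun_scale.
  - by move=> s _; exact: mule_ge0.
  - exact: emeasurable_fun_scale.
  rewrite !ge0_integralZl//; apply: leeD; apply: lee_wpmul2l => //.
    exact: (window_increment_line h0 v fC).
  by rewrite /B2 (integral_window_transport h0 (mHt v) (fun t => H0 t v)).
apply: (le_trans outer_le).
have mhA : measurable_fun setT (fun v => (h ^+ 2)%:E * A v) by exact: emeasurable_fun_scale.
have hA0 v : 0 <= (h ^+ 2)%:E * A v by rewrite mule_ge0// lee_fin sqr_ge0.
rewrite ge0_integralD//; last 4 first.
- by move=> v _; exact: mule_ge0.
- exact: emeasurable_fun_scale.
- by move=> v _; exact: mule_ge0.
- exact: emeasurable_fun_scale.
rewrite !ge0_integralZl// ?lee_fin ?sqr_ge0//.
have -> : \int[leb n]_v A v = nsq (pderiv ord0 f).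
  rewrite [RHS](@tonelli_rV_swap _ _ (fun r => (pderiv ord0 f r ^+ 2)%:E))//.
  - by apply/measurable_EFinP/measurable_funX; exact: (C1c_measurable_derive ord0 fC).
  - by move=> r; rewrite lee_fin sqr_ge0.
(* The induction hypothesis on every slice, integrated over the position of the slice. *)
have Mle : \int[leb n]_v M v <= (2 ^+ n * h ^+ 2)%:E * \sum_(i < n) nsq (pderiv (lift ord0 i) f).
  rewrite /M -(fubini_tonelli (m1 := mu) (m2 := leb n) (fun p => H p.1 p.2))//.
  apply: (@le_trans _ _ (\int[mu]_t ((2 ^+ n * h ^+ 2)%:E *
      \sum_(i < n) nsq (pderiv i (fun v => f (cons_rV (t, v))))))).
    apply: ge0_le_integral; first by [].
    - by move=> t _; exact: integral_ge0.
    - exact: (@measurable_fun_fubini_tonelli_F _ _ _ _ _ (leb n) _ mH (fun _ => H0 _ _)).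
    - apply: emeasurable_fun_scale; apply: emeasurable_sum => i.
      exact: measurable_nsq_slice fC.
    - by move=> t _; exact: (IH _ (C1c_slice t fC)).
  rewrite ge0_integralZl//.
  - rewrite ge0_integral_sum//.
    + by under eq_bigr do rewrite (nsq_slice _ fC).
    + by move=> i; exact: measurable_nsq_slice fC.
    + by move=> i t _; exact: nsq_ge0.
  - by apply: emeasurable_sum => i; exact: measurable_nsq_slice fC.
  - by move=> t _; apply: sume_ge0 => i _; exact: nsq_ge0.
  - by rewrite lee_fin mulr_ge0 ?sqr_ge0 ?exprn_ge0.
have S0 : 0 <= \sum_(i < n) nsq (pderiv (lift ord0 i) f).
  by apply: sume_ge0 => i _; exact: nsq_ge0.
rewrite big_ord_recl (ge0_muleDr _ (nsq_ge0 _) S0).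
apply: leeD.
  rewrite muleA -EFinM; apply: lee_wpmul2r; first exact: nsq_ge0.
  rewrite lee_fin (exprS 2 n) ler_wpM2r ?sqr_ge0// ler_peMr// exprn_ege1//.
  by rewrite ler1n.
apply: (le_trans (lee_wpmul2l _ Mle)); first by rewrite lee_fin.
by rewrite muleA -EFinM mulrA -(exprS 2 n).
Qed.

End window_increment.

(** * Real square integrable functions *)

(** The source of Cauchy-Schwarz for all the forms below. They vanish on functions that are 0 almost
    everywhere, so c = 0 must be covered. *)
Lemma discriminant_le (R : realFieldType) (a b c : R) : 0 <= c ->
  (forall t, 0 <= a + 2 * t * b + t ^+ 2 * c) -> b ^+ 2 <= a * c.
Proof.
rewrite le_eqVlt => /predU1P[<- H|c0 H].
  rewrite mulr0; have [->|b0] := eqVneq b 0; first by rewrite expr0n.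
  (* At this [t] the affine function a + 2 t b takes the value -1. *)
  have := H (- (a + 1) / (2 * b)).
  have -> : a + 2 * (- (a + 1) / (2 * b)) * b + (- (a + 1) / (2 * b)) ^+ 2 * 0 = -1.
    by field.
  by rewrite lerNr oppr0 ler10.
have := H (- b / c).
have -> : a + 2 * (- b / c) * b + (- b / c) ^+ 2 * c = a - b ^+ 2 / c.
  by field; rewrite gt_eqF.
by rewrite subr_ge0 ler_pdivrMr.
Qed.

Section real_L2.
Context {d : measure_display} {T : measurableType d} {R : realType}.
Variables (mu : {measure set T -> \bar R}) (D : set T).
Hypothesis mD : measurable D.
Implicit Types f g h : T -> R.

Definition sqint f := measurable_fun D f /\ (\int[mu]_(x in D) (f x ^+ 2)%:E < +oo)%E.

Definition ip f g : R := \int[mu]_(x in D) (f x * g x).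

Lemma sqint_measurable f : sqint f -> measurable_fun D f.
Proof. by case. Qed.

Lemma sqint_integrable_sqr f : sqint f -> mu.-integrable D (EFin \o (fun x => f x ^+ 2)).
Proof.
move=> [mf fi]; apply/integrableP; split; first exact/measurable_EFinP/measurable_funX.
by under eq_integral do rewrite /= ger0_norm ?sqr_ge0//.
Qed.

Lemma integrable_dominated f g : measurable_fun D f ->
  mu.-integrable D (EFin \o g) -> (forall x, D x -> `|f x| <= g x) ->
  mu.-integrable D (EFin \o f).
Proof.
move=> mf ig fg; apply: (le_integrable mD _ _ ig); first exact/measurable_EFinP.
by move=> x Dx /=; rewrite lee_fin (le_trans (fg x Dx))// ler_norm.
Qed.

Lemma sqint_dominated f g : measurable_fun D f ->
  mu.-integrable D (EFin \o g) -> (forall x, D x -> f x ^+ 2 <= g x) -> sqint f.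
Proof.
move=> mf /integrableP[mg ig] fg; split => //; apply: le_lt_trans ig.
apply: ge0_le_integral => //.
- by move=> x _; rewrite lee_fin sqr_ge0.
- exact/measurable_EFinP/measurable_funX.
- exact: measurableT_comp.
- by move=> x Dx; rewrite /= lee_fin (le_trans (fg x Dx))// ler_norm.
Qed.

Lemma integrableM_sqint f g : sqint f -> sqint g ->
  mu.-integrable D (EFin \o (fun x => f x * g x)).
Proof.
move=> Lf Lg.
apply: (@integrable_dominated _ (fun x => f x ^+ 2 + g x ^+ 2)).
- exact: measurable_funM (sqint_measurable Lf) (sqint_measurable Lg).
- exact: integrableD (sqint_integrable_sqr Lf) (sqint_integrable_sqr Lg).
- move=> x _; have := sqr_ge0 (f x - g x); have := sqr_ge0 (f x + g x).
  by rewrite ler_norml => h1 h2; apply/andP; split; nra.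
Qed.

Lemma sqintD f g : sqint f -> sqint g -> sqint (fun x => f x + g x).
Proof.
move=> Lf Lg; apply: (@sqint_dominated _ (fun x => 2 * f x ^+ 2 + 2 * g x ^+ 2)).
- exact: measurable_funD (sqint_measurable Lf) (sqint_measurable Lg).
- exact: (integrableD mD (integrableZl mD 2 (sqint_integrable_sqr Lf))
    (integrableZl mD 2 (sqint_integrable_sqr Lg))).
- by move=> x _; have := sqr_ge0 (f x - g x); nra.
Qed.

Lemma sqint_bounded_mul (m : T -> R) (M : R) f : measurable_fun D m ->
  (forall x, D x -> `|m x| <= M) -> sqint f -> sqint (fun x => m x * f x).
Proof.
move=> mm mM Lf; apply: (@sqint_dominated _ (fun x => M ^+ 2 * f x ^+ 2)).
- exact: measurable_funM mm (sqint_measurable Lf).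
- exact: (integrableZl mD (M ^+ 2) (sqint_integrable_sqr Lf)).
- move=> x Dx; rewrite exprMn ler_wpM2r ?sqr_ge0// -(real_normK (num_real (m x))).
  by rewrite lerXn2r ?nnegrE ?mM// (le_trans _ (mM x Dx)).
Qed.

Lemma sqintZ c f : sqint f -> sqint (fun x => c * f x).
Proof. by apply: (@sqint_bounded_mul (cst c) `|c|) => //=; exact: measurable_cst. Qed.

Lemma sqintN f : sqint f -> sqint (fun x => - f x).
Proof. by move=> /(sqintZ (-1)); under eq_fun do rewrite mulN1r. Qed.

Lemma sqintB f g : sqint f -> sqint g -> sqint (fun x => f x - g x).
Proof. by move=> Lf Lg; apply: sqintD => //; exact: sqintN. Qed.

Lemma sqint0 : sqint (cst 0).
Proof.
split; first exact: measurable_cst.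
by under eq_integral do rewrite expr0n; rewrite integral0 ltry.
Qed.

Lemma ipC f g : ip f g = ip g f.
Proof. by rewrite /ip; under eq_Rintegral do rewrite mulrC. Qed.

Lemma ipDl f g h : sqint f -> sqint g -> sqint h ->
  ip (fun x => f x + g x) h = ip f h + ip g h.
Proof.
move=> Lf Lg Lh; rewrite /ip; under eq_Rintegral do rewrite mulrDl.
by rewrite RintegralD//; exact: integrableM_sqint.
Qed.

Lemma ipZl c f h : sqint f -> sqint h -> ip (fun x => c * f x) h = c * ip f h.
Proof.
move=> Lf Lh; rewrite /ip; under eq_Rintegral do rewrite -mulrA.
by rewrite RintegralZl//; exact: integrableM_sqint.
Qed.

Lemma ipDr f g h : sqint f -> sqint g -> sqint h ->
  ip h (fun x => f x + g x) = ip h f + ip h g.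
Proof. by move=> Lf Lg Lh; rewrite ipC ipDl// (ipC f) (ipC g). Qed.

Lemma ipZr c f h : sqint f -> sqint h -> ip h (fun x => c * f x) = c * ip h f.
Proof. by move=> Lf Lh; rewrite ipC ipZl// ipC. Qed.

Lemma ip_ge0 f : 0 <= ip f f.
Proof. by apply: Rintegral_ge0 => x _; rewrite -expr2 sqr_ge0. Qed.

Lemma ip_cauchy_schwarz f g : sqint f -> sqint g ->
  ip f g ^+ 2 <= ip f f * ip g g.
Proof.
move=> Lf Lg; apply: discriminant_le; first exact: ip_ge0.
move=> t; have Ltg := sqintZ t Lg.
have := ip_ge0 (fun x => f x + t * g x).
rewrite ipDl// ?ipDr// ?ipZl// ?ipZr//; last exact: sqintD.
by rewrite (ipC g f); lra.
Qed.

Lemma ip_ae f g f' g' :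
  (\forall x \ae mu, D x -> f x = f' x) -> (\forall x \ae mu, D x -> g x = g' x) ->
  measurable_fun D f -> measurable_fun D g ->
  measurable_fun D f' -> measurable_fun D g' -> ip f g = ip f' g'.
Proof.
move=> ff' gg' mf mg mf' mg'; congr fine; apply: ae_eq_integral => //.
- exact/measurable_EFinP/measurable_funM.
- exact/measurable_EFinP/measurable_funM.
- by apply: filterS2 ff' gg' => x ff' gg' Dx /=; rewrite ff'// gg'.
Qed.

Lemma sqint_ae f g : measurable_fun D f ->
  (\forall x \ae mu, D x -> f x = g x) -> sqint g -> sqint f.
Proof.
move=> mf fg [mg gi]; split => //.
rewrite (_ : \int[mu]_(x in D) (f x ^+ 2)%:E = \int[mu]_(x in D) (g x ^+ 2)%:E)%E//.
apply: ae_eq_integral => //.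
- exact/measurable_EFinP/measurable_funX.
- exact/measurable_EFinP/measurable_funX.
- by apply: filterS fg => x fg Dx; rewrite fg.
Qed.

Lemma ip_sqr f : sqint f -> (\int[mu]_(x in D) (f x ^+ 2)%:E = (ip f f)%:E)%E.
Proof.
move=> /sqint_integrable_sqr fi; rewrite /ip /Rintegral.
have -> : (\int[mu]_(x in D) (f x * f x)%:E = \int[mu]_(x in D) (f x ^+ 2)%:E)%E.
  by apply: eq_integral => x _; rewrite expr2.
by rewrite fineK//; exact: integrable_fin_num.
Qed.

Lemma le_ip f g f' g' : sqint f -> sqint g -> sqint f' -> sqint g' ->
  (forall x, D x -> f x * g x <= f' x * g' x) -> ip f g <= ip f' g'.
Proof. by move=> Lf Lg Lf' Lg' fg; apply: le_Rintegral => //; exact: integrableM_sqint. Qed.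

End real_L2.

(** * Smooth functions and the fundamental lemma *)

Section flat.
Context {R : realType}.

(* The derivative of a member of this family is a combination of two others,
   so that all of them are smooth. *)
Definition flat (k : nat) (x : R) : R :=
  if 0 < x then x^-1 ^+ k * expR (- x^-1) else 0.

Lemma flat_ge0 k x : 0 <= flat k x.
Proof.
by rewrite /flat; case: ifP => // x0; rewrite mulr_ge0 ?expR_ge0 ?exprn_ge0 ?invr_ge0 ?ltW.
Qed.

(** With t = 1 / x, one term of the exponential series gives t^(k+2) <= (k+2)! e^t. Every member of
    the family is thus O(x^2) at 0, which makes the derivative there exist and vanish. *)
Lemma flat_le_sqr k x : flat k x <= (k.+2)`!%:R * x ^+ 2.
Proof.
rewrite /flat; case: ifPn => x0; last by rewrite mulr_ge0// sqr_ge0.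
set t := x^-1; have t0 : 0 < t by rewrite invr_gt0.
have et : t ^+ k.+2 <= (k.+2)`!%:R * expR t.
  rewrite mulrC -ler_pdivrMr ?ltr0n ?fact_gt0//.
  by apply: le_trans (expR_ge1Dxn k.+1 (ltW t0)); rewrite lerDr.
have -> : x = t^-1 by rewrite invrK.
rewrite (exprVn t 2) ler_pdivlMr ?exprn_gt0// mulrAC -exprD addn2 expRN.
by rewrite ler_pdivrMr ?expR_gt0.
Qed.

Lemma flat_is_derive k (x : R) :
  is_derive x 1 (flat k) (flat k.+2 x - k%:R * flat k.+1 x).
Proof.
have [x0|x0|->] := ltgtP x 0.
- have -> : flat k.+2 x - k%:R * flat k.+1 x = 0.
    by rewrite /flat !ifF ?mulr0 ?subr0//; apply/negP => /lt_gtF; rewrite x0.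
  have nz : {near x, (cst 0 : R -> R) =1 flat k}.
    near=> y; rewrite /flat ifF//; apply/negP => /lt_gtF.
    by have -> : y < 0 by near: y; exact: lt_nbhsl.
  apply: DeriveDef; first by apply: (near_eq_derivable nz); exact: derivable_cst.
  by rewrite -(near_eq_derive _ nz) derive_cst.
- have nz : {near x, (fun y => y^-1 ^+ k * expR (- y^-1)) =1 flat k}.
    near=> y; rewrite /flat ifT//.
    by near: y; exact: lt_nbhsr.
  have xn0 : x != 0 by rewrite gt_eqF.
  have dV : is_derive x 1 (fun y : R => y^-1) (- x ^- 2).
    have := @is_deriveV R id x 1 1 xn0 _.
    by rewrite /GRing.scale/= mulr1; apply.
  have dX : is_derive x 1 ((fun y : R => y^-1) ^+ k) ((k%:R * x^-1 ^+ k.-1) *: (- x ^- 2)).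
    exact: is_deriveX.
  have dE : is_derive x 1 (expR \o (fun y : R => - y^-1)) (expR (- x^-1) * (- (- x ^- 2))).
    by apply: is_derive1_comp; exact: is_deriveN.
  have dP := is_deriveM dX dE.
  have E : (fun y : R => y^-1 ^+ k * expR (- y^-1)) =
     ((fun y : R => y^-1) ^+ k) * (expR \o (fun y : R => - y^-1)).
    by apply/funext => y; rewrite mulrfctE exprfctE.
  apply: DeriveDef.
    by apply: (near_eq_derivable nz); rewrite E; by case: dP.
  case: dP => _ dPE; rewrite -(near_eq_derive _ nz) E dPE /flat x0.
  rewrite exprfctE /= /GRing.scale/= -!exprVn opprK.
  set t := x^-1; set e := expR _.
  by case: k {dX nz E dPE} => [|k] /=; rewrite ?exprS; ring.
- have f0 j : flat j 0 = 0 by rewrite /flat ltxx.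
  rewrite !f0 mulr0 subr0.
  have key : (fun h : R => h^-1 *: ((flat k \o shift 0) (h *: 1) - flat k 0)) h @[h --> 0^'] --> (0 : R).
    apply: (@cvg_to_0_linear _ _ ((k.+2)`!%:R) 1) => // h /andP[h0 _].
    rewrite f0 /= addr0 subr0 /GRing.scale/= mulr1 normrM normfV.
    rewrite (ger0_norm (flat_ge0 _ _)) ler_pdivrMl//.
    apply: (le_trans (flat_le_sqr _ _)).
    by rewrite -real_normK ?num_real// expr2 mulrCA.
  apply: DeriveDef; first by apply/cvg_ex; exists 0.
  exact: cvg_lim key.
Unshelve. all: by end_near. Qed.

End flat.

Section pi_system.
Context {d : measure_display} {T : measurableType d} {R : realType}.
Variable mu : {measure set T -> \bar R}.
Local Open Scope ereal_scope.

(** The sets whose trace on [B] has zero integral form a Dynkin class: complements use the zero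
    integral over [B] itself, disjoint unions the integrability of [g]. *)
Lemma ae_eq0_pi_system (G : set (set T)) (B : set T) (g : T -> \bar R) :
  @measurable _ T = <<s G >> -> setI_closed G -> measurable B ->
  mu.-integrable B g -> \int[mu]_(x in B) g x = 0 ->
  (forall A, G A -> \int[mu]_(x in B `&` A) g x = 0) -> ae_eq mu B g (cst 0).
Proof.
move=> mG IG mB ig gB gG.
have igA A : measurable A -> mu.-integrable (B `&` A) g.
  by move=> mA; apply: integrableS ig => //; exact: measurableI.
have gA A : measurable A -> \int[mu]_(x in B `&` A) g x = 0.
  rewrite {1}mG; apply: (dynkin_induction (P := fun A => \int[mu]_(x in B `&` A) g x = 0) mG IG).
  - by rewrite setIT.
  - exact: gG.
  - move=> S mS gS; move: gB.
    have BE : B = (B `&` S) `|` (B `&` ~` S) by rewrite -setIUr setUCr setIT.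
    rewrite {1}BE integral_setU//.
    + by rewrite gS add0e.
    + exact: measurableI.
    + by apply: measurableI => //; exact: measurableC.
    + by rewrite -BE; exact: measurable_int ig.
    + by apply/disj_setPS => x [[_ Sx] [_ /(_ Sx)]].
  - move=> F mF tF gF; rewrite setI_bigcupr integral_bigcup//.
    + by rewrite eseries0// => i _ _; exact: gF.
    + exact: trivIset_setIl.
    + by move=> k; exact: measurableI.
    + by rewrite -setI_bigcupr; apply: igA; exact: bigcup_measurable.
apply: integral_ae_eq => //.
move=> E EB mE; rewrite integral0; have := gA E mE.
by have /setIidPr -> := EB.
Qed.

End pi_system.

Section smooth_functions.
Context {R : realType} {n : nat}.
Implicit Types f g : 'rV[R]_n -> R.

(** [smooth] quantifies over all orders; a class stable under partial derivatives spares the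
    computation of higher ones. *)
Lemma smooth_coind (P : ('rV[R]_n -> R) -> Prop) :
  (forall f, P f -> [/\ continuous f, forall i r, derivable f r (evec R i) &
                        forall i, P (pderiv i f)]) ->
  forall f, P f -> smooth f.
Proof.
move=> H f Pf k; elim: k f Pf => [|k IH] f Pf; have [cf df Pdf] := H f Pf => //.
by split => // i; apply: IH (Pdf i).
Qed.

Lemma smooth_continuous f : smooth f -> continuous f.
Proof. by move=> /(_ 0%N). Qed.

Lemma smooth_derivable f i r : smooth f -> derivable f r (evec R i).
Proof. by move=> /(_ 1%N)[+ _]; exact. Qed.

Lemma smooth_pderiv f i : smooth f -> smooth (pderiv i f).
Proof. by move=> sf k; have [_] := sf k.+1; exact. Qed.

(** Reduces a directional derivative to a function of one real variable, where the chain rule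
    [is_derive1_comp] applies. *)
Lemma is_derive_line f r v (df : R) :
  is_derive (0 : R) 1 (fun h : R => f (h *: v + r)) df -> is_derive r v f df.
Proof.
have E : (fun h : R => h^-1 *: (((fun h : R => f (h *: v + r)) \o shift 0) (h *: 1) -
    f (0 *: v + r))) = (fun h : R => h^-1 *: ((f \o shift r) (h *: v) - f r)).
  by apply/funext => h /=; rewrite addr0 scale0r add0r /GRing.scale/= mulr1.
by move=> [dl dv]; apply: DeriveDef; rewrite ?/derivable ?/derive -E.
Qed.

Lemma coor_is_derive (j i : 'I_n) (r : 'rV[R]_n) :
  is_derive r (evec R i) (fun r : 'rV[R]_n => r ord0 j) ((i == j)%:R : R).
Proof.
apply: is_derive_line.
set e := (i == j)%:R.
have -> : (fun h : R => (h *: evec R i + r) ord0 j) = (fun h : R => e * h + r ord0 j).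
  by apply/funext => h /=; rewrite !mxE eqxx /= eq_sym -/e mulrC.
have := is_deriveD (is_deriveZ e (is_derive_id (0 : R) 1))
  (is_derive_cst (r ord0 j) (0 : R) 1).
by rewrite addr0 /GRing.scale/= mulr1.
Qed.

Lemma flat_coor_is_derive k (a b : R) (j i : 'I_n) (r : 'rV[R]_n) :
  is_derive r (evec R i) (fun r : 'rV[R]_n => flat k (a * r ord0 j + b))
    ((a * (i == j)%:R) * (flat k.+2 (a * r ord0 j + b) -
       k%:R * flat k.+1 (a * r ord0 j + b))).
Proof.
apply: is_derive_line.
set e := (i == j)%:R.
have -> : (fun h : R => flat k (a * (h *: evec R i + r) ord0 j + b)) =
    flat k \o (fun h : R => (a * e) * h + (a * r ord0 j + b)).
  apply/funext => h /=; rewrite !mxE eqxx /= eq_sym -/e; congr flat; ring.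
rewrite [X in is_derive _ _ _ X]mulrC; apply: is_derive1_comp.
  have F := flat_is_derive k (a * r ord0 j + b).
  by rewrite /= mulr0 add0r.
have := is_deriveD (is_deriveZ (a * e) (is_derive_id (0 : R) 1))
  (is_derive_cst (a * r ord0 j + b) (0 : R) 1).
by rewrite addr0 /GRing.scale/= mulr1.
Qed.

(* A class of functions closed under partial derivatives, hence consisting of
   smooth functions by [smooth_coind]. *)
Inductive elementary : ('rV[R]_n -> R) -> Prop :=
| elementary_smooth f : smooth f -> elementary f
| elementary_cst c : elementary (fun=> c)
| elementary_coor j : elementary (fun r => r ord0 j)
| elementary_flat k a b j : elementary (fun r => flat k (a * r ord0 j + b))
| elementaryD f g : elementary f -> elementary g -> elementary (fun r => f r + g r)
| elementaryM f g : elementary f -> elementary g -> elementary (fun r => f r * g r).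

Lemma elementary_is_smooth f : elementary f -> smooth f.
Proof.
apply: smooth_coind => {}f; elim => {f}.
- move=> f sf; split; first exact: smooth_continuous.
    by move=> i r; exact: smooth_derivable.
  by move=> i; apply: elementary_smooth; exact: smooth_pderiv.
- move=> c; split; [exact: cst_continuous|by move=> i r; exact: derivable_cst|].
  move=> i; rewrite (_ : pderiv i _ = fun=> 0); first exact: elementary_cst.
  by apply/funext => r; exact: derive_cst.
- move=> j; split; first exact: coord_continuous.
    by move=> i r; case: (coor_is_derive j i r).
  move=> i; rewrite (_ : pderiv i _ = fun=> (i == j)%:R); first exact: elementary_cst.
  by apply/funext => r; case: (coor_is_derive j i r).
- move=> k a b j; split.
  + move=> r; apply: (@continuous_comp _ _ _ (fun r : 'rV[R]_n => a * r ord0 j + b) (flat k)).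
      apply: continuousD; last exact: cst_continuous.
      by apply: continuousM; [exact: cst_continuous|exact: coord_continuous].
    apply/differentiable_continuous/derivable1_diffP.
    by case: (flat_is_derive k (a * r ord0 j + b)).
  + by move=> i r; case: (flat_coor_is_derive k a b j i r).
  + move=> i; rewrite (_ : pderiv i _ = fun r => (a * (i == j)%:R) *
      (flat k.+2 (a * r ord0 j + b) + (- k%:R) * flat k.+1 (a * r ord0 j + b))).
      apply: elementaryM; first exact: elementary_cst.
      apply: elementaryD; first exact: elementary_flat.
      by apply: elementaryM; [exact: elementary_cst|exact: elementary_flat].
    apply/funext => r; rewrite mulNr; by case: (flat_coor_is_derive k a b j i r).
- move=> f g ef [cf df Pf] eg [cg dg Pg]; split.
  + by move=> r; apply: continuousD; [exact: cf|exact: cg].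
  + by move=> i r; apply: derivable_add.
  + move=> i; rewrite (_ : pderiv i _ = fun r => pderiv i f r + pderiv i g r).
      exact: elementaryD.
    by apply/funext => r; exact: derive_add.
- move=> f g ef [cf df Pf] eg [cg dg Pg]; split.
  + by move=> r; apply: continuousM; [exact: cf|exact: cg].
  + by move=> i r; apply: derivable_mul.
  + move=> i; rewrite (_ : pderiv i _ = fun r => f r * pderiv i g r + g r * pderiv i f r).
      by apply: elementaryD; apply: elementaryM.
    by apply/funext => r; exact: derive_mul.
Qed.

End smooth_functions.

Section fubini.
Context {R : realType}.
Local Notation mu := (@lebesgue_measure R).
Local Notation leb := (lebesgue_measure_rV R).
Local Open Scope ereal_scope.

Lemma integrable_cons n (f : 'rV[R]_n.+1 -> \bar R) :
  (leb n.+1).-integrable setT f ->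
  (mu \x leb n).-integrable setT (f \o @cons_rV R n).
Proof.
move=> /integrableP[mf fi]; apply/integrableP; split.
  by apply: measurableT_comp => //; exact: measurable_cons_rV.
rewrite fubini_tonelli1//.
- by move: fi; rewrite tonelli_rV//; exact: measurableT_comp.
- apply: measurableT_comp => //.
  by apply: measurableT_comp => //; exact: measurable_cons_rV.
Qed.

Lemma fubini_rV n (f : 'rV[R]_n.+1 -> \bar R) : (leb n.+1).-integrable setT f ->
  \int[leb n.+1]_r f r = \int[mu]_x \int[leb n]_v f (cons_rV (x, v)).
Proof.
move=> fi; have ci := integrable_cons fi.
rewrite [RHS](integral12_prod_meas1 ci).
rewrite [LHS](integral_pushforward (@measurable_cons_rV R n))//.
exact: measurable_int fi.
Qed.

Lemma fubini_rV_swap n (f : 'rV[R]_n.+1 -> \bar R) : (leb n.+1).-integrable setT f ->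
  \int[leb n.+1]_r f r = \int[leb n]_v \int[mu]_x f (cons_rV (x, v)).
Proof.
move=> fi; have ci := integrable_cons fi.
rewrite [RHS](integral21_prod_meas1 ci).
rewrite [LHS](integral_pushforward (@measurable_cons_rV R n))//.
exact: measurable_int fi.
Qed.

Lemma continuous_box_bounded n (L : R) (f : 'rV[R]_n -> R) : continuous f ->
  (forall (r : 'rV[R]_n) j, (L <= `|r ord0 j|)%R -> f r = 0%R) ->
  exists M : R, forall r, (`|f r| <= M)%R.
Proof.
move=> cf f0.
have cK := @compact_closed_box R n (const_mx (- L)%R) (const_mx L).
have := continuous_compact (continuous_subspaceT cf) cK.
move=> /compact_bounded[M [_ MK]].
exists (Num.max 0 (M + 1))%R => r.
have [[j rj]|rL] := pselect (exists j, (L <= `|r ord0 j|)%R).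
  by rewrite (f0 r _ rj) normr0 le_max lexx.
rewrite le_max; apply/orP; right; apply: (MK (M + 1)%R); first by rewrite ltrDl.
exists r => // j; rewrite !mxE -ler_norml leNgt; apply/negP => Lr.
by apply: rL; exists j; exact: ltW.
Qed.

Lemma continuous_box_integrable n (L : R) (f : 'rV[R]_n -> R) : continuous f ->
  (forall (r : 'rV[R]_n) j, (L <= `|r ord0 j|)%R -> f r = 0%R) ->
  (leb n).-integrable setT (EFin \o f).
Proof.
move=> cf f0; have [M fM] := continuous_box_bounded cf f0.
set B := closed_box (const_mx (- L)%R) (const_mx L : 'rV[R]_n).
have mB : measurable B by exact: measurable_closed_box.
have Bfin : leb n B < +oo by exact: lebesgue_measure_closed_box.
have mf : measurable_fun setT f by exact: continuous_measurable_rV.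
rewrite (_ : EFin \o f = (EFin \o f) \_ B); last first.
  apply/funext => r; rewrite patchE; case: ifPn => //; rewrite notin_setE => rB.
  rewrite /= (_ : f r = 0%R)//.
  have [j rj] : exists j, (L <= `|r ord0 j|)%R.
    apply/not_existsP => H; apply: rB => j; rewrite !mxE -ler_norml.
    by rewrite leNgt; apply/negP => /ltW; exact: H.
  exact: f0 rj.
apply/(integrable_mkcond _ mB).
apply: (@le_integrable _ _ _ _ _ mB _ (cst M%:E)).
- exact/measurable_EFinP/measurable_funTS.
- by move=> r _ /=; rewrite lee_fin (le_trans (fM r))// ler_norm.
- apply/integrableP; split; first exact: measurable_cst.
  by rewrite integral_cst//= lte_mul_pinfty.
Qed.

(** Integrating along the direction of the derivative leaves two boundary values, both 0; other
    directions are reached by slicing off the first coordinate. Applied to a product, this is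
    integration by parts. *)
Lemma integral_pderiv0 n (L : R) (f : 'rV[R]_n -> R) i : C1c L f ->
  \int[leb n]_r (pderiv i f r)%:E = 0.
Proof.
elim: n L f i => [|n IH] L f i fC; first by case: i.
have [cf df cdf f0 df0] := fC.
have ii := continuous_box_integrable (cdf i) (df0 i).
case: (unliftP ord0 i) => [j ij|i0].
  rewrite fubini_rV// integral0_eq// => x _.
  have := IH L _ j (C1c_slice x fC).
  by rewrite pderiv_slice_tail -ij.
rewrite fubini_rV_swap// integral0_eq// => v _; rewrite i0 /=.
have f00 s : (L <= `|s|)%R -> f (cons_rV (s, v)) = 0%R.
  by move=> Ls; apply: (f0 _ ord0); rewrite mxE unlift_none.
(* For L <= 0 the interval [-L, L] is empty or a point, but then the support clause makes the
   derivative vanish everywhere. *)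
have [L0|L0] := leP L 0%R.
  rewrite integral0_eq// => x _; rewrite (df0 ord0 _ ord0)//.
  by rewrite (le_trans L0).
transitivity (\int[mu]_(x in `[(- L)%R, L]) (pderiv ord0 f (cons_rV (x, v)))%:E).
  rewrite [RHS]integral_mkcond; apply: eq_integral => x _.
  rewrite patchE; case: ifPn => //; rewrite notin_setE/= in_itv/= -ler_norml => /negP.
  rewrite -ltNge => /ltW xL.
  by rewrite (df0 ord0 _ ord0)// mxE unlift_none.
rewrite (@ftc_line _ (fun x : R => f (cons_rV (x, v)))
  (fun x : R => pderiv ord0 f (cons_rV (x, v)))).
- by rewrite !f00 ?subee// ?normrN ler_norm.
- by rewrite (le_trans _ (ltW L0))// oppr_le0 ltW.
- by move=> x; exact/derivable_slice_head/df.
- by move=> x; exact: derive_slice_head.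
- exact: (continuous_slice_head (cdf ord0)).
Qed.

End fubini.

Section real_test_functions.
Context {R : realType} {n : nat}.
Variable D : set 'rV[R]_n.
Implicit Types f g : 'rV[R]_n -> R.

Definition rtest f := smooth f /\
  exists K, [/\ compact K, K `<=` D & forall r, ~ K r -> f r = 0].

Lemma rtest_pderiv i f : rtest f -> rtest (pderiv i f).
Proof.
move=> [sf [K [cK KD fK]]]; split; first exact: smooth_pderiv.
exists K; split => // r rK.
have nz : {near r, (cst 0 : 'rV[R]_n -> R) =1 f}.
  have oK : open (~` K) by apply: closed_openC; exact: compact_closed.
  near=> s; rewrite fK//; near: s.
  exact: open_nbhs_nbhs.
by rewrite /pderiv -(near_eq_derive _ nz) derive_cst.
Unshelve. all: by end_near. Qed.

Lemma rtestMl m f : smooth m -> rtest f -> rtest (fun r => m r * f r).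
Proof.
move=> sm [sf [K [cK KD fK]]]; split.
  by apply: elementary_is_smooth; apply: elementaryM; exact: elementary_smooth.
by exists K; split => // r rK; rewrite fK// mulr0.
Qed.

Lemma rtest_smooth f : rtest f -> smooth f. Proof. by case. Qed.

Lemma rtest_out f r : rtest f -> ~ D r -> f r = 0.
Proof. by move=> [_ [K [_ KD fK]]] rD; apply: fK => /KD. Qed.

Lemma rtestD f g : rtest f -> rtest g -> rtest (fun r => f r + g r).
Proof.
move=> [sf [K [cK KD fK]]] [sg [K' [cK' KD' gK]]]; split.
  by apply: elementary_is_smooth; apply: elementaryD; exact: elementary_smooth.
exists (K `|` K'); split; first exact: compactU.
  by move=> r [/KD|/KD'].
by move=> r /not_orP[rK rK']; rewrite fK// gK// addr0.
Qed.

Variable L : R.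
Hypothesis DL : forall r, D r -> forall j, `|r ord0 j| < L.

Lemma rtest_C1c f : rtest f -> C1c L f.
Proof.
move=> tf; have sf := rtest_smooth tf.
have out g (r : 'rV[R]_n) j : rtest g -> L <= `|r ord0 j| -> g r = 0.
  move=> tg Lr; apply: (rtest_out tg) => /DL/(_ j).
  by rewrite ltNge Lr.
split.
- exact: smooth_continuous.
- by move=> i r; exact: smooth_derivable.
- by move=> i; apply: smooth_continuous; exact: smooth_pderiv.
- by move=> r j; exact: out.
- by move=> i r j; apply: out; exact: rtest_pderiv.
Qed.

End real_test_functions.

Section fundamental_lemma.
Context {R : realType} {n : nat}.
Variables (D : set 'rV[R]_n) (L : R).
Hypothesis oD : open D.
Hypothesis DL : forall r, D r -> forall j, `|r ord0 j| < L.
Local Notation leb := (lebesgue_measure_rV R n).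
Local Notation sqint := (sqint leb D).
Local Notation ip := (ip leb D).
Implicit Types f g : 'rV[R]_n -> R.

Let mD : measurable D. Proof. exact: open_measurable_rV. Qed.

Lemma bounded_domain_finite : (leb D < +oo)%E.
Proof.
apply: le_lt_trans (lebesgue_measure_closed_box (const_mx (- L)) (const_mx L)).
apply: le_measure; rewrite ?inE//; first exact: measurable_closed_box.
by move=> r /DL rL j; rewrite !mxE -ler_norml ltW.
Qed.

Lemma integrable_bounded f (M : R) : measurable_fun D f ->
  (forall r, D r -> `|f r| <= M) -> leb.-integrable D (EFin \o f).
Proof.
move=> mf fM; apply: (@integrable_dominated _ _ _ leb D mD f (cst M)) => //.
suff : leb.-integrable D (cst M%:E) by [].
apply/integrableP; split; first exact: measurable_cst.
by rewrite integral_cst//= lte_mul_pinfty//; exact: bounded_domain_finite.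
Qed.

Lemma sqint_bounded f (M : R) : measurable_fun D f ->
  (forall r, D r -> `|f r| <= M) -> sqint f.
Proof.
move=> mf fM; apply: (@sqint_dominated _ _ _ leb D mD f (fun r => `|f r| ^+ 2)) => //.
  apply: (@integrable_bounded _ (M ^+ 2)).
    by apply: measurable_funX; exact: measurableT_comp.
  move=> r Dr; rewrite ger0_norm ?sqr_ge0// lerXn2r ?nnegrE//.
    exact: le_trans (fM r Dr).
  exact: fM.
by move=> r _; rewrite real_normK// num_real.
Qed.

Lemma rtest_bounded f : rtest D f -> exists M, forall r, `|f r| <= M.
Proof.
move=> tf; have [cf _ _ f0 _] := rtest_C1c DL tf.
exact: continuous_box_bounded cf f0.
Qed.

Lemma rtest_measurable f : rtest D f -> measurable_fun setT f.
Proof. by move=> tf; have := C1c_measurable (rtest_C1c DL tf). Qed.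

Lemma rtest_sqint f : rtest D f -> sqint f.
Proof.
move=> tf; have [M fM] := rtest_bounded tf.
by apply: (@sqint_bounded _ M) => //; apply: measurable_funTS; exact: rtest_measurable.
Qed.

Lemma integral_domain (F : 'rV[R]_n -> \bar R) : (forall r, ~ D r -> F r = 0%E) ->
  (\int[leb]_(r in D) F r = \int[leb]_r F r)%E.
Proof.
move=> F0; rewrite [LHS]integral_mkcond; apply: eq_integral => r _.
by rewrite patchE; case: ifPn => //; rewrite notin_setE => /F0 ->.
Qed.

Lemma rtest_integration_by_parts i f g : rtest D f -> rtest D g ->
  ip f (pderiv i g) = - ip (pderiv i f) g.
Proof.
move=> tf tg; have tfg := rtestMl (rtest_smooth tf) tg.
have := integral_pderiv0 i (rtest_C1c DL tfg).
rewrite -integral_domain => [I0|r /(rtest_out (rtest_pderiv i tfg)) ->//].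
have E : pderiv i (fun r => f r * g r) = fun r => f r * pderiv i g r + pderiv i f r * g r.
  apply/funext => r; rewrite /pderiv derive_mul; last 2 first.
  - exact: smooth_derivable (rtest_smooth tf).
  - exact: smooth_derivable (rtest_smooth tg).
  by rewrite (mulrC (g r)).
have tdf := rtest_pderiv i tf; have tdg := rtest_pderiv i tg.
apply/eqP; rewrite -addr_eq0; apply/eqP.
rewrite /ip -RintegralD//; last 2 first.
  exact: (integrableM_sqint mD (rtest_sqint tf) (rtest_sqint tdg)).
  exact: (integrableM_sqint mD (rtest_sqint tdf) (rtest_sqint tg)).
by move: I0; rewrite E /Rintegral => ->.
Qed.

(* Increases to the indicator function of the open box as [m] goes to infinity. *)
Definition box_bump (a b : 'rV[R]_n) (m : R) (r : 'rV[R]_n) : R :=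
  \prod_(i < n) (flat 0 (m * r ord0 i + - (m * a ord0 i)) *
                 flat 0 (- m * r ord0 i + m * b ord0 i)).

Lemma box_bump_smooth a b m : smooth (box_bump a b m).
Proof.
apply: elementary_is_smooth; rewrite /box_bump.
elim: (index_enum _) => [|i s IH].
  by under eq_fun do rewrite big_nil; exact: elementary_cst.
under eq_fun do rewrite big_cons.
by apply: elementaryM => //; apply: elementaryM; exact: elementary_flat.
Qed.

Lemma flat0_le1 (x : R) : flat 0 x <= 1.
Proof.
rewrite /flat; case: ifP => // x0; rewrite expr0 mul1r expR_le1.
by rewrite oppr_le0 invr_ge0 ltW.
Qed.

Lemma box_bump_ge0 a b m r : 0 <= box_bump a b m r.
Proof. by apply: prodr_ge0 => i _; rewrite mulr_ge0 ?flat_ge0. Qed.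

Lemma box_bump_le1 a b m r : box_bump a b m r <= 1.
Proof.
apply: prodr_ile1 => i _; apply/andP; split; first by rewrite mulr_ge0 ?flat_ge0.
by rewrite mulr_ile1 ?flat_ge0 ?flat0_le1.
Qed.

Lemma box_bump_out a b m r : 0 < m -> ~ open_box a b r -> box_bump a b m r = 0.
Proof.
move=> m0 /existsNP[i /negP]; rewrite negb_and -!leNgt => abi.
rewrite /box_bump (bigD1 i)//= [X in X * _](_ : _ = 0) ?mul0r//.
rewrite /flat; case/orP : abi => h.
  rewrite ifF ?mul0r//; apply/negP; rewrite -mulrBr pmulr_rgt0// subr_gt0.
  by move/lt_geF; rewrite h.
rewrite [X in _ * X]ifF ?mulr0//; apply/negP.
rewrite mulNr addrC -mulrBr pmulr_rgt0// subr_gt0.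
by move/lt_geF; rewrite h.
Qed.

Lemma flat0_cvg (x : R) : 0 < x -> (flat 0 (k.+1%:R * x) @[k --> \oo] --> (1 : R)).
Proof.
move=> x0.
rewrite (_ : (fun k : nat => flat 0 (k.+1%:R * x)) = (fun k : nat => expR (- (x^-1 * k.+1%:R^-1)))); last first.
  apply/funext => k; rewrite /flat ifT ?mulr_gt0// expr0 mul1r invfM mulrC.
  by rewrite mulrC.
have H : - (x^-1 * k.+1%:R^-1) @[k --> \oo] --> - (x^-1 * 0 : R).
  by apply: cvgN; apply: cvgM; [exact: cvg_cst|exact: cvg_harmonic].
rewrite mulr0 oppr0 in H.
by have := cvg_comp _ _ H (@continuous_expR R 0); rewrite expR0; exact.
Qed.

Lemma box_bump_cvg a b r :
  box_bump a b k.+1%:R r @[k --> \oo] --> (\1_(open_box a b) r : R).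
Proof.
rewrite indicE; have [rab|rab] := boolP (r \in open_box a b); last first.
  rewrite (_ : (fun k : nat => _) = fun=> 0); first exact: cvg_cst.
  by apply/funext => k; apply: box_bump_out => //; rewrite notin_setE in rab.
rewrite inE in rab.
have E k : box_bump a b k.+1%:R r = \prod_(i < n)
    (flat 0 (k.+1%:R * (r ord0 i - a ord0 i)) * flat 0 (k.+1%:R * (b ord0 i - r ord0 i))).
  apply: eq_bigr => i _; congr (flat 0 _ * flat 0 _); first by rewrite mulrBr.
  by rewrite mulrBr mulNr addrC.
under eq_fun do rewrite E.
have -> : (true%:R : R) = \prod_(i < n) (1 * 1) by rewrite mulr1 big1.
apply: cvg_big => [|i _]; first exact: mul_continuous.
have /andP[ra rb] := rab i.
by apply: cvgM; apply: flat0_cvg; rewrite subr_gt0.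
Qed.

Lemma rtest_box_bump a b k : closed_box a b `<=` D -> rtest D (box_bump a b k.+1%:R).
Proof.
move=> abD; split; first exact: box_bump_smooth.
exists (closed_box a b); split => //; first exact: compact_closed_box.
by move=> r rab; apply: box_bump_out => // /open_boxW.
Qed.

Lemma integral_box0 g a b : sqint g -> (forall f, rtest D f -> ip g f = 0) ->
  closed_box a b `<=` D -> (\int[leb]_(r in open_box a b) (g r)%:E = 0)%E.
Proof.
move=> Lg g0 abD.
have ig : leb.-integrable D (EFin \o g).
  have L1 : sqint (cst 1) by apply: (@sqint_bounded _ 1) => // r _; rewrite normr1.
  have := integrableM_sqint mD Lg L1.
  by under eq_fun do rewrite mulr1.
have mg := sqint_measurable Lg.
have mO : measurable (open_box a b) by exact: measurable_open_box.
have OD : open_box a b `<=` D by move=> r /open_boxW /abD.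
pose F (k : nat) r := (g r * box_bump a b k.+1%:R r)%:E.
have mF k : measurable_fun D (F k).
  apply/measurable_EFinP/measurable_funM => //; apply: measurable_funTS.
  exact: (rtest_measurable (rtest_box_bump k abD)).
have mG : measurable_fun D (fun r => (g r * \1_(open_box a b) r)%:E).
  by apply/measurable_EFinP/measurable_funM => //; exact: measurable_indic.
have cvgF : \forall r \ae leb, D r ->
    F k r @[k --> \oo] --> (g r * \1_(open_box a b) r)%:E.
  apply: aeW => r _; apply: cvg_EFin; first by apply: nearW.
  by apply: cvgM; [exact: cvg_cst|exact: box_bump_cvg].
have domF : \forall r \ae leb, forall k, D r -> (`|F k r| <= `|g r|%:E)%E.
  apply: aeW => r k _; rewrite /F /= lee_fin normrM ler_piMr//.
  by rewrite ger0_norm ?box_bump_ge0 ?box_bump_le1.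
have [_ _ cF] := dominated_convergence mD mF mG cvgF (integrable_norm ig) domF.
have F0 k : (\int[leb]_(r in D) F k r)%E = 0%E.
  have tb := @rtest_box_bump a b k abD.
  have := g0 _ tb; rewrite /ip /Rintegral /F => I0.
  rewrite -(fineK (integrable_fin_num mD (integrableM_sqint mD Lg (rtest_sqint tb)))).
  by rewrite I0.
have : (\int[leb]_(r in D) (g r * \1_(open_box a b) r)%:E = 0)%E.
  apply: (cvg_unique _ cF) => //.
  rewrite (_ : [sequence _]_n = cst 0%E); first exact: cvg_cst.
  by apply/funext => k; exact: F0.
move=> <-; rewrite [LHS]integral_mkcond [RHS]integral_mkcond.
apply: eq_integral => r _; rewrite !patchE indicE.
have [rab|rab] := boolP (r \in open_box a b); last by rewrite mulr0; case: ifP.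
by rewrite mulr1 ifT// inE; apply: OD; rewrite -inE.
Qed.

(** Inside a rational box with closure in [D], [g] has zero integral over every subbox, and boxes
    generate the sigma-algebra; so [g] vanishes almost everywhere there. Countably many such boxes
    cover [D]. *)
Lemma fundamental_lemma g : sqint g -> (forall f, rtest D f -> ip g f = 0) ->
  \forall r \ae leb, D r -> g r = 0.
Proof.
move=> Lg g0.
have ig : leb.-integrable D (EFin \o g).
  have L1 : sqint (cst 1) by apply: (@sqint_bounded _ 1) => // r _; rewrite normr1.
  have := integrableM_sqint mD Lg L1.
  by under eq_fun do rewrite mulr1.
have box_ae (q : 'rV[rat]_n * 'rV[rat]_n) : (@rat_box R n q).2 `<=` D ->
    \forall r \ae leb, (@rat_box R n q).1 r -> g r = 0.
  move=> qD.
  have mB : measurable (@rat_box R n q).1 by exact: measurable_open_box.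
  have BD : (@rat_box R n q).1 `<=` D by move=> r /open_boxW /qD.
  have box0 a b : (\int[leb]_(r in (@rat_box R n q).1 `&` open_box a b) (g r)%:E = 0)%E.
    have [c [e [-> ceq]]] := @open_boxI R n (map_mx ratr q.1) (map_mx ratr q.2) a b.
    by apply: integral_box0 => // r /ceq /qD.
  have ae0 := @ae_eq0_pi_system _ _ _ leb _ _ (EFin \o g) measurable_open_boxesE
    setI_closed_open_boxes mB (integrableS mD mB BD ig) _ _.
  have : ae_eq leb (@rat_box R n q).1 (EFin \o g) (cst 0%E).
    apply: ae0; last by move=> _ [ab _ <-]; exact: box0.
    exact: integral_box0.
  by apply: filterS => r /[apply] -[].
have cover : \forall r \ae leb, forall k : nat,
    if unpickle k is Some q then (@rat_box R n q).2 `<=` D -> (@rat_box R n q).1 r -> g r = 0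
    else True.
  apply/ae_foralln => k; case: (unpickle k) => [q|]; last exact: aeW.
  have [qD|qD] := pselect ((@rat_box R n q).2 `<=` D).
    by apply: filterS (box_ae q qD) => r + _.
  by apply: aeW => r /qD.
apply: filterS cover => r H Dr.
move: (Dr); rewrite {1}(open_rat_boxes oD) => -[q qD qr].
by have := H (pickle q); rewrite pickleK; apply.
Qed.

End fundamental_lemma.

(** * Sobolev spaces *)

Section complex_L2.
Local Open Scope complex_scope.
Context {R : realType} {n : nat}.
Variables (D : set 'rV[R]_n) (L : R).
Hypothesis oD : open D.
Hypothesis DL : forall r, D r -> forall j, `|r ord0 j| < L.
Local Notation leb := (lebesgue_measure_rV R n).
Local Notation sqint := (sqint leb D).
Local Notation ip := (ip leb D).
Local Notation "f ^re" := (fun r => complex.Re (f r)) (at level 2, format "f ^re").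
Local Notation "f ^im" := (fun r => complex.Im (f r)) (at level 2, format "f ^im").
Implicit Types f g h u v w : 'rV[R]_n -> R[i].

Let mD : measurable D. Proof. exact: open_measurable_rV. Qed.

Lemma normc_sqr (z : R[i]) : normc z ^+ 2 = complex.Re z ^+ 2 + complex.Im z ^+ 2.
Proof. by case: z => a b /=; rewrite sqr_sqrtr// addr_ge0// sqr_ge0. Qed.

Lemma L2P f : L2 D f <-> sqint f^re /\ sqint f^im.
Proof.
split.
  move=> [mr mi fi].
  have dom (h : 'rV[R]_n -> R) : measurable_fun D h ->
      (forall r, h r ^+ 2 <= normc (f r) ^+ 2) -> sqint h.
    move=> mh hf; split => //; apply: le_lt_trans fi; apply: ge0_le_integral => //.
    - by move=> r _; rewrite lee_fin sqr_ge0.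
    - exact/measurable_EFinP/measurable_funX.
    - apply/measurable_EFinP; under eq_fun do rewrite normc_sqr.
      by apply: measurable_funD; exact: measurable_funX.
    - by move=> r _; rewrite lee_fin.
  by split; apply: dom => // r; rewrite normc_sqr ?lerDl ?lerDr sqr_ge0.
move=> [[mr ri] [mi ii]]; split => //.
under eq_integral do rewrite normc_sqr EFinD.
rewrite ge0_integralD//.
- by rewrite lte_add_pinfty.
- by move=> r _; rewrite lee_fin sqr_ge0.
- exact/measurable_EFinP/measurable_funX.
- by move=> r _; rewrite lee_fin sqr_ge0.
- exact/measurable_EFinP/measurable_funX.
Qed.

(** The real part of [L2dot] on L^2 ([Re_L2dot]), the only part that enters the derivative of the
    energy and the tangent space. *)
Definition rdot f g : R := ip f^re g^re + ip f^im g^im.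

Lemma L2D f g : L2 D f -> L2 D g -> L2 D (fun r => f r + g r).
Proof.
move=> /L2P[fr fi] /L2P[gr gi]; apply/L2P; split.
  by under eq_fun do rewrite raddfD; exact: sqintD.
by under eq_fun do rewrite raddfD; exact: sqintD.
Qed.

Lemma complex_ReM (z w : R[i]) :
  complex.Re (z * w) = complex.Re z * complex.Re w - complex.Im z * complex.Im w.
Proof. by case: z w => [a b] [c e]. Qed.

Lemma complex_ImM (z w : R[i]) :
  complex.Im (z * w) = complex.Re z * complex.Im w + complex.Im z * complex.Re w.
Proof. by case: z w => [a b] [c e]. Qed.

Lemma complex_ReJ (z : R[i]) : complex.Re z^* = complex.Re z.
Proof. by case: z. Qed.

Lemma complex_ImJ (z : R[i]) : complex.Im z^* = - complex.Im z.
Proof. by case: z. Qed.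

Lemma L2Z (c : R[i]) f : L2 D f -> L2 D (fun r => c * f r).
Proof.
move=> /L2P[fr fi]; apply/L2P; split.
  under eq_fun do rewrite complex_ReM.
  by apply: sqintB => //; exact: sqintZ.
under eq_fun do rewrite complex_ImM.
by apply: sqintD => //; exact: sqintZ.
Qed.

Lemma L2_bounded_mul (m : 'rV[R]_n -> R) (M : R) f : measurable_fun D m ->
  (forall r, D r -> `|m r| <= M) -> L2 D f -> L2 D (fun r => (m r)%:C * f r).
Proof.
move=> mm mM /L2P[fr fi]; apply/L2P; split.
  by under eq_fun do rewrite complex_ReM /= mul0r subr0; exact: sqint_bounded_mul mM fr.
by under eq_fun do rewrite complex_ImM /= mul0r addr0; exact: sqint_bounded_mul mM fi.
Qed.

Lemma rdotC f g : rdot f g = rdot g f.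
Proof. by rewrite /rdot ipC (ipC _ _ f^im). Qed.

Lemma rdotDl f g h : L2 D f -> L2 D g -> L2 D h ->
  rdot (fun r => f r + g r) h = rdot f h + rdot g h.
Proof.
move=> /L2P[fr fi] /L2P[gr gi] /L2P[hr hi]; rewrite /rdot.
under eq_fun do rewrite raddfD.
under [X in _ + ip X _]eq_fun do rewrite raddfD.
by rewrite !ipDl//=; ring.
Qed.

Lemma rdotZl (c : R) f h : L2 D f -> L2 D h ->
  rdot (fun r => c%:C * f r) h = c * rdot f h.
Proof.
move=> /L2P[fr fi] /L2P[hr hi]; rewrite /rdot.
under eq_fun do rewrite complex_ReM /= mul0r subr0.
under [X in _ + ip X _]eq_fun do rewrite complex_ImM /= mul0r addr0.
by rewrite !ipZl//=; ring.
Qed.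

Lemma rdotDr f g h : L2 D f -> L2 D g -> L2 D h ->
  rdot h (fun r => f r + g r) = rdot h f + rdot h g.
Proof. by move=> Lf Lg Lh; rewrite rdotC rdotDl// (rdotC f) (rdotC g). Qed.

Lemma rdotZr (c : R) f h : L2 D f -> L2 D h ->
  rdot h (fun r => c%:C * f r) = c * rdot h f.
Proof. by move=> Lf Lh; rewrite rdotC rdotZl// rdotC. Qed.

Lemma rdot_ge0 f : 0 <= rdot f f.
Proof. by rewrite addr_ge0// ip_ge0. Qed.

Lemma rdot_cauchy_schwarz f g : L2 D f -> L2 D g ->
  rdot f g ^+ 2 <= rdot f f * rdot g g.
Proof.
move=> Lf Lg; apply: discriminant_le; first exact: rdot_ge0.
move=> t; have Ltg := L2Z t%:C Lg.
have := rdot_ge0 (fun r => f r + t%:C * g r).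
rewrite rdotDl// ?rdotDr// ?rdotZl// ?rdotZr//; last exact: L2D.
by rewrite (rdotC g f); lra.
Qed.

Lemma rdot_ae f g f' g' :
  (\forall r \ae leb, D r -> f r = f' r) -> (\forall r \ae leb, D r -> g r = g' r) ->
  L2 D f -> L2 D g -> L2 D f' -> L2 D g' -> rdot f g = rdot f' g'.
Proof.
move=> ff' gg' /L2P[[fr _] [fi _]] /L2P[[gr _] [gi _]] /L2P[[fr' _] [fi' _]] /L2P[[gr' _] [gi' _]].
rewrite /rdot; congr (_ + _); apply: ip_ae => //.
- by apply: filterS ff' => r H /H ->.
- by apply: filterS gg' => r H /H ->.
- by apply: filterS ff' => r H /H ->.
- by apply: filterS gg' => r H /H ->.
Qed.

Lemma cintegralM f g : L2 D f -> L2 D g ->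
  cintegral D (fun r => f r * g r) =
  (ip f^re g^re - ip f^im g^im) +i* (ip f^re g^im + ip f^im g^re).
Proof.
move=> /L2P[fr fi] /L2P[gr gi]; rewrite /cintegral; congr (_ +i* _).
  under eq_Rintegral do rewrite complex_ReM.
  by rewrite RintegralB//; apply: integrableM_sqint.
under eq_Rintegral do rewrite complex_ImM.
by rewrite RintegralD//; apply: integrableM_sqint.
Qed.

Lemma L2J f : L2 D f -> L2 D (fun r => (f r)^*).
Proof.
move=> /L2P[fr fi]; apply/L2P; split; first by under eq_fun do rewrite complex_ReJ.
by under eq_fun do rewrite complex_ImJ; exact: sqintN.
Qed.

Lemma L2dotE f g : L2 D f -> L2 D g ->
  L2dot D f g = rdot f g +i* rdot f (fun r => - 'i * g r).
Proof.
move=> Lf Lg; have /L2P[fr fi] := Lf; have /L2P[gr gi] := Lg.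
rewrite /L2dot cintegralM//; last exact: L2J.
have E1 : (fun r => complex.Re (f r)^*) = f^re by apply/funext => r; rewrite complex_ReJ.
have E2 : (fun r => complex.Im (f r)^*) = fun r => -1 * complex.Im (f r).
  by apply/funext => r; rewrite complex_ImJ mulN1r.
have E3 : (fun r => complex.Re (- 'i * g r)) = g^im.
  by apply/funext => r; rewrite complex_ReM /=; ring.
have E4 : (fun r => complex.Im (- 'i * g r)) = fun r => -1 * complex.Re (g r).
  by apply/funext => r; rewrite complex_ImM /=; ring.
rewrite /rdot E1 E2 E3 E4 !ipZl// !ipZr//; congr (_ +i* _); ring.
Qed.

Lemma Re_L2dot f g : L2 D f -> L2 D g -> complex.Re (L2dot D f g) = rdot f g.
Proof. by move=> Lf Lg; rewrite L2dotE. Qed.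

Lemma L2norm_sqr f : L2 D f -> L2norm D f ^+ 2 = rdot f f.
Proof. by move=> Lf; rewrite /L2norm Re_L2dot// sqr_sqrtr// rdot_ge0. Qed.

End complex_L2.

Section weak_derivatives.
Local Open Scope complex_scope.
Context {R : realType} {n : nat}.
Variables (D : set 'rV[R]_n) (L : R).
Hypothesis oD : open D.
Hypothesis DL : forall r, D r -> forall j, `|r ord0 j| < L.
Local Notation leb := (lebesgue_measure_rV R n).
Local Notation sqint := (sqint leb D).
Local Notation ip := (ip leb D).
Local Notation "f ^re" := (fun r => complex.Re (f r)) (at level 2, format "f ^re").
Local Notation "f ^im" := (fun r => complex.Im (f r)) (at level 2, format "f ^im").
Implicit Types u v g h phi : 'rV[R]_n -> R[i].

Let mD : measurable D. Proof. exact: open_measurable_rV. Qed.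

Definition real_weak_pderiv i (f g : 'rV[R]_n -> R) :=
  sqint g /\ forall psi, rtest D psi -> ip f (pderiv i psi) = - ip g psi.

Lemma test_functionP phi : test_function D phi <-> rtest D phi^re /\ rtest D phi^im.
Proof.
split => [[sr si [K [cK KD pK]]]|[[sr [K [cK KD pK]]] [si [K' [cK' KD' pK']]]]].
  by split; split => //; exists K; split => // r /pK ->.
split => //; exists (K `|` K'); split; first exact: compactU.
  by move=> r [/KD|/KD'].
move=> r /not_orP[/pK rK /pK' rK'].
by apply/eqP; rewrite eq_complex /= rK rK' eqxx.
Qed.

Lemma rtest_cst0 : rtest D (fun=> 0).
Proof.
split; first exact/elementary_is_smooth/elementary_cst.
by exists set0; split => //; exact: compact0.
Qed.

Lemma test_function_L2 phi : test_function D phi -> L2 D phi.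
Proof.
by move=> /test_functionP[tr ti]; apply/(L2P oD); split; apply: (rtest_sqint oD DL).
Qed.

Lemma test_function_partial i phi : test_function D phi -> test_function D (partial i phi).
Proof.
by move=> /test_functionP[tr ti]; apply/test_functionP; split; exact: rtest_pderiv.
Qed.

Lemma weak_partialP i u g : L2 D u ->
  weak_partial D i u g <->
  real_weak_pderiv i u^re g^re /\ real_weak_pderiv i u^im g^im.
Proof.
move=> Lu; split.
  move=> [Lg H]; have /(L2P oD)[gr gi] := Lg.
  have key psi : rtest D psi -> ip u^re (pderiv i psi) = - ip g^re psi /\
      ip u^im (pderiv i psi) = - ip g^im psi.
    move=> tpsi; pose phi r := (psi r)%:C.
    have tphi : test_function D phi.
      by apply/test_functionP; split => //; exact: rtest_cst0.
    have Lpsi := rtest_sqint oD DL tpsi.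
    have Ldpsi := rtest_sqint oD DL (rtest_pderiv i tpsi).
    have := H _ tphi.
    rewrite !cintegralM//; [|exact: test_function_L2|exact/test_function_L2/test_function_partial].
    have E0 : (fun r : 'rV[R]_n => complex.Im (partial i phi r)) = fun r => 0 * 0.
      by apply/funext => r /=; rewrite mulr0; exact: derive_cst.
    have E1 : (fun r : 'rV[R]_n => complex.Im (phi r)) = fun r => 0 * 0.
      by apply/funext => r /=; rewrite mulr0.
    have s0 : sqint (fun=> 0) by exact: sqint0.
    have ip0 f : sqint f -> ip f (fun=> 0 * 0) = 0.
      by move=> Lf; rewrite ipZr// mul0r.
    have /(L2P oD)[ur ui] := Lu.
    rewrite E0 E1 !ip0// !subr0 !add0r => /eqP; rewrite eq_complex /= => /andP[/eqP -> /eqP ->].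
    by [].
  by split; split => // psi /key[].
move=> [[gr Hr] [gi Hi]]; split; first exact/(L2P oD).
move=> phi tphi; have /test_functionP[tr ti] := tphi.
rewrite !cintegralM//; first last.
- exact/test_function_L2/test_function_partial.
- exact: test_function_L2.
- exact/(L2P oD).
have Er : (fun r : 'rV[R]_n => complex.Re (partial i phi r)) = pderiv i phi^re by [].
have Ei : (fun r : 'rV[R]_n => complex.Im (partial i phi r)) = pderiv i phi^im by [].
rewrite Er Ei !Hr// !Hi//.
by apply/eqP; rewrite eq_complex /=; apply/andP; split; apply/eqP; ring.
Qed.

Lemma real_weak_pderiv_unique i (f g g' : 'rV[R]_n -> R) : real_weak_pderiv i f g ->
  real_weak_pderiv i f g' -> \forall r \ae leb, D r -> g r = g' r.
Proof.
move=> [Lg Hg] [Lg' Hg'].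
have := @fundamental_lemma _ _ D L oD DL (fun r => g r - g' r) (sqintB mD Lg Lg').
have H psi : rtest D psi -> ip (fun r => g r - g' r) psi = 0.
  move=> tpsi; have Lpsi := rtest_sqint oD DL tpsi.
  under [X in ip X _]eq_fun do rewrite -mulN1r.
  rewrite ipDl//; last exact: sqintZ.
  by rewrite ipZl// mulN1r; have := Hg _ tpsi; rewrite Hg'// => /oppr_inj ->; rewrite subrr.
by move=> /(_ H); apply: filterS => r /[apply] /eqP; rewrite subr_eq0 => /eqP.
Qed.

Lemma real_weak_pderivD i (f f' g g' : 'rV[R]_n -> R) : sqint f -> sqint f' ->
  real_weak_pderiv i f g -> real_weak_pderiv i f' g' ->
  real_weak_pderiv i (fun r => f r + f' r) (fun r => g r + g' r).
Proof.
move=> Lf Lf' [Lg Hg] [Lg' Hg']; split; first exact: sqintD.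
move=> psi tpsi; have Lpsi := rtest_sqint oD DL tpsi.
have Ldpsi := rtest_sqint oD DL (rtest_pderiv i tpsi).
by rewrite !ipDl// Hg// Hg'// opprD.
Qed.

Lemma real_weak_pderivZ i c (f g : 'rV[R]_n -> R) : sqint f ->
  real_weak_pderiv i f g -> real_weak_pderiv i (fun r => c * f r) (fun r => c * g r).
Proof.
move=> Lf [Lg Hg]; split; first exact: sqintZ.
move=> psi tpsi; have Lpsi := rtest_sqint oD DL tpsi.
have Ldpsi := rtest_sqint oD DL (rtest_pderiv i tpsi).
by rewrite !ipZl// Hg// mulrN.
Qed.

Lemma rtest_weak_pderiv i f : rtest D f -> real_weak_pderiv i f (pderiv i f).
Proof.
move=> tf; split; first exact/(rtest_sqint oD DL)/rtest_pderiv.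
by move=> psi tpsi; exact: (rtest_integration_by_parts oD DL).
Qed.

Lemma weak_partialD i u v g h : L2 D u -> L2 D v ->
  weak_partial D i u g -> weak_partial D i v h ->
  weak_partial D i (fun r => u r + v r) (fun r => g r + h r).
Proof.
move=> Lu Lv /(weak_partialP _ _ Lu)[ur ui] /(weak_partialP _ _ Lv)[vr vi].
have /(L2P oD)[Lur Lui] := Lu; have /(L2P oD)[Lvr Lvi] := Lv.
apply/weak_partialP; first exact: L2D.
split.
  by under eq_fun do rewrite raddfD; under [X in real_weak_pderiv _ _ X]eq_fun do rewrite raddfD; exact: real_weak_pderivD.
by under eq_fun do rewrite raddfD; under [X in real_weak_pderiv _ _ X]eq_fun do rewrite raddfD; exact: real_weak_pderivD.
Qed.

Lemma weak_partialZ i (c : R[i]) u g : L2 D u ->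
  weak_partial D i u g -> weak_partial D i (fun r => c * u r) (fun r => c * g r).
Proof.
move=> Lu /(weak_partialP _ _ Lu)[ur ui].
have /(L2P oD)[Lur Lui] := Lu.
apply/weak_partialP; first exact: L2Z.
split.
  rewrite (_ : (fun r => complex.Re (c * u r)) = fun r =>
    complex.Re c * complex.Re (u r) + - complex.Im c * complex.Im (u r)); last first.
    by apply/funext => r; rewrite complex_ReM mulNr.
  rewrite (_ : (fun r => complex.Re (c * g r)) = fun r =>
    complex.Re c * complex.Re (g r) + - complex.Im c * complex.Im (g r)); last first.
    by apply/funext => r; rewrite complex_ReM mulNr.
  by apply: real_weak_pderivD; try exact: sqintZ; exact: real_weak_pderivZ.
rewrite (_ : (fun r => complex.Im (c * u r)) = fun r =>
  complex.Re c * complex.Im (u r) + complex.Im c * complex.Re (u r)); last first.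
  by apply/funext => r; rewrite complex_ImM.
rewrite (_ : (fun r => complex.Im (c * g r)) = fun r =>
  complex.Re c * complex.Im (g r) + complex.Im c * complex.Re (g r)); last first.
  by apply/funext => r; rewrite complex_ImM.
by apply: real_weak_pderivD; try exact: sqintZ; exact: real_weak_pderivZ.
Qed.

Lemma test_weak_partial i phi : test_function D phi -> weak_partial D i phi (partial i phi).
Proof.
move=> tphi; have /test_functionP[tr ti] := tphi.
by apply/weak_partialP; [exact: test_function_L2|split; exact: rtest_weak_pderiv].
Qed.

Lemma weak_partial_unique i u g h : L2 D u -> weak_partial D i u g ->
  weak_partial D i u h -> \forall r \ae leb, D r -> g r = h r.
Proof.
move=> Lu /(weak_partialP _ _ Lu)[gr gi] /(weak_partialP _ _ Lu)[hr hi].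
apply: filterS2 (real_weak_pderiv_unique gr hr) (real_weak_pderiv_unique gi hi) => r Er Ei Dr.
by apply/eqP; rewrite eq_complex Er// Ei// !eqxx.
Qed.

Lemma H1_L2 u : H1 D u -> L2 D u. Proof. by case. Qed.

Lemma wpartialP i u : H1 D u -> weak_partial D i u (wpartial D i u).
Proof. by move=> [_ /(_ i)]; rewrite /wpartial => -[g ug]; case: xgetP => // /(_ g). Qed.

Lemma wpartial_L2 i u : H1 D u -> L2 D (wpartial D i u).
Proof. by move=> /(wpartialP i)[]. Qed.

Lemma wpartial_ae i u g : H1 D u -> weak_partial D i u g ->
  \forall r \ae leb, D r -> wpartial D i u r = g r.
Proof. by move=> Hu; apply: weak_partial_unique (H1_L2 Hu) (wpartialP i Hu). Qed.

Lemma H1D u v : H1 D u -> H1 D v -> H1 D (fun r => u r + v r).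
Proof.
move=> Hu Hv; split; first by apply: (L2D oD); exact: H1_L2.
move=> i; eexists; apply: weak_partialD; try exact: H1_L2; exact: wpartialP.
Qed.

Lemma H1Z (c : R[i]) u : H1 D u -> H1 D (fun r => c * u r).
Proof.
move=> Hu; split; first by apply: (L2Z oD); exact: H1_L2.
move=> i; eexists; apply: weak_partialZ; try exact: H1_L2; exact: wpartialP.
Qed.

Lemma test_H1 phi : test_function D phi -> H1 D phi.
Proof.
move=> tphi; split; first exact: test_function_L2.
by move=> i; exists (partial i phi); exact: test_weak_partial.
Qed.

Lemma wpartialD i u v : H1 D u -> H1 D v -> \forall r \ae leb, D r ->
  wpartial D i (fun r => u r + v r) r = wpartial D i u r + wpartial D i v r.
Proof.
move=> Hu Hv; apply: wpartial_ae; first exact: H1D.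
by apply: weak_partialD; try exact: H1_L2; exact: wpartialP.
Qed.

Lemma wpartialZ i (c : R[i]) u : H1 D u -> \forall r \ae leb, D r ->
  wpartial D i (fun r => c * u r) r = c * wpartial D i u r.
Proof.
move=> Hu; apply: wpartial_ae; first exact: H1Z.
by apply: weak_partialZ; try exact: H1_L2; exact: wpartialP.
Qed.

Lemma wpartial_test i phi : test_function D phi -> \forall r \ae leb, D r ->
  wpartial D i phi r = partial i phi r.
Proof. by move=> tphi; apply: wpartial_ae; [exact: test_H1|exact: test_weak_partial]. Qed.

Lemma test_functionD phi psi : test_function D phi -> test_function D psi ->
  test_function D (fun r => phi r + psi r).
Proof.
move=> /test_functionP[pr pi] /test_functionP[qr qi]; apply/test_functionP; split.
  by under eq_fun do rewrite raddfD; exact: rtestD.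
by under eq_fun do rewrite raddfD; exact: rtestD.
Qed.

Lemma rtestZ c f : rtest D f -> rtest D (fun r => c * f r).
Proof. by apply: rtestMl; exact/elementary_is_smooth/elementary_cst. Qed.

Lemma test_functionZ (c : R[i]) phi : test_function D phi ->
  test_function D (fun r => c * phi r).
Proof.
move=> /test_functionP[pr pi]; apply/test_functionP; split.
  under eq_fun do rewrite complex_ReM -mulNr.
  by apply: rtestD; exact: rtestZ.
under eq_fun do rewrite complex_ImM.
by apply: rtestD; exact: rtestZ.
Qed.

End weak_derivatives.

Section sobolev_space.
Local Open Scope complex_scope.
Context {R : realType} {n : nat}.
Variables (D : set 'rV[R]_n) (L : R).
Hypothesis oD : open D.
Hypothesis DL : forall r, D r -> forall j, `|r ord0 j| < L.
Local Opaque wpartial rdot.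
Local Notation rdot := (rdot D).
Local Notation H1 := (H1 D).
Local Notation H01 := (H01 D).
Local Notation wpartial := (wpartial D).
Implicit Types u v w phi : 'rV[R]_n -> R[i].

Lemma rdotD_le u v : L2 D u -> L2 D v ->
  rdot (fun r => u r + v r) (fun r => u r + v r) <= 2 * rdot u u + 2 * rdot v v.
Proof.
move=> Lu Lv; have Lv' := L2Z oD (-1)%:C Lv.
have := rdot_ge0 D (fun r => u r + (-1)%:C * v r).
rewrite !(rdotDl oD)//; try exact: L2D.
rewrite !(rdotDr oD)// !(rdotZl oD)// !(rdotZr oD)//.
by rewrite (rdotC D v u); lra.
Qed.

Definition gdot u v : R := \sum_(i < n) rdot (wpartial i u) (wpartial i v).

Lemma gdotC u v : gdot u v = gdot v u.
Proof. by apply: eq_bigr => i _; exact: rdotC. Qed.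

Lemma gdot_ge0 u : 0 <= gdot u u.
Proof. by apply: sumr_ge0 => i _; exact: rdot_ge0. Qed.

(** [wpartial] is chosen separately for each function: the derivative of a sum is the sum of the
    derivatives only almost everywhere, which [rdot_ae] absorbs. *)
Lemma gdotDl u v w : H1 u -> H1 v -> H1 w ->
  gdot (fun r => u r + v r) w = gdot u w + gdot v w.
Proof.
move=> Hu Hv Hw; rewrite /gdot -big_split; apply: eq_bigr => i _ /=.
have Lu := wpartial_L2 i Hu; have Lv := wpartial_L2 i Hv; have Lw := wpartial_L2 i Hw.
rewrite -(rdotDl oD Lu Lv Lw).
exact: (rdot_ae oD (wpartialD oD DL i Hu Hv) (aeW _ (fun _ _ => erefl))
  (wpartial_L2 i (H1D oD DL Hu Hv)) Lw (L2D oD Lu Lv) Lw).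
Qed.

Lemma gdotZl (c : R) u w : H1 u -> H1 w -> gdot (fun r => c%:C * u r) w = c * gdot u w.
Proof.
move=> Hu Hw; rewrite /gdot mulr_sumr; apply: eq_bigr => i _ /=.
have Lu := wpartial_L2 i Hu; have Lw := wpartial_L2 i Hw.
rewrite -(rdotZl oD c Lu Lw).
exact: (rdot_ae oD (wpartialZ oD DL i c%:C Hu) (aeW _ (fun _ _ => erefl))
  (wpartial_L2 i (H1Z oD DL c%:C Hu)) Lw (L2Z oD c%:C Lu) Lw).
Qed.

Local Opaque gdot.

Lemma gdotDr u v w : H1 u -> H1 v -> H1 w ->
  gdot w (fun r => u r + v r) = gdot w u + gdot w v.
Proof. by move=> Hu Hv Hw; rewrite gdotC (gdotDl Hu Hv Hw) (gdotC u w) (gdotC v w). Qed.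

Lemma gdotZr (c : R) u w : H1 u -> H1 w -> gdot w (fun r => c%:C * u r) = c * gdot w u.
Proof. by move=> Hu Hw; rewrite gdotC (gdotZl c Hu Hw) (gdotC u w). Qed.

Lemma gdotD_le u v : H1 u -> H1 v ->
  gdot (fun r => u r + v r) (fun r => u r + v r) <= 2 * gdot u u + 2 * gdot v v.
Proof.
move=> Hu Hv; have Hv' := H1Z oD DL (-1)%:C Hv.
have := gdot_ge0 (fun r => u r + (-1)%:C * v r).
have Hs := H1D oD DL Hu Hv; have Hs' := H1D oD DL Hu Hv'.
rewrite (gdotDl Hu Hv Hs) (gdotDl Hu Hv' Hs').
rewrite (gdotDr Hu Hv Hu) (gdotDr Hu Hv Hv) (gdotDr Hu Hv' Hu) (gdotDr Hu Hv' Hv').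
rewrite (gdotZl _ Hv Hu) (gdotZl _ Hv Hv') !(gdotZr _ Hv Hu) (gdotZr _ Hv Hv).
rewrite (gdotC v u).
move: (gdot u u) (gdot u v) (gdot v v) => a b c; lra.
Qed.

Lemma gdotE u v : gdot u v = \sum_(i < n) rdot (wpartial i u) (wpartial i v).
Proof. by []. Qed.

Lemma H01norm_sqr u : H1 u -> H01norm D u ^+ 2 = gdot u u.
Proof.
move=> Hu; rewrite /H01norm sqr_sqrtr; last by apply: sumr_ge0 => i _; exact: sqr_ge0.
rewrite gdotE; by apply: eq_bigr => i _; rewrite (L2norm_sqr oD)//; exact: wpartial_L2.
Qed.

Lemma H1norm_sqr u : H1 u -> H1norm D u ^+ 2 = rdot u u + gdot u u.
Proof.
move=> Hu; rewrite /H1norm sqr_sqrtr.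
  rewrite (L2norm_sqr oD); last exact: H1_L2.
  rewrite gdotE; congr (_ + _); apply: eq_bigr => i _; rewrite (L2norm_sqr oD)//; exact: wpartial_L2.
by rewrite addr_ge0 ?sqr_ge0//; apply: sumr_ge0 => i _; exact: sqr_ge0.
Qed.

Lemma sub_addN u v : (fun r => u r - v r) = (fun r => u r + (-1)%:C * v r).
Proof. by apply/funext => r; rewrite rmorphN rmorph1 mulN1r. Qed.

Lemma H1B u v : H1 u -> H1 v -> H1 (fun r => u r - v r).
Proof. by move=> Hu Hv; rewrite sub_addN; exact: (H1D oD DL Hu (H1Z oD DL _ Hv)). Qed.

Lemma H01_dense u e : H01 u -> 0 < e -> exists2 phi, test_function D phi &
  rdot (fun r => u r - phi r) (fun r => u r - phi r) +
  gdot (fun r => u r - phi r) (fun r => u r - phi r) < e.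
Proof.
move=> [Hu du] e0; have se0 : 0 < Num.sqrt e by rewrite sqrtr_gt0.
have [phi tphi lt] := du _ se0; exists phi => //.
have Hd : H1 (fun r => u r - phi r) by apply: H1B => //; exact: (test_H1 oD DL).
rewrite -(H1norm_sqr Hd) -(sqr_sqrtr (ltW e0)).
by rewrite ltr_pXn2r// nnegrE sqrtr_ge0.
Qed.

Lemma H01_from_dense u : H1 u -> (forall e, 0 < e -> exists2 phi, test_function D phi &
    rdot (fun r => u r - phi r) (fun r => u r - phi r) +
    gdot (fun r => u r - phi r) (fun r => u r - phi r) < e) -> H01 u.
Proof.
move=> Hu du; split => // e e0; have [|phi tphi lt] := du (e ^+ 2); first exact: exprn_gt0.
exists phi => //.
have Hd : H1 (fun r => u r - phi r) by apply: H1B => //; exact: (test_H1 oD DL).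
move: lt; rewrite -(H1norm_sqr Hd) ltr_pXn2r// nnegrE; [exact: sqrtr_ge0|exact: ltW].
Qed.

Lemma H01_H1 u : H01 u -> H1 u. Proof. by case. Qed.

Lemma H01D u v : H01 u -> H01 v -> H01 (fun r => u r + v r).
Proof.
move=> Hu Hv; have H1u := H01_H1 Hu; have H1v := H01_H1 Hv.
apply: H01_from_dense; first exact: (H1D oD DL).
move=> e e0; have e4 : 0 < e / 4 by rewrite divr_gt0.
have [p tp pe] := H01_dense Hu e4; have [q tq qe] := H01_dense Hv e4.
exists (fun r => p r + q r); first exact: test_functionD.
have Hp : H1 (fun r => u r - p r) by apply: H1B => //; exact: (test_H1 oD DL).
have Hq : H1 (fun r => v r - q r) by apply: H1B => //; exact: (test_H1 oD DL).
have -> : (fun r => u r + v r - (p r + q r)) = (fun r => (u r - p r) + (v r - q r)).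
  by apply/funext => r; rewrite opprD addrACA.
have := rdotD_le (H1_L2 Hp) (H1_L2 Hq); have := gdotD_le Hp Hq.
move: pe qe; set a1 := rdot _ _; set a2 := gdot _ _; set a3 := rdot _ _; set a4 := gdot _ _.
set a5 := gdot _ _; set a6 := rdot _ _.
by move: a1 a2 a3 a4 a5 a6 => a1 a2 a3 a4 a5 a6; lra.
Qed.

Lemma H01Z (c : R) u : H01 u -> H01 (fun r => c%:C * u r).
Proof.
move=> Hu; have H1u := H01_H1 Hu.
apply: H01_from_dense; first exact: (H1Z oD DL).
move=> e e0; have c1 : 0 < c ^+ 2 + 1 by rewrite ltr_wpDl// sqr_ge0.
have ec : 0 < e / (c ^+ 2 + 1) by rewrite divr_gt0.
have [p tp pe] := H01_dense Hu ec.
exists (fun r => c%:C * p r); first exact: test_functionZ.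
have Hp : H1 (fun r => u r - p r) by apply: H1B => //; exact: (test_H1 oD DL).
have -> : (fun r => c%:C * u r - c%:C * p r) = (fun r => c%:C * (u r - p r)).
  by apply/funext => r; rewrite mulrBr.
have Hcp := H1Z oD DL c%:C Hp.
have Lp := H1_L2 Hp.
rewrite (gdotZl _ Hp Hcp) (gdotZr _ Hp Hp) (rdotZl oD _ Lp (H1_L2 Hcp)) (rdotZr oD _ Lp Lp).
rewrite ltr_pdivlMr// in pe; apply: le_lt_trans pe.
have := rdot_ge0 D (fun r => u r - p r); have := gdot_ge0 (fun r => u r - p r).
set a := rdot _ _; set b := gdot _ _.
by move: a b => a b a0 b0; have := addr_ge0 a0 b0; lra.
Qed.

Lemma H01B u v : H01 u -> H01 v -> H01 (fun r => u r - v r).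
Proof. by move=> Hu Hv; rewrite sub_addN; exact: (H01D Hu (H01Z (-1) Hv)). Qed.

Lemma H01_sub_scale (c : R) u v : H01 u -> H01 v -> H01 (fun r => u r - c%:C * v r).
Proof. by move=> Hu Hv; exact: (H01B Hu (H01Z c Hv)). Qed.

End sobolev_space.

(** In the spatial bound the derivative in the first direction is added, so that the sum becomes the
    full gradient energy. *)
Lemma integral4_flux (R : realType) (n : nat) (L : R) (f : 'rV[R]_n.+1 -> R) :
  n.+1 = 2%N \/ n.+1 = 3%N -> C1c L f ->
  (exists i j, \int[lebesgue_measure_rV R n.+1]_r (f r ^+ 4)%:E <= flux i f * flux j f)%E \/
  (\int[lebesgue_measure_rV R n.+1]_r (f r ^+ 4)%:E <=
    4%:E * flux ord0 f * \sum_(i < n.+1) nsq (pderiv i f))%E.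
Proof.
case=> -[n1]; rewrite n1 in f * => fC; [left|right].
  by exists (lift ord0 ord0), ord0; exact: integral4_le2 fC.
apply: (le_trans (integral4_le3 fC)).
apply: lee_wpmul2l; first by rewrite mule_ge0// flux_ge0.
rewrite !big_ord_recl big_ord0.
move: (nsq_ge0 (pderiv ord0 f)); generalize (nsq (pderiv ord0 f)) => a.
generalize (nsq (pderiv (lift ord0 ord0) f)) => b.
generalize (nsq (pderiv (lift ord0 (lift ord0 ord0)) f)) => c a0.
Show.
by rewrite adde0 leeDr.
Qed.

(** * Poincare and L^4 estimates with explicit constants *)

Section real_test_estimates.
Context {R : realType} {n : nat}.
Variables (D : set 'rV[R]_n.+1) (L : R).
Hypothesis oD : open D.
Hypothesis L0 : 0 <= L.
Hypothesis DL : forall r, D r -> forall j, `|r ord0 j| < L.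
Local Notation leb := (lebesgue_measure_rV R n.+1).
Local Notation ip := (ip leb D).
Implicit Types f : 'rV[R]_n.+1 -> R.

Let mD : measurable D. Proof. exact: open_measurable_rV. Qed.

Definition rgrad f : R := \sum_(i < n.+1) ip (pderiv i f) (pderiv i f).

Lemma nsq_rtest f : rtest D f -> nsq f = (ip f f)%:E.
Proof.
move=> tf; rewrite -(ip_sqr mD (rtest_sqint oD DL tf)) /nsq -(@integral_domain _ _ D)//.
by move=> r /(rtest_out tf) ->; rewrite expr0n.
Qed.

Lemma nsq_pderiv_rtest i f : rtest D f ->
  nsq (pderiv i f) = (ip (pderiv i f) (pderiv i f))%:E.
Proof. by move=> tf; exact/nsq_rtest/rtest_pderiv. Qed.

Lemma rgrad_ge i f : ip (pderiv i f) (pderiv i f) <= rgrad f.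
Proof.
rewrite /rgrad (bigD1 i)//= lerDl; apply: sumr_ge0 => j _; exact: ip_ge0.
Qed.

Lemma rgrad_ge0 f : 0 <= rgrad f.
Proof. by apply: sumr_ge0 => j _; exact: ip_ge0. Qed.

Lemma rtest_flux i f : rtest D f -> exists F : R, [/\ 0 <= F, flux i f = F%:E &
  F ^+ 2 <= 4 * (ip f f * rgrad f)].
Proof.
move=> tf; have := flux_sq_le i (rtest_C1c DL tf).
rewrite nsq_rtest// nsq_pderiv_rtest// -!EFinM.
have := flux_ge0 i f; case: (flux i f) => [F|_|//]; last by rewrite mulyy leye_eq.
rewrite lee_fin => F0; rewrite -EFinM lee_fin -expr2 => F2.
exists F; split=> //; apply: le_trans F2 _.
by rewrite ler_wpM2l// ler_wpM2l ?ip_ge0 ?rgrad_ge.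
Qed.

(** With N and G the squared norms of [f] and of its gradient, N <= 2 L F and F^2 <= 4 N G give N^2
    <= 16 L^2 N G, and one factor N cancels. *)
Lemma rtest_poincare f : rtest D f -> ip f f <= 16 * L ^+ 2 * rgrad f.
Proof.
move=> tf; have [F [F0 FE F2]] := rtest_flux ord0 tf.
have := nsq_le_flux L0 (rtest_C1c DL tf).
rewrite nsq_rtest// FE -EFinM lee_fin.
have := ip_ge0 leb D f; have := rgrad_ge0 f.
move: (ip f f) (rgrad f) F2 => N G F2 G0 N0 NF.
have [->|Nn0] := eqVneq N 0; first by rewrite !mulr_ge0 ?exprn_ge0.
have Np : 0 < N by rewrite lt_def Nn0.
rewrite -(ler_pM2l Np).
have : N * N <= (2 * L * F) * (2 * L * F) by apply: ler_pM.
have : (2 * L) ^+ 2 * F ^+ 2 <= (2 * L) ^+ 2 * (4 * (N * G)).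
  by rewrite ler_wpM2l// sqr_ge0.
by lra.
Qed.

(** In dimension 3 the bound (4 F G)^2 <= 64 N G^3 is direct. In dimension 2 the product of fluxes
    gives 16 N^2 G^2, and Poincare trades one N for 16 L^2 G, whence 256 L^2. The sum of the
    constants serves both dimensions. *)
Lemma rtest_integral4_fin f : (n.+1 = 2%N \/ n.+1 = 3%N) -> rtest D f ->
  exists X : R, [/\ 0 <= X, (\int[leb]_(r in D) (f r ^+ 4)%:E = X%:E)%E &
    X ^+ 2 <= (64 + 256 * L ^+ 2) * (ip f f * rgrad f ^+ 3)].
Proof.
move=> n23 tf.
have -> : (\int[leb]_(r in D) (f r ^+ 4)%:E = \int[leb]_r (f r ^+ 4)%:E)%E.
  by apply: integral_domain => r /(rtest_out tf) ->; rewrite expr0n.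
have I0 : (0 <= \int[leb]_r (f r ^+ 4)%:E)%E.
  by apply: integral_ge0 => r _; rewrite lee_fin -[4%N]/(2 * 2)%N exprM sqr_ge0.
suff [Y [YI Y0 Y2]] : exists Y : R, [/\ (\int[leb]_r (f r ^+ 4)%:E <= Y%:E)%E, 0 <= Y &
    Y ^+ 2 <= (64 + 256 * L ^+ 2) * (ip f f * rgrad f ^+ 3)].
  move: YI I0; case: (integral _ _ _) => [X|//|//].
  rewrite !lee_fin => XY X0; exists X; split => //; apply: le_trans Y2.
  by rewrite ler_pXn2r ?nnegrE.
have N0 := ip_ge0 leb D f; have G0 := rgrad_ge0 f; have NG := rtest_poincare tf.
have [[i [j le4]]|le4] := integral4_flux n23 (rtest_C1c DL tf).
  have [F [F0 FE F2]] := rtest_flux i tf; have [F' [F'0 FE' F'2]] := rtest_flux j tf.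
  exists (F * F'); split; [by rewrite EFinM -FE -FE'|exact: mulr_ge0|].
  move: (ip f f) (rgrad f) F2 F'2 N0 G0 NG => N G F2 F'2 N0 G0 NG.
  have H1 : (F * F') ^+ 2 <= (4 * (N * G)) * (4 * (N * G)).
    by rewrite exprMn; apply: ler_pM => //; exact: sqr_ge0.
  apply: (le_trans H1).
  have -> : 4 * (N * G) * (4 * (N * G)) = (16 * N * G ^+ 2) * N by ring.
  have -> : (64 + 256 * L ^+ 2) * (N * G ^+ 3) =
    (16 * N * G ^+ 2) * (16 * L ^+ 2 * G) + 64 * (N * G ^+ 3) by ring.
  apply: ler_wpDr; first by rewrite !mulr_ge0 ?exprn_ge0.
  by rewrite ler_wpM2l// !mulr_ge0 ?exprn_ge0.
have [F [F0 FE F2]] := rtest_flux ord0 tf.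
have E : (\sum_(i < n.+1) nsq (pderiv i f) = (rgrad f)%:E)%E.
  by rewrite /rgrad -sumEFin; apply: eq_bigr => i _; exact: nsq_pderiv_rtest.
exists (4 * F * rgrad f); split.
- by rewrite !EFinM -FE -E.
- by rewrite !mulr_ge0.
move: (ip f f) (rgrad f) F2 N0 G0 {E NG le4} => N G F2 N0 G0.
have -> : (4 * F * G) ^+ 2 = 16 * G ^+ 2 * F ^+ 2 by ring.
have H : 16 * G ^+ 2 * F ^+ 2 <= 16 * G ^+ 2 * (4 * (N * G)).
  by rewrite ler_wpM2l// mulr_ge0 ?exprn_ge0.
apply: (le_trans H).
have -> : 16 * G ^+ 2 * (4 * (N * G)) = 64 * (N * G ^+ 3) by ring.
by rewrite ler_wpM2r ?mulr_ge0 ?exprn_ge0// lerDl mulr_ge0 ?sqr_ge0.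
Qed.

End real_test_estimates.

(** The last step of a density argument: replacing a function by a test function costs an error
    linear in [e]. *)
Lemma le_of_small (R : realFieldType) (a b c : R) :
  (forall e, 0 < e <= 1 -> a <= b + e * c) -> a <= b.
Proof.
move=> H; rewrite leNgt; apply/negP => ba.
have c1 : 0 < `|c| + 1 by rewrite ltr_wpDl.
pose e := Num.min 1 ((a - b) / (2 * (`|c| + 1))).
have e0 : 0 < e by rewrite lt_min ltr01 divr_gt0 ?subr_gt0// mulr_gt0.
have e1 : e <= 1 by rewrite ge_min lexx.
have := H e; rewrite e0 e1 => /(_ erefl).
have : e * (2 * (`|c| + 1)) <= a - b.
  by rewrite -ler_pdivlMr ?mulr_gt0// ge_min lexx orbT.
have : e * c <= e * `|c| by rewrite ler_pM2l// ler_norm.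
lra.
Qed.

Section H01_estimates.
Local Open Scope complex_scope.
Context {R : realType} {n : nat}.
Variables (D : set 'rV[R]_n.+1) (L : R).
Hypothesis oD : open D.
Hypothesis L0 : 0 <= L.
Hypothesis DL : forall r, D r -> forall j, `|r ord0 j| < L.
Local Notation leb := (lebesgue_measure_rV R n.+1).
Local Notation ip := (ip leb D).
Local Notation rdot := (rdot D).
Local Notation gdot := (gdot D).
Local Notation "f ^re" := (fun r => complex.Re (f r)) (at level 2, format "f ^re").
Local Notation "f ^im" := (fun r => complex.Im (f r)) (at level 2, format "f ^im").
Implicit Types u v w phi : 'rV[R]_n.+1 -> R[i].

Let mD : measurable D. Proof. exact: open_measurable_rV. Qed.

Definition csq u (r : 'rV[R]_n.+1) : R := complex.Re (u r) ^+ 2 + complex.Im (u r) ^+ 2.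

Lemma csq_ge0 u r : 0 <= csq u r.
Proof. by rewrite addr_ge0 ?sqr_ge0. Qed.

Lemma measurable_csq u : L2 D u -> measurable_fun D (csq u).
Proof. by move=> [mr mi _]; apply: measurable_funD; exact: measurable_funX. Qed.

Lemma rdot_csq u : L2 D u -> (\int[leb]_(r in D) (csq u r)%:E = (rdot u u)%:E)%E.
Proof.
move=> Lu; have [mr mi _] := Lu; have /(L2P oD)[ur ui] := Lu.
rewrite /csq; under eq_integral do rewrite EFinD.
rewrite ge0_integralD//.
- by rewrite !ip_sqr// -EFinD.
- by move=> r _; rewrite lee_fin sqr_ge0.
- exact/measurable_EFinP/measurable_funX.
- by move=> r _; rewrite lee_fin sqr_ge0.
- exact/measurable_EFinP/measurable_funX.
Qed.

Lemma gdot_test phi : test_function D phi ->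
  gdot phi phi = rgrad D phi^re + rgrad D phi^im.
Proof.
move=> tphi; rewrite gdotE /rgrad -big_split; apply: eq_bigr => i _ /=.
have Hphi := test_H1 oD DL tphi.
have Lw := wpartial_L2 i Hphi.
have Lp := test_function_L2 oD DL (test_function_partial i tphi).
have ae := wpartial_test oD DL i tphi.
by rewrite (rdot_ae oD ae ae Lw Lw Lp Lp).
Qed.

Lemma test_poincare phi : test_function D phi ->
  rdot phi phi <= 16 * L ^+ 2 * gdot phi phi.
Proof.
move=> tphi; rewrite (gdot_test tphi) mulrDr.
have /test_functionP[tr ti] := tphi.
exact: lerD (rtest_poincare oD L0 DL tr) (rtest_poincare oD L0 DL ti).
Qed.

(** |phi|^4 is at most twice the sum of the fourth powers of the real and imaginary parts, and (2 X
    + 2 Y)^2 <= 8 X^2 + 8 Y^2 accounts for the factor 8. *)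
Lemma test_integral4 phi : (n.+1 = 2%N \/ n.+1 = 3%N) -> test_function D phi ->
  exists X : R, [/\ 0 <= X, (\int[leb]_(r in D) (csq phi r ^+ 2)%:E <= X%:E)%E &
    X ^+ 2 <= 8 * (64 + 256 * L ^+ 2) * (rdot phi phi * gdot phi phi ^+ 3)].
Proof.
move=> n23 tphi; have /test_functionP[tr ti] := tphi.
have [X [X0 XI X2]] := rtest_integral4_fin oD L0 DL n23 tr.
have [Y [Y0 YI Y2]] := rtest_integral4_fin oD L0 DL n23 ti.
have mr := rtest_measurable DL tr; have mi := rtest_measurable DL ti.
exists (2 * X + 2 * Y); split.
- by rewrite addr_ge0// mulr_ge0.
- rewrite EFinD !EFinM -XI -YI.
  have m4 (f : 'rV[R]_n.+1 -> R) : measurable_fun setT f ->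
      measurable_fun D (fun r => (f r ^+ 4)%:E).
    by move=> mf; apply/measurable_EFinP/measurable_funX/measurable_funTS.
  have e4 (y : R) : 0 <= y ^+ 4 by rewrite -[4%N]/(2 * 2)%N exprM sqr_ge0.
  have p4 (f : 'rV[R]_n.+1 -> R) r : D r -> (0 <= (f r ^+ 4)%:E)%E by rewrite lee_fin.
  rewrite -(ge0_integralZl_EFin leb mD (p4 phi^re) (m4 _ mr))//.
  rewrite -(ge0_integralZl_EFin leb mD (p4 phi^im) (m4 _ mi))//.
  rewrite -ge0_integralD//; last 4 first.
  + by move=> r _; rewrite lee_fin mulr_ge0.
  + by apply/measurable_EFinP/measurable_funM => //; apply/measurable_funX/measurable_funTS.
  + by move=> r _; rewrite lee_fin mulr_ge0.
  + by apply/measurable_EFinP/measurable_funM => //; apply/measurable_funX/measurable_funTS.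
  apply: ge0_le_integral => //.
  + by move=> r _; rewrite lee_fin sqr_ge0.
  + apply/measurable_EFinP/measurable_funX.
    exact: (measurable_csq (test_function_L2 oD DL tphi)).
  + apply/measurable_EFinP/measurable_funD; apply: measurable_funM => //;
      by apply/measurable_funX/measurable_funTS.
  + move=> r _; rewrite -EFinD lee_fin /csq.
    move: (complex.Re _) (complex.Im _) => a b.
    rewrite -subr_ge0.
    have -> : 2 * a ^+ 4 + 2 * b ^+ 4 - (a ^+ 2 + b ^+ 2) ^+ 2 = (a ^+ 2 - b ^+ 2) ^+ 2 by ring.
    exact: sqr_ge0.
rewrite (gdot_test tphi) /rdot.
have := rgrad_ge0 D phi^re; have := rgrad_ge0 D phi^im.
have := ip_ge0 leb D phi^re; have := ip_ge0 leb D phi^im.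
move: X2 Y2; move: (rgrad D phi^re) (rgrad D phi^im) (ip phi^re phi^re) (ip phi^im phi^im).
move=> G1 G2 N1 N2 X2 Y2 N20 N10 G20 G10.
set c := 64 + 256 * L ^+ 2 in X2 Y2 *.
have c0 : 0 <= c.
  by apply: addr_ge0; [exact: ler0n|apply: mulr_ge0; [exact: ler0n|exact: sqr_ge0]].
have H : (2 * X + 2 * Y) ^+ 2 <= 8 * X ^+ 2 + 8 * Y ^+ 2.
  have := sqr_ge0 (X - Y); nra.
apply: (le_trans H).
have H1 : N1 * G1 ^+ 3 <= N1 * (G1 + G2) ^+ 3.
  by rewrite ler_wpM2l// lerXn2r ?nnegrE ?addr_ge0// lerDl.
have H2 : N2 * G2 ^+ 3 <= N2 * (G1 + G2) ^+ 3.
  by rewrite ler_wpM2l// lerXn2r ?nnegrE ?addr_ge0// lerDr.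
have H3 := ler_wpM2l c0 H1; have H4 := ler_wpM2l c0 H2.
rewrite (mulrDl N1 N2) mulrDr -!mulrA.
by move: (c * _) (c * _) (c * _) (c * _) X2 Y2 H3 H4 => p q r s; lra.
Qed.

Lemma test_approximation u e : H01 D u -> 0 < e -> exists phi,
  [/\ test_function D phi, L2 D (fun r => u r - phi r),
      rdot (fun r => u r - phi r) (fun r => u r - phi r) <= e,
      rdot phi phi <= 2 * rdot u u + 2 * e &
      gdot phi phi <= 2 * gdot u u + 2 * e].
Proof.
move=> Hu e0; have [phi tphi lte] := H01_dense oD DL Hu e0.
have H1u := H01_H1 Hu; have H1p := test_H1 oD DL tphi.
have H1d := H1B oD DL H1u H1p.
have Ld := H1_L2 H1d; have H1d' := H1Z oD DL (-1)%:C H1d; have Ld' := H1_L2 H1d'.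
have E : phi = fun r => u r + (-1)%:C * (u r - phi r).
  by apply/funext => r; rewrite rmorphN rmorph1 mulN1r opprB addrC subrK.
have Er : rdot (fun r => (-1)%:C * (u r - phi r)) (fun r => (-1)%:C * (u r - phi r)) =
    rdot (fun r => u r - phi r) (fun r => u r - phi r).
  by rewrite (rdotZl oD _ Ld Ld') (rdotZr oD _ Ld Ld) mulrA mulrNN !mul1r.
have Eg : gdot (fun r => (-1)%:C * (u r - phi r)) (fun r => (-1)%:C * (u r - phi r)) =
    gdot (fun r => u r - phi r) (fun r => u r - phi r).
  by rewrite (gdotZl oD DL _ H1d H1d') (gdotZr oD DL _ H1d H1d) mulrA mulrNN !mul1r.
have de : rdot (fun r => u r - phi r) (fun r => u r - phi r) <= e.
  by apply: le_trans (ltW lte); rewrite lerDl gdot_ge0.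
have ge : gdot (fun r => u r - phi r) (fun r => u r - phi r) <= e.
  by apply: le_trans (ltW lte); rewrite lerDr rdot_ge0.
exists phi; split; [exact: tphi|exact: Ld|exact: de| |].
  have := rdotD_le oD (H1_L2 H1u) Ld'; rewrite -E Er => /le_trans; apply.
  by rewrite lerD2l ler_pM2l.
have := gdotD_le oD DL H1u H1d'; rewrite -E Eg => /le_trans; apply.
by rewrite lerD2l ler_pM2l.
Qed.

Lemma rdot_split u phi : L2 D phi -> L2 D (fun r => u r - phi r) ->
  rdot u u <= 2 * rdot phi phi + 2 * rdot (fun r => u r - phi r) (fun r => u r - phi r).
Proof.
move=> Lp Ld; have := rdotD_le oD Lp Ld.
by have -> : (fun r => phi r + (u r - phi r)) = u by apply/funext => r; rewrite addrC subrK.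
Qed.

(** Going from [u] to a test function and back loses a factor 2 each time, which turns 16 into
    64. *)
Lemma H01_poincare u : H01 D u -> rdot u u <= 64 * L ^+ 2 * gdot u u.
Proof.
move=> Hu; apply: (@le_of_small _ _ _ (64 * L ^+ 2 + 2)) => e /andP[e0 _].
have [phi [tphi Ld de _ gphi]] := test_approximation Hu e0.
have Lp := test_function_L2 oD DL tphi.
have P := test_poincare tphi.
have S := rdot_split Lp Ld.
move: (rdot u u) (rdot phi phi) (gdot phi phi) (gdot u u) P S de gphi.
set x := rdot _ _; move: x => x a b g g' P S de gphi.
move: P (ler_wpM2l (sqr_ge0 L) gphi); move: (L ^+ 2) => l P Q; nra.
Qed.

(* For [s = |u|^2], [p = |phi|^2] and [q = |u - phi|^2]: truncating at [K] leaves a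
   left-hand side known to be integrable and an error linear in [q]. *)
Lemma truncation_le (s p q K : R) : 0 <= s -> 0 <= p -> 0 <= q -> 0 <= K ->
  s <= 2 * p + 2 * q -> Num.min s K ^+ 2 <= 8 * p ^+ 2 + 4 * K * q.
Proof.
move=> s0 p0 q0 K0 spq; set m := Num.min s K.
have m0 : 0 <= m by rewrite le_min s0.
have ms : m <= s by rewrite ge_min lexx.
have mK : m <= K by rewrite ge_min lexx orbT.
have H1 : m * m <= m * (2 * p + 2 * q) by rewrite ler_wpM2l// (le_trans ms).
have H2 : m * q <= K * q by rewrite ler_wpM2r.
have H3 := sqr_ge0 (m - 2 * p); have H4 := sqr_ge0 p.
clearbody m; nra.
Qed.

Lemma csq_split u phi r : csq u r <= 2 * csq phi r + 2 * csq (fun r => u r - phi r) r.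
Proof.
rewrite /csq; case: (u r) => a b; case: (phi r) => c e /=.
have := sqr_ge0 (a - 2 * c); have := sqr_ge0 (b - 2 * e).
lra.
Qed.

End H01_estimates.

Section H01_integral4.
Local Open Scope complex_scope.
Context {R : realType} {n : nat}.
Variables (D : set 'rV[R]_n.+1) (L : R).
Hypothesis oD : open D.
Hypothesis L0 : 0 <= L.
Hypothesis DL : forall r, D r -> forall j, `|r ord0 j| < L.
Local Notation leb := (lebesgue_measure_rV R n.+1).
Local Notation ip := (ip leb D).
Local Notation sqint := (sqint leb D).
Local Notation rdot := (rdot D).
Local Notation gdot := (gdot D).
Implicit Types u v w phi : 'rV[R]_n.+1 -> R[i].

Let mD : measurable D. Proof. exact: open_measurable_rV. Qed.

(** 8 (64 + 256 L^2) comes from [test_integral4]. The factor 2048 = 128 * 16 is lost by density: 128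
    when 8 X plus an error is squared, 16 from N' <= 2 N and G' <= 2 G, up to errors, in N' G'^3. *)
Definition ladyzhenskaya_cst : R := 2048 * (8 * (64 + 256 * L ^+ 2)).

Lemma ladyzhenskaya_cst_ge0 : 0 <= ladyzhenskaya_cst.
Proof.
apply: mulr_ge0; first exact: ler0n.
apply: mulr_ge0; first exact: ler0n.
by apply: addr_ge0; [exact: ler0n|apply: mulr_ge0; [exact: ler0n|exact: sqr_ge0]].
Qed.

Lemma truncated_bound (Y X c N G N' G' K e : R) :
  0 <= Y -> 0 <= X -> 0 <= c -> 0 <= N -> 0 <= G -> 0 <= N' -> 0 <= G' -> 0 <= K -> 0 < e <= 1 ->
  N' <= 2 * N + 2 * e -> G' <= 2 * G + 2 * e ->
  X ^+ 2 <= c * (N' * G' ^+ 3) -> Y <= 8 * X + 4 * K * e ->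
  Y ^+ 2 <= 2048 * c * (N * G ^+ 3) +
    e * (2048 * c * (3 * N * (G + 1) ^+ 2 + (G + 1) ^+ 3) + 32 * K ^+ 2).
Proof.
move=> Y0 X0 c0 N0 G0 N'0 G'0 K0 /andP[e0 e1] N'N G'G X2 YX.
have Ke0 : 0 <= K * e by rewrite mulr_ge0// ltW.
have H1 : Y ^+ 2 <= 128 * X ^+ 2 + 32 * K ^+ 2 * e.
  apply: (@le_trans _ _ ((8 * X + 4 * K * e) ^+ 2)).
    by rewrite ler_pXn2r ?nnegrE// addr_ge0 ?mulr_ge0// ltW.
  apply: (@le_trans _ _ (128 * X ^+ 2 + 32 * (K * e) ^+ 2)).
    by have := sqr_ge0 (8 * X - 4 * (K * e)); nra.
  rewrite lerD2l -mulrA ler_pM2l// exprMn ler_wpM2l ?sqr_ge0//.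
  by rewrite expr2 -[leRHS]mulr1 ler_pM2l.
apply: (le_trans H1).
have H2 : N' * G' ^+ 3 <= (2 * N + 2 * e) * (2 * G + 2 * e) ^+ 3.
  apply: ler_pM => //; first exact: exprn_ge0.
  by rewrite lerXn2r ?nnegrE// (le_trans G'0).
have H3 : (2 * N + 2 * e) * (2 * G + 2 * e) ^+ 3 = 16 * ((N + e) * (G + e) ^+ 3) by ring.
have H4 : (N + e) * (G + e) ^+ 3 <= N * G ^+ 3 + e * (3 * N * (G + 1) ^+ 2 + (G + 1) ^+ 3).
  have g3 : (G + e) ^+ 3 <= (G + 1) ^+ 3.
    apply: lerXn2r; rewrite ?nnegrE ?lerD2l//; apply: addr_ge0 => //; exact: ltW.
  have g2 : (G + e) ^+ 3 <= G ^+ 3 + e * (3 * (G + 1) ^+ 2).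
    have -> : (G + e) ^+ 3 = G ^+ 3 + e * (3 * G ^+ 2 + 3 * G * e + e ^+ 2) by ring.
    rewrite lerD2l ler_pM2l//; have : e ^+ 2 <= 1 by rewrite expr2 mulr_ile1// ltW.
    have : G * e <= G * 1 by rewrite ler_wpM2l.
    by move: (e ^+ 2) (G * e) => a b; rewrite mulr1; nra.
  rewrite mulrDl mulrDr addrA; apply: lerD; last by rewrite ler_pM2l.
  have -> : N * G ^+ 3 + e * (3 * N * (G + 1) ^+ 2) = N * (G ^+ 3 + e * (3 * (G + 1) ^+ 2)) by ring.
  by rewrite ler_wpM2l.
have H5 : X ^+ 2 <= 16 * c * (N * G ^+ 3 + e * (3 * N * (G + 1) ^+ 2 + (G + 1) ^+ 3)).
  apply: (le_trans X2); apply: (@le_trans _ _ (c * (16 * ((N + e) * (G + e) ^+ 3)))).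
    by rewrite ler_wpM2l// -H3.
  by rewrite mulrCA -mulrA ler_pM2l// ler_wpM2l.
move: H5; move: (N * G ^+ 3) (3 * N * (G + 1) ^+ 2 + (G + 1) ^+ 3) (X ^+ 2) => a b x H5.
have := ler_wpM2l (ler0n R 128) H5.
have -> : 128 * (16 * c * (a + e * b)) = 2048 * c * a + e * (2048 * c * b) by ring.
rewrite [e * (_ + _)]mulrDr addrA.
have -> : 32 * K ^+ 2 * e = e * (32 * K ^+ 2) by ring.
by rewrite lerD2r.
Qed.

(** For fixed [K] the approximation error 4 K e tends to 0 with [e], while the resulting bound is
    free of [K]. *)
Lemma truncated_integral_le u (K : R) : (n.+1 = 2%N \/ n.+1 = 3%N) -> 0 <= K -> H01 D u ->
  (\int[leb]_(r in D) (Num.min (csq u r) K ^+ 2)%:E <=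
   (Num.sqrt (ladyzhenskaya_cst * (rdot u u * gdot u u ^+ 3)))%:E)%E.
Proof.
move=> n23 K0 Hu; have Lu := H1_L2 (H01_H1 Hu).
have mu := measurable_csq Lu.
have mT : measurable_fun D (fun r => (Num.min (csq u r) K ^+ 2)%:E).
  apply/measurable_EFinP/measurable_funX.
  by apply: measurable_minr => //; exact: measurable_cst.
have bound e : 0 < e -> exists X N' G', [/\ [/\ 0 <= X, 0 <= N' & 0 <= G'],
    N' <= 2 * rdot u u + 2 * e, G' <= 2 * gdot u u + 2 * e,
    X ^+ 2 <= (8 * (64 + 256 * L ^+ 2)) * (N' * G' ^+ 3) &
    (\int[leb]_(r in D) (Num.min (csq u r) K ^+ 2)%:E <= (8 * X + 4 * K * e)%:E)%E].
  move=> e0; have [phi [tphi Ld de Np Gp]] := test_approximation oD DL Hu e0.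
  have [X [X0 XI X2]] := test_integral4 oD L0 DL n23 tphi.
  have Lp := test_function_L2 oD DL tphi.
  have mp := measurable_csq Lp; have md := measurable_csq Ld.
  exists X, (rdot phi phi), (gdot phi phi).
  split; [split; [exact: X0|exact: rdot_ge0|exact: gdot_ge0]|exact: Np|exact: Gp|exact: X2|].
  pose d := fun r => u r - phi r.
  apply: (@le_trans _ _ (\int[leb]_(r in D) (8%:E * (csq phi r ^+ 2)%:E + (4 * K)%:E * (csq d r)%:E))%E).
    apply: ge0_le_integral => //.
    - by move=> r _; rewrite lee_fin sqr_ge0.
    - apply: emeasurable_funD; apply/measurable_EFinP/measurable_funM => //.
      exact: measurable_funX.
    - move=> r _; rewrite -!EFinM -EFinD lee_fin.
      apply: truncation_le => //; try exact: csq_ge0.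
      exact: csq_split.
  rewrite ge0_integralD//; last 4 first.
  - by move=> r _; rewrite -EFinM lee_fin mulr_ge0// sqr_ge0.
  - by apply/measurable_EFinP/measurable_funM => //; exact: measurable_funX.
  - by move=> r _; rewrite -EFinM lee_fin !mulr_ge0// csq_ge0.
  - by apply/measurable_EFinP/measurable_funM.
  rewrite ge0_integralZl_EFin//; last 2 first.
  - by move=> r _; rewrite lee_fin sqr_ge0.
  - exact/measurable_EFinP/measurable_funX.
  rewrite ge0_integralZl_EFin//; last 3 first.
  - by move=> r _; rewrite lee_fin csq_ge0.
  - exact/measurable_EFinP.
  - by rewrite mulr_ge0.
  have -> : (8 * X + 4 * K * e)%:E = (8%:E * X%:E + (4 * K)%:E * e%:E)%E :> \bar R.
    by rewrite -!EFinM -EFinD.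
  rewrite (rdot_csq oD Ld); apply: leeD; first exact: lee_wpmul2l.
  by apply: lee_wpmul2l; rewrite lee_fin ?mulr_ge0.
have I0 : (0 <= \int[leb]_(r in D) (Num.min (csq u r) K ^+ 2)%:E)%E.
  by apply: integral_ge0 => r _; rewrite lee_fin sqr_ge0.
move: bound I0; case: (integral _ _ _) => [Y|b _|//]; last first.
  by have [X [N' [G' [_ _ _ _]]]] := b 1 ltr01; rewrite leye_eq.
move=> bound; rewrite lee_fin => Y0; rewrite lee_fin.
have c0 : 0 <= 8 * (64 + 256 * L ^+ 2).
  apply: mulr_ge0; first exact: ler0n.
  by apply: addr_ge0; [exact: ler0n|apply: mulr_ge0; [exact: ler0n|exact: sqr_ge0]].
rewrite -(ger0_norm Y0) -sqrtr_sqr; apply: ler_wsqrtr.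
rewrite /ladyzhenskaya_cst.
apply: (@le_of_small _ _ _ (2048 * (8 * (64 + 256 * L ^+ 2)) *
  (3 * rdot u u * (gdot u u + 1) ^+ 2 + (gdot u u + 1) ^+ 3) + 32 * K ^+ 2)) => e e01.
have e0 : 0 < e by case/andP: e01.
have [X [N' [G' [[X0 N'0 G'0] NN GG X2 YX]]]] := bound e e0.
rewrite lee_fin in YX.
exact: (truncated_bound Y0 X0 c0 (rdot_ge0 D u) (gdot_ge0 D u) N'0 G'0 K0 e01 NN GG X2 YX).
Qed.

(** The truncations at the integers increase to |u|^4 and their integrals share one bound, so
    monotone convergence yields integrability together with the estimate. *)
Lemma H01_integral4 u : (n.+1 = 2%N \/ n.+1 = 3%N) -> H01 D u ->
  sqint (csq u) /\ ip (csq u) (csq u) ^+ 2 <= ladyzhenskaya_cst * (rdot u u * gdot u u ^+ 3).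
Proof.
move=> n23 Hu; have Lu := H1_L2 (H01_H1 Hu).
have mu := measurable_csq Lu.
set A := ladyzhenskaya_cst * _.
have A0 : 0 <= A.
  apply: mulr_ge0; first exact: ladyzhenskaya_cst_ge0.
  by apply: mulr_ge0; [exact: rdot_ge0|apply: exprn_ge0; exact: gdot_ge0].
pose g (k : nat) r := (Num.min (csq u r) k%:R ^+ 2)%:E : \bar R.
have mg k : measurable_fun D (g k).
  apply/measurable_EFinP/measurable_funX.
  by apply: measurable_minr => //; exact: measurable_cst.
have g0 k r : D r -> (0 <= g k r)%E by move=> _; rewrite lee_fin sqr_ge0.
have ndg r : D r -> {homo g ^~ r : k m / (k <= m)%N >-> (k <= m)%E}.
  move=> _ k m km; rewrite lee_fin; apply: lerXn2r.
  - by rewrite nnegrE le_min csq_ge0 ler0n.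
  - by rewrite nnegrE le_min csq_ge0 ler0n.
  - by rewrite le_min !ge_min lexx /= ler_nat km orbT.
have limg r : limn (g ^~ r) = (csq u r ^+ 2)%:E.
  apply: cvg_lim => //; apply: (@cvg_near_cst _ _ _ _ _ _).
  near=> k; rewrite /g min_l//.
  by near: k; exact: nbhs_infty_ger.
have le4 : (\int[leb]_(r in D) (csq u r ^+ 2)%:E <= (Num.sqrt A)%:E)%E.
  have := monotone_convergence leb mD mg g0 ndg.
  under eq_integral do rewrite limg.
  move=> ->; apply: lime_le.
    apply: ereal_nondecreasing_is_cvgn => k m km; apply: ge0_le_integral => //.
    - by move=> r; exact: g0.
    - by move=> r Dr; exact: ndg.
  by apply: nearW => k; exact: truncated_integral_le.
have Ls : sqint (csq u) by split => //; apply: le_lt_trans le4 _; rewrite ltry.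
split => //; move: le4; rewrite (ip_sqr mD Ls) lee_fin => le4.
rewrite -(sqr_sqrtr A0) ler_pXn2r ?nnegrE ?sqrtr_ge0//.
exact: ip_ge0.
Unshelve. all: by end_near. Qed.

End H01_integral4.

(** * The Rellich theorem *)

Section window_average.
Context {R : realType} {n : nat}.
Variables (D : set 'rV[R]_n.+1) (L h : R).
Hypothesis oD : open D.
Hypothesis DL : forall r, D r -> forall j, `|r ord0 j| < L.
Hypothesis h0 : 0 < h.
Local Notation leb := (lebesgue_measure_rV R n.+1).
Local Notation ipT := (ip leb setT).
Local Notation sqintT := (sqint leb setT).
Local Notation ip := (ip leb D).
Local Notation sqint := (sqint leb D).
Implicit Types f g : 'rV[R]_n.+1 -> R.

Let mD : measurable D. Proof. exact: open_measurable_rV. Qed.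

(** The mean over the cube v + [0, h]^(n+1) of the extension of [f] by 0, since the cube may leave
    [D]. *)
Definition average f (v : 'rV[R]_n.+1) : R := ip (window_rV h v) f.

Let wmax := h^-1 ^+ n.+1.

Lemma window_rV_le (v w : 'rV[R]_n.+1) : window_rV h v w <= wmax.
Proof.
rewrite /wmax -[X in _ ^+ X]card_ord -prodr_const; apply: ler_prod => i _.
apply/andP; split; first exact: window_ge0.
by rewrite /window; case: ifP => _; rewrite ?lexx// invr_ge0 ltW.
Qed.

Lemma measurable_window_rVr (v : 'rV[R]_n.+1) : measurable_fun setT (window_rV h v).
Proof. by apply: measurable_window_rV => //; exact: measurable_cst. Qed.

Lemma sqint_window v : sqint (window_rV h v).
Proof.
apply: (sqint_bounded oD DL (M := wmax)).
  by apply: measurable_funTS; exact: measurable_window_rVr.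
by move=> r _; rewrite ger0_norm ?window_rV_le ?window_rV_ge0.
Qed.

Definition average_cst : R := wmax ^+ 2 * fine (leb D).

Lemma average_cst_ge0 : 0 <= average_cst.
Proof. by rewrite mulr_ge0 ?sqr_ge0 ?fine_ge0. Qed.

Lemma average_sqr_le f v : sqint f -> average f v ^+ 2 <= average_cst * ip f f.
Proof.
move=> Lf; apply: (le_trans (ip_cauchy_schwarz mD (sqint_window v) Lf)).
apply: ler_wpM2r; first exact: ip_ge0.
have -> : average_cst = ip (cst wmax) (cst wmax).
  by rewrite /ip (Rintegral_cst leb mD (wmax * wmax)) /average_cst expr2.
have Lc : sqint (cst wmax).
  by apply: (sqint_bounded oD DL (M := `|wmax|)) => //; exact: measurable_cst.
apply: (le_ip mD) => //; try exact: sqint_window.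
by move=> r _; apply: ler_pM; rewrite ?window_rV_ge0 ?window_rV_le.
Qed.

Lemma averageD f g v : sqint f -> sqint g ->
  average (fun r => f r + g r) v = average f v + average g v.
Proof. by move=> Lf Lg; rewrite /average ipDr//; exact: sqint_window. Qed.

Lemma averageZ c f v : sqint f -> average (fun r => c * f r) v = c * average f v.
Proof. by move=> Lf; rewrite /average ipZr//; exact: sqint_window. Qed.

Lemma measurable_average_ge0 f : sqint f -> (forall r, 0 <= f r) ->
  measurable_fun setT (average f).
Proof.
move=> Lf f0; have mf : measurable_fun setT (f \_ D).
  exact: (measurable_restrictT f mD).1 (sqint_measurable Lf).
have F0 (p : 'rV[R]_n.+1 * 'rV[R]_n.+1) : (0 <= (window_rV h p.1 p.2 * (f \_ D) p.2)%:E)%E.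
  rewrite lee_fin mulr_ge0 ?window_rV_ge0// patchE; case: ifP => // _.
have mF : measurable_fun setT (fun p : 'rV[R]_n.+1 * 'rV[R]_n.+1 =>
    (window_rV h p.1 p.2 * (f \_ D) p.2)%:E).
  apply/measurable_EFinP/measurable_funM; first exact: measurable_window_rV.
  exact: (measurableT_comp mf measurable_snd).
have mI := @measurable_fun_fubini_tonelli_F _ _ _ _ _ leb _ mF F0.
rewrite (_ : average f = fine \o (fun v => \int[leb]_w (window_rV h v w * (f \_ D) w)%:E)%E).
  exact: (measurableT_comp (fine_measurable _) mI).
apply/funext => v; rewrite /average /ip /Rintegral /=; congr fine.
rewrite [LHS]integral_mkcond; apply: eq_integral => w _; rewrite !patchE.
by case: ifP => // _; rewrite mulr0.
Qed.

Lemma measurable_average f : sqint f -> measurable_fun setT (average f).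
Proof.
move=> Lf; have mf := sqint_measurable Lf.
(* Tonelli gives measurability of integrals of nonnegative functions, hence the split into positive
   and negative parts. *)
have Lp : sqint (fun r => Num.max (f r) 0).
  apply: (sqint_dominated mD _ (sqint_integrable_sqr Lf)).
    by apply: measurable_maxr => //; exact: measurable_cst.
  by move=> r _ /=; case: (leP (f r) 0) => _ //; rewrite expr0n sqr_ge0.
have Ln : sqint (fun r => Num.max (- f r) 0).
  apply: (sqint_dominated mD _ (sqint_integrable_sqr Lf)).
    apply: measurable_maxr; last exact: measurable_cst.
    exact: (sqint_measurable (sqintN mD Lf)).
  by move=> r _ /=; case: (leP (- f r) 0) => _; rewrite ?sqrrN// expr0n sqr_ge0.
have E : f = fun r => Num.max (f r) 0 + (-1) * Num.max (- f r) 0.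
  apply/funext => r; rewrite mulN1r; case: (leP (f r) 0) => fr.
    by rewrite add0r max_l ?opprK// oppr_ge0.
  by rewrite max_r ?subr0// oppr_le0 ltW.
rewrite (_ : average f = fun v => average (fun r => Num.max (f r) 0) v +
    (-1) * average (fun r => Num.max (- f r) 0) v).
  apply: measurable_funD; last apply: measurable_funM => //.
    by apply: measurable_average_ge0 => // r; rewrite le_max lexx orbT.
  by apply: measurable_average_ge0 => // r; rewrite le_max lexx orbT.
apply/funext => v; rewrite {1}E averageD ?averageZ//.
exact: sqintZ.
Qed.

Lemma sqint_average f : sqint f -> sqint (average f).
Proof.
move=> Lf; have M0 : 0 <= average_cst * ip f f.
  by apply: mulr_ge0; [exact: average_cst_ge0|exact: ip_ge0].
apply: (sqint_bounded oD DL (M := Num.sqrt (average_cst * ip f f))).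
  by apply: measurable_funTS; exact: measurable_average.
move=> r _; rewrite -sqrtr_sqr; apply: ler_wsqrtr; exact: average_sqr_le.
Qed.

(** f v - average f v is a mean of f v - f w, bounded by Cauchy-Schwarz after splitting the kernel
    into two square roots. As [f] vanishes off [D], the average may be taken over the whole space,
    where the kernel has mass 1. *)
Lemma rtest_average_pointwise f v : rtest D f ->
  ((f v ^+ 2)%:E <= (2 * average f v ^+ 2)%:E + 2%:E *
    \int[leb]_w (window_rV h v w * (f v - f w) ^+ 2)%:E)%E.
Proof.
move=> tf; have [M fM] := rtest_bounded DL tf; have mf := rtest_measurable DL tf.
set k := window_rV h v; have mk := measurable_window_rVr v.
have k0 w : 0 <= k w by exact: window_rV_ge0.
have Ik : (\int[leb]_w (k w)%:E = 1)%E by exact: integral_window_rV.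
have ik : leb.-integrable setT (EFin \o k).
  apply/integrableP; split; first exact/measurable_EFinP.
  by under eq_integral do rewrite /= ger0_norm//; rewrite Ik ltry.
pose s w := Num.sqrt (k w); pose d w := s w * (f v - f w).
have ms : measurable_fun setT s.
  exact: (measurableT_comp (continuous_measurable_fun (@sqrt_continuous R)) mk).
have Ls : sqintT s.
  split => //; under eq_integral do rewrite sqr_sqrtr//.
  by rewrite Ik ltry.
have Ld : sqintT d.
  apply: (@sqint_dominated _ _ _ leb setT measurableT d (fun w => (2 * M) ^+ 2 * k w)).
  - by apply: measurable_funM => //; apply: measurable_funB => //; exact: measurable_cst.
  - exact: (integrableZl measurableT ((2 * M) ^+ 2) ik).
  - move=> w _; rewrite exprMn sqr_sqrtr// mulrC ler_wpM2r//.
    rewrite -(real_normK (num_real (f v - f w))) lerXn2r ?nnegrE//.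
      by rewrite mulr_ge0// (le_trans _ (fM v)).
    by rewrite (le_trans (ler_normB _ _))// mulrDl !mul1r lerD.
have Es : ipT s s = 1.
  rewrite /ipT /Rintegral; under eq_integral do rewrite -expr2 sqr_sqrtr//.
  by rewrite Ik.
have Esd : ipT s d = f v - average f v.
  have ikf : leb.-integrable setT (EFin \o (fun w => k w * f w)).
    apply: (@integrable_dominated _ _ _ leb setT measurableT _ (fun w => M * k w)).
    - exact: measurable_funM.
    - exact: (integrableZl measurableT M ik).
    - by move=> w _; rewrite normrM (ger0_norm (k0 w)) mulrC ler_wpM2r.
  transitivity (\int[leb]_w (f v * k w - k w * f w)).
    apply: eq_Rintegral => w _; rewrite /d mulrA -expr2 sqr_sqrtr//; ring.
  rewrite RintegralB//; last exact: (integrableZl measurableT (f v) ik).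
  rewrite RintegralZl// {1}/Rintegral Ik /= mulr1; congr (_ - _).
  rewrite /average /ip /Rintegral; congr fine; apply/esym.
  by apply: integral_domain => w /(rtest_out tf) ->; rewrite mulr0.
have := ip_cauchy_schwarz measurableT Ls Ld; rewrite Es mul1r Esd => cs.
have -> : (\int[leb]_w (k w * (f v - f w) ^+ 2)%:E = (ipT d d)%:E)%E.
  rewrite -(ip_sqr measurableT Ld); apply: eq_integral => w _.
  by rewrite exprMn sqr_sqrtr.
rewrite -EFinM -EFinD lee_fin.
move: cs; move: (ipT _ _) (average f v) (f v) => x a y cs.
have := sqr_ge0 (y - 2 * a); nra.
Qed.

Lemma rtest_average_le f : rtest D f ->
  ip f f <= 2 * ip (average f) (average f) + 2 ^+ n.+2 * h ^+ 2 * rgrad D f.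
Proof.
move=> tf; have Lf := rtest_sqint oD DL tf; have La := sqint_average Lf.
have fC := rtest_C1c DL tf; have mf := rtest_measurable DL tf.
have mW : measurable_fun setT (fun p : 'rV[R]_n.+1 * 'rV[R]_n.+1 =>
    (window_rV h p.1 p.2 * (f p.1 - f p.2) ^+ 2)%:E).
  apply: measurable_window_density; try exact: measurable_fst; try exact: measurable_snd.
    exact: (measurableT_comp mf measurable_fst).
  exact: (measurableT_comp mf measurable_snd).
have W0 (p : 'rV[R]_n.+1 * 'rV[R]_n.+1) :
    (0 <= (window_rV h p.1 p.2 * (f p.1 - f p.2) ^+ 2)%:E)%E.
  by rewrite lee_fin mulr_ge0 ?window_rV_ge0 ?sqr_ge0.
pose I v := (\int[leb]_w (window_rV h v w * (f v - f w) ^+ 2)%:E)%E.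
have mI : measurable_fun setT I.
  exact: (@measurable_fun_fubini_tonelli_F _ _ _ _ _ leb _ mW W0).
have I0 v : (0 <= I v)%E by apply: integral_ge0 => w _; exact: (W0 (v, w)).
have E : (window_energy h f <= (2 ^+ n.+1 * h ^+ 2 * rgrad D f)%:E)%E.
  apply: (le_trans (window_energy_le h0 fC)); rewrite [leRHS]EFinM.
  apply: lee_wpmul2l; first by rewrite lee_fin mulr_ge0 ?sqr_ge0 ?exprn_ge0.
  rewrite /rgrad -sumEFin; apply: lee_sum => i _.
  by rewrite (nsq_pderiv_rtest oD DL i tf).
rewrite -lee_fin -(ip_sqr mD Lf).
apply: (@le_trans _ _ (\int[leb]_(v in D) ((2 * average f v ^+ 2)%:E + 2%:E * I v))%E).
  apply: ge0_le_integral => //.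
  - by move=> v _; rewrite lee_fin sqr_ge0.
  - by apply/measurable_EFinP/measurable_funX/measurable_funTS.
  - apply: emeasurable_funD.
      apply/measurable_EFinP/measurable_funM => //; apply: measurable_funX.
      exact: sqint_measurable La.
    by apply: measurable_funTS; exact: emeasurable_fun_scale.
  - by move=> v _; exact: rtest_average_pointwise.
rewrite ge0_integralD//; last 4 first.
- by move=> v _; rewrite lee_fin mulr_ge0// sqr_ge0.
- apply/measurable_EFinP/measurable_funM => //; apply: measurable_funX.
  exact: sqint_measurable La.
- by move=> v _; rewrite mule_ge0.
- by apply: measurable_funTS; exact: emeasurable_fun_scale.
rewrite [leRHS]EFinD; apply: leeD.
  under eq_integral do rewrite EFinM.
  rewrite ge0_integralZl_EFin//; last 2 first.
  - by move=> v _; rewrite lee_fin sqr_ge0.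
  - by apply/measurable_EFinP/measurable_funX; exact: sqint_measurable La.
  by rewrite (ip_sqr mD La) -EFinM.
rewrite ge0_integralZl_EFin//; last exact: measurable_funTS.
have -> : 2 ^+ n.+2 * h ^+ 2 * rgrad D f = 2 * (2 ^+ n.+1 * h ^+ 2 * rgrad D f).
  by rewrite exprS; ring.
rewrite [leRHS]EFinM; apply: lee_wpmul2l => //.
apply: le_trans E; rewrite /window_energy.
by apply: ge0_subset_integral.
Qed.

End window_average.

Lemma average_arith (R : realFieldType) (N G b1 b2 a1 a2 p q d1 d2 g1 g2 k C e : R) :
  0 <= k -> 0 <= C -> N <= 2 * (p + q) + 2 * (d1 + d2) -> d1 + d2 <= e ->
  a1 <= 2 * b1 + 2 * (C * d1) -> a2 <= 2 * b2 + 2 * (C * d2) ->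
  p <= 2 * a1 + k * g1 -> q <= 2 * a2 + k * g2 -> g1 + g2 <= 2 * G + 2 * e ->
  N <= 8 * (b1 + b2) + 4 * k * G + e * (8 * C + 4 * k + 2).
Proof.
move=> k0 C0 S de A1 A2 P Q gg.
have := ler_wpM2l k0 gg; have := ler_wpM2l C0 de; rewrite !mulrDr.
have -> : 4 * k * G = 4 * (k * G) by ring.
have -> : k * (2 * G) = 2 * (k * G) by ring.
have -> : k * (2 * e) = 2 * (k * e) by ring.
have -> : e * (8 * C) = 8 * (C * e) by ring.
have -> : e * (4 * k) = 4 * (k * e) by ring.
move: (k * g1) (k * g2) (k * G) (k * e) (C * d1) (C * d2) (C * e) P Q A1 A2.
by move=> x1 x2 x3 x4 x5 x6 x7; lra.
Qed.

Section rellich.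
Local Open Scope complex_scope.
Context {R : realType} {n : nat}.
Variables (D : set 'rV[R]_n.+1) (L : R).
Hypothesis oD : open D.
Hypothesis L0 : 0 <= L.
Hypothesis DL : forall r, D r -> forall j, `|r ord0 j| < L.
Local Notation leb := (lebesgue_measure_rV R n.+1).
Local Notation ip := (ip leb D).
Local Notation sqint := (sqint leb D).
Local Notation rdot := (rdot D).
Local Notation gdot := (gdot D).
Local Notation average := (average D).
Local Notation "f ^re" := (fun r => complex.Re (f r)) (at level 2, format "f ^re").
Local Notation "f ^im" := (fun r => complex.Im (f r)) (at level 2, format "f ^im").
Implicit Types u phi : 'rV[R]_n.+1 -> R[i].

Let mD : measurable D. Proof. exact: open_measurable_rV. Qed.

Definition average_energy h u : R :=
  ip (average h u^re) (average h u^re) + ip (average h u^im) (average h u^im).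

Lemma ipD_le (f g : 'rV[R]_n.+1 -> R) : sqint f -> sqint g ->
  ip (fun r => f r + g r) (fun r => f r + g r) <= 2 * ip f f + 2 * ip g g.
Proof.
move=> Lf Lg; have Lg' := sqintZ mD (-1) Lg.
have := ip_ge0 leb D (fun r => f r + (-1) * g r).
rewrite !(ipDl mD)//; try exact: sqintD.
rewrite !(ipDr mD)// !(ipZl mD)// !(ipZr mD)// (ipC _ _ g f).
by move: (ip f f) (ip f g) (ip g g) => a b c; lra.
Qed.

Lemma ip_average_le h (f : 'rV[R]_n.+1 -> R) : 0 < h -> sqint f ->
  ip (average h f) (average h f) <= average_cst D h * fine (leb D) * ip f f.
Proof.
move=> h0 Lf; have La := sqint_average oD DL h0 Lf.
set c := Num.sqrt (average_cst D h * ip f f).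
have cc : c * c = average_cst D h * ip f f.
  rewrite -expr2 sqr_sqrtr// mulr_ge0 ?ip_ge0//; exact: average_cst_ge0.
have -> : average_cst D h * fine (leb D) * ip f f = ip (cst c) (cst c).
  by rewrite /ip (Rintegral_cst leb mD (c * c)) cc mulrAC.
have Lc : sqint (cst c).
  by apply: (sqint_bounded oD DL (M := `|c|)) => //; exact: measurable_cst.
apply: (le_ip mD) => //.
move=> r _ /=; rewrite cc -expr2.
exact: (average_sqr_le oD DL h0 r Lf).
Qed.

(** Averaging is bounded on L^2 for fixed [h], so the inequality for test functions survives the
    passage to the limit. The size of [C] for small [h] is harmless: it only multiplies [e]. *)
Lemma H01_average_le u h : 0 < h -> H01 D u ->
  rdot u u <= 8 * average_energy h u + 4 * (2 ^+ n.+2 * h ^+ 2) * gdot u u.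
Proof.
move=> h0 Hu; set kappa := 2 ^+ n.+2 * h ^+ 2.
have kappa0 : 0 <= kappa by rewrite mulr_ge0 ?sqr_ge0 ?exprn_ge0.
set C := average_cst D h * fine (leb D).
have C0 : 0 <= C by rewrite mulr_ge0 ?average_cst_ge0 ?fine_ge0.
apply: (@le_of_small _ _ _ (8 * C + 4 * kappa + 2)) => e /andP[e0 _].
have [phi [tphi Ld de _ gphi]] := test_approximation oD DL Hu e0.
have Lp := test_function_L2 oD DL tphi.
have S := rdot_split oD Lp Ld.
have /test_functionP[tr ti] := tphi.
have Ar := rtest_average_le oD DL h0 tr; have Ai := rtest_average_le oD DL h0 ti.
have /(L2P oD)[ur ui] := H1_L2 (H01_H1 Hu).
have /(L2P oD)[dr di] := Ld.
have aux (f g dd : 'rV[R]_n.+1 -> R) : sqint f -> sqint g -> sqint dd ->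
    (forall r, dd r = f r - g r) ->
    ip (average h g) (average h g) <= 2 * ip (average h f) (average h f) + 2 * (C * ip dd dd).
  move=> Lf Lg Ldd E.
  have Eg : g = fun r => f r + (-1) * dd r by apply/funext => r; rewrite E; ring.
  have EA : average h g = fun r => average h f r + (-1) * average h dd r.
    apply/funext => r; rewrite {1}Eg (averageD oD DL h0 _ Lf (sqintZ mD (-1) Ldd)).
    by rewrite (averageZ oD DL h0 _ _ Ldd).
  have La := sqint_average oD DL h0 Lf; have Lb := sqint_average oD DL h0 Ldd.
  rewrite EA; apply: (le_trans (ipD_le La (sqintZ mD (-1) Lb))).
  rewrite lerD2l ler_pM2l// (ipZl mD)//; last exact: sqintZ.
  rewrite (ipZr mD)// mulrA mulrNN !mul1r.
  exact: ip_average_le.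
have Hre r : complex.Re (u r - phi r) = complex.Re (u r) - complex.Re (phi r).
  by rewrite raddfB.
have Him r : complex.Im (u r - phi r) = complex.Im (u r) - complex.Im (phi r).
  by rewrite raddfB.
have Br := aux _ _ _ ur (rtest_sqint oD DL tr) dr Hre.
have Bi := aux _ _ _ ui (rtest_sqint oD DL ti) di Him.
have Gphi : gdot phi phi = rgrad D phi^re + rgrad D phi^im by exact: (gdot_test oD DL tphi).
rewrite Gphi in gphi.
have Ed : rdot (fun r => u r - phi r) (fun r => u r - phi r) =
  ip (fun r => complex.Re (u r - phi r)) (fun r => complex.Re (u r - phi r)) +
  ip (fun r => complex.Im (u r - phi r)) (fun r => complex.Im (u r - phi r)) by [].
rewrite Ed in S de.
have Ep : rdot phi phi = ip phi^re phi^re + ip phi^im phi^im by [].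
rewrite Ep in S; rewrite /average_energy.
exact: (average_arith kappa0 C0 S de Br Bi Ar Ai gphi).
Qed.

(** The averages are bounded by one constant on [D], a set of finite measure, so dominated
    convergence upgrades the pointwise limit. *)
Lemma average_energy_cvg0 (u : nat -> 'rV[R]_n.+1 -> R[i]) (M h : R) : 0 < h ->
  (forall k, L2 D (u k)) -> (forall k, rdot (u k) (u k) <= M) ->
  (forall v, average h (u k)^re v @[k --> \oo] --> (0 : R)) ->
  (forall v, average h (u k)^im v @[k --> \oo] --> (0 : R)) ->
  average_energy h (u k) @[k --> \oo] --> (0 : R).
Proof.
move=> h0 Lu uM cr ci; rewrite -[X in _ --> X](addr0 0).
have key (f : nat -> 'rV[R]_n.+1 -> R) : (forall k, sqint (f k)) ->
    (forall k, ip (f k) (f k) <= M) ->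
    (forall v, average h (f k) v @[k --> \oo] --> (0 : R)) ->
    ip (average h (f k)) (average h (f k)) @[k --> \oo] --> (0 : R).
  move=> Lf fM cf.
  have La k := sqint_average oD DL h0 (Lf k).
  pose F (k : nat) v := (average h (f k) v ^+ 2)%:E.
  have mF k : measurable_fun D (F k).
    by apply/measurable_EFinP/measurable_funX; exact: sqint_measurable (La k).
  have cF : \forall v \ae leb, D v -> F k v @[k --> \oo] --> (0 : R)%:E.
    apply: aeW => v _; apply: cvg_EFin; first exact: nearW.
    have c2 : average h (f k) v * average h (f k) v @[k --> \oo] --> (0 * 0 : R).
      by apply: cvgM; exact: cf.
    rewrite mulr0 in c2; apply: cvg_trans c2; apply: near_eq_cvg.
    by apply: nearW => k /=; rewrite expr2.
  have iC : leb.-integrable D (cst (average_cst D h * M)%:E).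
    apply/integrableP; split; first exact: measurable_cst.
    by rewrite integral_cst//= lte_mul_pinfty//; exact: (bounded_domain_finite oD DL).
  have dF : \forall v \ae leb, forall k, D v -> (`|F k v| <= cst (average_cst D h * M)%:E v)%E.
    apply: aeW => v k _; rewrite /F /= lee_fin ger0_norm ?sqr_ge0//.
    apply: (le_trans (average_sqr_le oD DL h0 v (Lf k))).
    by apply: ler_wpM2l => //; exact: average_cst_ge0.
  have [_ _] := dominated_convergence mD mF (measurable_cst _) cF iC dF.
  rewrite integral0 => H.
  rewrite (_ : (fun k : nat => ip _ _) = fine \o (fun k => \int[leb]_(v in D) F k v)%E).
    exact: fine_cvg H.
  by apply/funext => k /=; rewrite (ip_sqr mD (La k)).
apply: cvgD; apply: key => // k.
- by have /(L2P oD)[] := Lu k.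
- by apply: le_trans (uM k); rewrite lerDl ip_ge0.
- by have /(L2P oD)[] := Lu k.
- by apply: le_trans (uM k); rewrite lerDr ip_ge0.
Qed.

Lemma rellich (u : nat -> 'rV[R]_n.+1 -> R[i]) (M : R) :
  (forall k, H01 D (u k)) -> (forall k, gdot (u k) (u k) <= M) ->
  (forall h v, 0 < h -> average h (u k)^re v @[k --> \oo] --> (0 : R)) ->
  (forall h v, 0 < h -> average h (u k)^im v @[k --> \oo] --> (0 : R)) ->
  rdot (u k) (u k) @[k --> \oo] --> (0 : R).
Proof.
move=> Hu gM cr ci.
have M0 : 0 <= M by apply: le_trans (gM 0%N); exact: gdot_ge0.
apply/cvgrPdist_le => e e0.
(* [h] is chosen to make the gradient term of [H01_average_le] at most e / 2 for all [k]; M + 1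
   keeps [c] positive. The averages enter with the factor 8 and must fall below e / 16. *)
pose c := 4 * 2 ^+ n.+2 * (M + 1) : R.
have c0 : 0 < c.
  apply: mulr_gt0; last exact: ltr_wpDl.
  by apply: mulr_gt0; [exact: ltr0n|exact: exprn_gt0].
have q0 : 0 < e / 2 / c by apply: divr_gt0 => //; apply: divr_gt0.
pose h := Num.sqrt (e / 2 / c).
have h0 : 0 < h by rewrite sqrtr_gt0.
have h2 : h ^+ 2 = e / 2 / c by apply: sqr_sqrtr; exact: ltW.
have rM k : rdot (u k) (u k) <= 64 * L ^+ 2 * M.
  apply: (le_trans (H01_poincare oD L0 DL (Hu k))).
  by apply: ler_wpM2l => //; apply: mulr_ge0; [exact: ler0n|exact: sqr_ge0].
have := average_energy_cvg0 h0 (fun k => H1_L2 (H01_H1 (Hu k))) rM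
  (fun v => cr h v h0) (fun v => ci h v h0).
move=> /cvgrPdist_le /(_ (e / 16)) H.
have e16 : 0 < e / 16 by rewrite divr_gt0// ltr0n.
near=> k; rewrite sub0r normrN ger0_norm ?rdot_ge0//.
have Hk : `|0 - average_energy h (u k)| <= e / 16 by near: k; exact: H.
rewrite sub0r normrN in Hk; have {Hk} := le_trans (ler_norm _) Hk.
have := H01_average_le h0 (Hu k).
have : 4 * (2 ^+ n.+2 * h ^+ 2) * gdot (u k) (u k) <= e / 2.
  rewrite h2; apply: (@le_trans _ _ (4 * (2 ^+ n.+2 * (e / 2 / c)) * (M + 1))).
    apply: ler_wpM2l; last by apply: (le_trans (gM k)); rewrite lerDl.
    apply: mulr_ge0; first exact: ler0n.
    by apply: mulr_ge0; [exact: exprn_ge0|exact: ltW].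
  have -> : 4 * (2 ^+ n.+2 * (e / 2 / c)) * (M + 1) = e / 2 / c * c.
    by move: (e / 2 / c) => q; rewrite /c; move: (2 ^+ n.+2) => t; ring.
  by rewrite divfK// gt_eqF.
move: (rdot (u k) (u k)) (average_energy h (u k)) (4 * _ * _) => x y z; lra.
Unshelve. all: by end_near. Qed.

End rellich.

(** * The angular momentum and the energy form *)

Section angular_momentum.
Local Open Scope complex_scope.
Context {R : realType} {n : nat}.
Variables (D : set 'rV[R]_n) (L : R).
Hypothesis oD : open D.
Hypothesis L0 : 0 <= L.
Hypothesis DL : forall r, D r -> forall j, `|r ord0 j| < L.
Local Notation leb := (lebesgue_measure_rV R n).
Local Notation ip := (ip leb D).
Local Notation "f ^im" := (fun r => complex.Im (f r)) (at level 2, format "f ^im").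
Implicit Types f g u v phi : 'rV[R]_n -> R[i].
Implicit Types (m : 'rV[R]_n -> R).

Let mD : measurable D. Proof. exact: open_measurable_rV. Qed.

Lemma rdot_mul m f g :
  rdot D (fun r => (m r)%:C * f r) g = rdot D f (fun r => (m r)%:C * g r).
Proof.
rewrite /rdot /ip; congr (_ + _); apply: eq_Rintegral => r _.
  by rewrite !complex_ReM /=; ring.
by rewrite !complex_ImM /=; ring.
Qed.

Lemma Re_mulNi (z : R[i]) : complex.Re (- 'i * z) = complex.Im z.
Proof. by rewrite complex_ReM /=; ring. Qed.

Lemma Im_mulNi (z : R[i]) : complex.Im (- 'i * z) = - complex.Re z.
Proof. by rewrite complex_ImM /=; ring. Qed.

Lemma rdot_mulNi f g : L2 D f -> L2 D g ->
  rdot D f (fun r => - 'i * g r) = - rdot D (fun r => - 'i * f r) g.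
Proof.
move=> /(L2P oD)[fr fi] /(L2P oD)[gr gi]; rewrite /rdot.
have E (h : 'rV[R]_n -> R[i]) : (fun r => complex.Re (- 'i * h r)) = h^im.
  by apply/funext => r; exact: Re_mulNi.
have E' (h : 'rV[R]_n -> R[i]) :
    (fun r => complex.Im (- 'i * h r)) = fun r => -1 * complex.Re (h r).
  by apply/funext => r; rewrite Im_mulNi mulN1r.
by rewrite !E !E' (ipZr mD)// (ipZl mD)//; ring.
Qed.

Lemma rdot_mulNi2 f g : L2 D f -> L2 D g ->
  rdot D (fun r => - 'i * f r) (fun r => - 'i * g r) = rdot D f g.
Proof.
move=> Lf Lg; rewrite (rdot_mulNi (L2Z oD _ Lf) Lg).
have -> : (fun r => - 'i * (- 'i * f r)) = (fun r => (-1)%:C * f r).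
  by apply/funext => r; rewrite mulrA mulrNN -expr2 sqr_i rmorphN rmorph1.
by rewrite (rdotZl oD _ Lf Lg) mulN1r opprK.
Qed.

Lemma rdot_mul_ge0 (m : 'rV[R]_n -> R) f : (forall r, D r -> 0 <= m r) ->
  0 <= rdot D f (fun r => (m r)%:C * f r).
Proof.
move=> m0; rewrite /rdot /ip; apply: addr_ge0; apply: Rintegral_ge0 => r Dr.
  rewrite complex_ReM /= mul0r subr0 mulrCA -expr2.
  by apply: mulr_ge0; [exact: m0|exact: sqr_ge0].
rewrite complex_ImM /= mul0r addr0 mulrCA -expr2.
by apply: mulr_ge0; [exact: m0|exact: sqr_ge0].
Qed.

Lemma L2_coorM j f : L2 D f -> L2 D (fun r => (r ord0 j)%:C * f r).
Proof.
apply: (L2_bounded_mul oD (M := L)); first by apply: measurable_funTS; exact: measurable_coor.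
by move=> r /DL rL; exact: ltW.
Qed.

Lemma rdot_coorM_le k f : L2 D f ->
  rdot D (fun r => (r ord0 k)%:C * f r) (fun r => (r ord0 k)%:C * f r) <= L ^+ 2 * rdot D f f.
Proof.
move=> Lf; have Lm := L2_coorM k Lf.
have LL := L2Z oD L%:C Lf.
have -> : L ^+ 2 * rdot D f f = rdot D (fun r => L%:C * f r) (fun r => L%:C * f r).
  by rewrite (rdotZl oD _ Lf LL) (rdotZr oD _ Lf Lf) mulrA -expr2.
have /(L2P oD)[mr mi] := Lm; have /(L2P oD)[lr li] := LL.
have key (r : 'rV[R]_n) (x : R) : D r ->
    (r ord0 k * x) * (r ord0 k * x) <= (L * x) * (L * x).
  move=> Dr; rewrite -!expr2 !exprMn; apply: ler_wpM2r; first exact: sqr_ge0.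
  by rewrite -(real_normK (num_real (r ord0 k))) lerXn2r ?nnegrE// ltW// DL.
rewrite /rdot; apply: lerD; apply: (le_ip mD) => // r Dr.
  by rewrite !complex_ReM /= !mul0r !subr0; exact: key.
by rewrite !complex_ImM /= !mul0r !addr0; exact: key.
Qed.

Local Opaque rdot wpartial.

Lemma rdot_wpartial_test i u phi : H1 D u -> test_function D phi ->
  rdot D u (wpartial D i phi) = - rdot D (wpartial D i u) phi.
Proof.
move=> Hu tphi; have Lu := H1_L2 Hu; have tp := test_function_partial i tphi.
have Lp := test_function_L2 oD DL tphi; have Ldp := test_function_L2 oD DL tp.
have /(weak_partialP oD DL _ _ Lu)[[_ wr] [_ wi]] := wpartialP i Hu.
have /test_functionP[tr ti] := tphi.
rewrite (rdot_ae oD (aeW _ (fun _ _ => erefl)) (wpartial_test oD DL i tphi) Lu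
  (wpartial_L2 i (test_H1 oD DL tphi)) Lu Ldp).
Transparent rdot.
by rewrite /rdot (wr _ tr) (wi _ ti) opprD.
Qed.
Local Opaque rdot.

Lemma test_functionMl m phi : smooth m -> test_function D phi ->
  test_function D (fun r => (m r)%:C * phi r).
Proof.
move=> sm /test_functionP[tr ti]; apply/test_functionP; split.
  by under eq_fun do rewrite complex_ReM /= mul0r subr0; exact: rtestMl.
by under eq_fun do rewrite complex_ImM /= mul0r addr0; exact: rtestMl.
Qed.

Lemma coor_smooth j : smooth (fun r : 'rV[R]_n => r ord0 j).
Proof. exact/elementary_is_smooth/elementary_coor. Qed.

Lemma partial_coorM (i j : 'I_n) phi r : i != j -> test_function D phi ->
  partial i (fun r => (r ord0 j)%:C * phi r) r = (r ord0 j)%:C * partial i phi r.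
Proof.
move=> ij /test_functionP[[sr _] [si _]].
have key (f : 'rV[R]_n -> R) : smooth f ->
    'D_(evec R i) (fun r : 'rV[R]_n => r ord0 j * f r) r = r ord0 j * 'D_(evec R i) f r.
  move=> sf; rewrite derive_mul.
  - by have [_ ->] := coor_is_derive j i r; rewrite (negPf ij) mulr0 addr0.
  - exact: (smooth_derivable (coor_smooth j)).
  - exact: smooth_derivable.
rewrite /partial.
have -> : (fun s : 'rV[R]_n => complex.Re ((s ord0 j)%:C * phi s)) =
    fun s => s ord0 j * complex.Re (phi s).
  by apply/funext => s; rewrite complex_ReM /= mul0r subr0.
have -> : (fun s : 'rV[R]_n => complex.Im ((s ord0 j)%:C * phi s)) =
    fun s => s ord0 j * complex.Im (phi s).
  by apply/funext => s; rewrite complex_ImM /= mul0r addr0.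
rewrite (key _ sr) (key _ si); apply/eqP; rewrite eq_complex.
by rewrite complex_ReM complex_ImM /= !mul0r subr0 addr0 !eqxx.
Qed.

(** The coordinate [j] is constant along direction [i], so it passes through the derivative and
    integration by parts leaves no extra term. This makes the rotation field skew. *)
Lemma rdot_coor_wpartial i j u phi : i != j -> H1 D u -> test_function D phi ->
  rdot D u (fun r => (r ord0 j)%:C * wpartial D i phi r) =
  - rdot D (fun r => (r ord0 j)%:C * wpartial D i u r) phi.
Proof.
move=> ij Hu tphi; have tm := test_functionMl (coor_smooth j) tphi.
rewrite [in RHS]rdot_mul -(rdot_wpartial_test i Hu tm).
have Lu := H1_L2 Hu.
apply: (rdot_ae oD (aeW _ (fun _ _ => erefl)) _ Lu
  (L2_coorM j (wpartial_L2 i (test_H1 oD DL tphi))) Lu (wpartial_L2 i (test_H1 oD DL tm))).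
apply: filterS2 (wpartial_test oD DL i tphi) (wpartial_test oD DL i tm) => r E1 E2 Dr.
by rewrite (E1 Dr) (E2 Dr) (partial_coorM _ ij tphi).
Qed.

End angular_momentum.

Section rotation.
Local Open Scope complex_scope.
Context {R : realType} {n : nat}.
Variables (D : set 'rV[R]_n) (L : R).
Hypothesis oD : open D.
Hypothesis L0 : 0 <= L.
Hypothesis DL : forall r, D r -> forall j, `|r ord0 j| < L.
Variables (i j : 'I_n).
Hypothesis ij : i != j.
Local Opaque rdot wpartial gdot.
Local Notation leb := (lebesgue_measure_rV R n).
Local Notation rdot := (rdot D).
Local Notation gdot := (gdot D).
Local Notation H1 := (H1 D).
Local Notation H01 := (H01 D).
Implicit Types f g u v w phi : 'rV[R]_n -> R[i].

(** The difference is written as a sum with the real factor -1, the shape on which [rdotDr] and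
    [rdotZr] act. *)
Definition rot u : 'rV[R]_n -> R[i] := fun r =>
  (r ord0 i)%:C * wpartial D j u r + (-1)%:C * ((r ord0 j)%:C * wpartial D i u r).

(* The angular momentum operator in the plane of the coordinates [i] and [j]. *)
Definition ang u : 'rV[R]_n -> R[i] := fun r => - 'i * rot u r.

Lemma angE u : ang u = fun r => - 'i * rot u r.
Proof. by []. Qed.

Lemma L2_rot u : H1 u -> L2 D (rot u).
Proof.
move=> Hu; apply: (L2D oD (L2_coorM oD DL i (wpartial_L2 j Hu))).
exact: (L2Z oD _ (L2_coorM oD DL j (wpartial_L2 i Hu))).
Qed.

Lemma L2_ang u : H1 u -> L2 D (ang u).
Proof. by move=> Hu; exact: (L2Z oD _ (L2_rot Hu)). Qed.

Lemma rdot_skewB u phi f1 f2 g1 g2 :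
  L2 D u -> L2 D phi -> L2 D f1 -> L2 D f2 -> L2 D g1 -> L2 D g2 ->
  rdot u f1 = - rdot g1 phi -> rdot u f2 = - rdot g2 phi ->
  rdot u (fun r => f1 r + (-1)%:C * f2 r) = - rdot (fun r => g1 r + (-1)%:C * g2 r) phi.
Proof.
move=> Lu Lp Lf1 Lf2 Lg1 Lg2 E1 E2.
rewrite (rdotDr oD Lf1 (L2Z oD _ Lf2) Lu) (rdotDl oD Lg1 (L2Z oD _ Lg2) Lp).
by rewrite (rdotZr oD _ Lf2 Lu) (rdotZl oD _ Lg2 Lp) E1 E2 mulrN -opprD.
Qed.

Lemma rdot_rot u phi : H1 u -> test_function D phi ->
  rdot u (rot phi) = - rdot (rot u) phi.
Proof.
move=> Hu tphi; have Hp := test_H1 oD DL tphi.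
have ji : j != i by rewrite eq_sym.
exact: (rdot_skewB (H1_L2 Hu) (H1_L2 Hp)
  (L2_coorM oD DL i (wpartial_L2 j Hp)) (L2_coorM oD DL j (wpartial_L2 i Hp))
  (L2_coorM oD DL i (wpartial_L2 j Hu)) (L2_coorM oD DL j (wpartial_L2 i Hu))
  (rdot_coor_wpartial oD DL ji Hu tphi) (rdot_coor_wpartial oD DL ij Hu tphi)).
Qed.

Lemma ang_arith (q x y z a b a' b' c : R[i]) :
  q * (x * (a + c * a') + z * (y * (b + c * b'))) =
  q * (x * a + z * (y * b)) + c * (q * (x * a' + z * (y * b'))).
Proof. ring. Qed.

Lemma rot_arith (x y z a b c : R[i]) :
  x * (c * a) + z * (y * (c * b)) = c * (x * a + z * (y * b)).
Proof. ring. Qed.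

Lemma ang_ae u v w (c : R[i]) : H1 u -> H1 v ->
  (forall k, \forall r \ae leb, D r ->
    wpartial D k w r = wpartial D k u r + c * wpartial D k v r) ->
  \forall r \ae leb, D r -> ang w r = ang u r + c * ang v r.
Proof.
move=> Hu Hv H; apply: filterS2 (H i) (H j) => r Ei Ej Dr.
by rewrite /ang /rot (Ei Dr) (Ej Dr); exact: ang_arith.
Qed.

Lemma angD_ae u v : H1 u -> H1 v ->
  \forall r \ae leb, D r -> ang (fun r => u r + v r) r = ang u r + ang v r.
Proof.
move=> Hu Hv; have H := ang_ae (w := fun r => u r + v r) (c := 1) Hu Hv.
apply: filterS (H _) => [r E Dr|k]; first by rewrite (E Dr) mul1r.
by apply: filterS (wpartialD oD DL k Hu Hv) => r E Dr; rewrite (E Dr) mul1r.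
Qed.

Lemma angZ_ae (c : R[i]) u : H1 u ->
  \forall r \ae leb, D r -> ang (fun r => c * u r) r = c * ang u r.
Proof.
move=> Hu; apply: filterS2 (wpartialZ oD DL i c Hu) (wpartialZ oD DL j c Hu) => r Ei Ej Dr.
rewrite /ang /rot (Ei Dr) (Ej Dr).
by rewrite rot_arith [LHS]mulrCA.
Qed.

Lemma rdot_angD w u v : L2 D w -> H1 u -> H1 v ->
  rdot w (ang (fun r => u r + v r)) = rdot w (ang u) + rdot w (ang v).
Proof.
move=> Lw Hu Hv; have LU := L2_ang Hu; have LV := L2_ang Hv.
rewrite -(rdotDr oD LU LV Lw).
exact: (rdot_ae oD (aeW _ (fun _ _ => erefl)) (angD_ae Hu Hv) Lw
  (L2_ang (H1D oD DL Hu Hv)) Lw (L2D oD LU LV)).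
Qed.

Lemma rdot_angZ w (c : R) u : L2 D w -> H1 u ->
  rdot w (ang (fun r => c%:C * u r)) = c * rdot w (ang u).
Proof.
move=> Lw Hu; have LU := L2_ang Hu.
rewrite -(rdotZr oD _ LU Lw).
exact: (rdot_ae oD (aeW _ (fun _ _ => erefl)) (angZ_ae c%:C Hu) Lw
  (L2_ang (H1Z oD DL _ Hu)) Lw (L2Z oD _ LU)).
Qed.

(** The factor - i is skew as well, so its product with the skew rotation field is symmetric. *)
Lemma rdot_ang_test u phi : H1 u -> test_function D phi ->
  rdot u (ang phi) = rdot (ang u) phi.
Proof.
move=> Hu tphi; have Lu := H1_L2 Hu; have Lp := test_function_L2 oD DL tphi.
have Hp := test_H1 oD DL tphi; have HJ := H1Z oD DL (- 'i) Hu.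
have LJ := L2Z oD (- 'i) Lu.
rewrite {1}/ang (rdot_mulNi oD Lu (L2_rot Hp)) (rdot_rot HJ tphi) opprK.
apply: (rdot_ae oD _ (aeW _ (fun _ _ => erefl)) (L2_rot HJ) Lp (L2_ang Hu) Lp).
apply: filterS2 (wpartialZ oD DL i (- 'i) Hu) (wpartialZ oD DL j (- 'i) Hu) => r Ei Ej Dr.
rewrite /ang /rot (Ei Dr) (Ej Dr).
exact: rot_arith.
Qed.

Lemma gdot2_le u : rdot (wpartial D i u) (wpartial D i u) +
  rdot (wpartial D j u) (wpartial D j u) <= gdot u u.
Proof.
rewrite gdotE (bigD1 i)//= lerD2l (bigD1 j) /=; last by rewrite eq_sym.
by rewrite lerDl; apply: sumr_ge0 => k _; exact: rdot_ge0.
Qed.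

Lemma rdotDN_le f g : L2 D f -> L2 D g ->
  rdot (fun r => f r + (-1)%:C * g r) (fun r => f r + (-1)%:C * g r) <=
  2 * rdot f f + 2 * rdot g g.
Proof.
move=> Lf Lg; have Lg' := L2Z oD (-1)%:C Lg.
apply: (le_trans (rdotD_le oD Lf Lg')).
rewrite (rdotZl oD _ Lg Lg') (rdotZr oD _ Lg Lg).
by move: (rdot f f) (rdot g g) => a b; lra.
Qed.

Lemma ang_le_arith (l g a b x y z : R) : z <= 2 * x + 2 * y -> x <= l * b ->
  y <= l * a -> l * (a + b) <= l * g -> z <= 2 * l * g.
Proof. by rewrite mulrDr => H1 H2 H3 H4; rewrite -mulrA; lra. Qed.

Lemma ang_le u : H1 u -> rdot (ang u) (ang u) <= 2 * L ^+ 2 * gdot u u.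
Proof.
move=> Hu; have Lr := L2_rot Hu.
have Li := wpartial_L2 i Hu; have Lj := wpartial_L2 j Hu.
have Xj := L2_coorM oD DL i Lj; have Xi := L2_coorM oD DL j Li.
rewrite /ang (rdot_mulNi2 oD Lr Lr).
exact: (ang_le_arith (rdotDN_le Xj Xi) (rdot_coorM_le oD L0 DL i Lj) (rdot_coorM_le oD L0 DL j Li)
  (ler_wpM2l (sqr_ge0 L) (gdot2_le u))).
Qed.

Lemma H01_split v e : H01 v -> 0 < e -> exists phi w,
  [/\ test_function D phi, H1 w, v = fun r => phi r + w r & rdot w w + gdot w w < e].
Proof.
move=> Hv e0; have [phi tphi de] := H01_dense oD DL Hv e0.
exists phi, (fun r => v r - phi r); split => //.
  exact: (H1B oD DL (H01_H1 Hv) (test_H1 oD DL tphi)).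
by apply/funext => r; rewrite addrC subrK.
Qed.

Lemma sym_arith (x y z r g a b l e : R) : 0 <= a -> 0 <= b -> 0 <= l -> 0 <= r -> 0 <= g ->
  r + g < e -> x ^+ 2 <= a * z -> y ^+ 2 <= b * r -> z <= 2 * l * g ->
  (x - y) ^+ 2 <= 0 + e * (2 * (a * (2 * l)) + 2 * b).
Proof.
move=> a0 b0 l0 r0 g0 de C1 C2 A.
have A' : z <= 2 * l * e.
  by apply: (le_trans A); apply: ler_wpM2l; [exact: mulr_ge0|lra].
have C1' : x ^+ 2 <= a * (2 * l * e) by apply: (le_trans C1); exact: ler_wpM2l.
have C2' : y ^+ 2 <= b * e by apply: (le_trans C2); apply: ler_wpM2l => //; lra.
have S : (x - y) ^+ 2 <= 2 * x ^+ 2 + 2 * y ^+ 2 by have := sqr_ge0 (x + y); nra.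
apply: (le_trans S); rewrite add0r.
have -> : e * (2 * (a * (2 * l)) + 2 * b) = 2 * (a * (2 * l * e)) + 2 * (b * e) by ring.
by apply: lerD; apply: ler_wpM2l.
Qed.

(** The identity holds for test functions and both sides are continuous in [v] for the H^1 norm, by
    [ang_le] and Cauchy-Schwarz. The boundary terms vanish with [v]. *)
Lemma rdot_ang_sym u v : H1 u -> H01 v -> rdot u (ang v) = rdot (ang u) v.
Proof.
move=> Hu Hv; have Lu := H1_L2 Hu; have LAu := L2_ang Hu.
apply/eqP; rewrite -subr_eq0 -sqrf_eq0 eq_le sqr_ge0 andbT.
apply: (@le_of_small _ _ _ (2 * (rdot u u * (2 * L ^+ 2)) + 2 * rdot (ang u) (ang u))).
move=> e /andP[e0 _]; have [phi [w [tphi Hw Ev de]]] := H01_split Hv e0.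
have Hp := test_H1 oD DL tphi; have Lp := H1_L2 Hp; have Lw := H1_L2 Hw.
have -> : rdot u (ang v) - rdot (ang u) v = rdot u (ang w) - rdot (ang u) w.
  rewrite Ev (rdot_angD Lu Hp Hw) (rdotDr oD Lp Lw LAu) (rdot_ang_test Hu tphi).
  by rewrite opprD addrACA subrr add0r.
exact: (sym_arith (rdot_ge0 D u) (rdot_ge0 D (ang u)) (sqr_ge0 L) (rdot_ge0 D w)
  (gdot_ge0 D w) de (rdot_cauchy_schwarz oD Lu (L2_ang Hw))
  (rdot_cauchy_schwarz oD LAu Lw) (ang_le Hw)).
Qed.

End rotation.

(** With q the last term, 4 (t b) q = c^2 a b: an inequality between geometric and arithmetic means,
    proved on squares because only x^2 is controlled. *)
Lemma young_le (R : realFieldType) (x a b c t : R) : 0 <= a -> 0 <= b -> 0 < t ->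
  x ^+ 2 <= a * b -> c * x <= t * b + c ^+ 2 / (4 * t) * a.
Proof.
move=> a0 b0 t0 xab; set q := c ^+ 2 / (4 * t) * a.
have q0 : 0 <= q by rewrite mulr_ge0// divr_ge0 ?sqr_ge0// mulr_ge0// ltW.
have tb0 : 0 <= t * b by rewrite mulr_ge0// ltW.
have E : 4 * (t * b) * q = c ^+ 2 * (a * b) by rewrite /q; field; rewrite gt_eqF.
have H : (c * x) ^+ 2 <= (t * b + q) ^+ 2.
  have H1 : (c * x) ^+ 2 <= 4 * (t * b) * q by rewrite E exprMn ler_wpM2l// sqr_ge0.
  by apply: (le_trans H1); have := sqr_ge0 (t * b - q); nra.
apply: (le_trans (ler_norm _)).
by rewrite -(ler_pXn2r (n := 2)) ?nnegrE ?addr_ge0// real_normK ?num_real.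
Qed.

Section energy_form.
Local Open Scope complex_scope.
Context {R : realType} {n : nat}.
Variables (D : set 'rV[R]_n.+1) (L : R).
Hypothesis oD : open D.
Hypothesis L0 : 0 <= L.
Hypothesis DL : forall r, D r -> forall j, `|r ord0 j| < L.
Variables (i j : 'I_n.+1).
Hypothesis ij : i != j.
Variables (W : 'rV[R]_n.+1 -> R) (M K Omega : R).
Hypothesis mW : measurable_fun D W.
Hypothesis M0 : 0 <= M.
Hypothesis WM : forall r, D r -> `|W r| <= M.
Hypothesis K0 : 0 < K.
Hypothesis trap : forall r, D r ->
  (1 + K) / 4 * Omega ^+ 2 * (r ord0 i ^+ 2 + r ord0 j ^+ 2) <= W r.
Local Opaque rdot wpartial gdot ang.
Local Notation rdot := (rdot D).
Local Notation gdot := (gdot D).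
Local Notation H1 := (H1 D).
Local Notation H01 := (H01 D).
Local Notation ang := (ang D i j).
Implicit Types f g u v w phi : 'rV[R]_n.+1 -> R[i].

Lemma L2_W f : L2 D f -> L2 D (fun r => (W r)%:C * f r).
Proof. exact: (L2_bounded_mul oD mW WM). Qed.

(** The real part of [a0dot] ([Re_a0dot]), with [W] a bounded version of the potential that
    satisfies the trapping condition everywhere on [D]. *)
Definition form v w : R :=
  gdot v w + rdot v (fun r => (W r)%:C * w r) - Omega * rdot v (ang w).

Lemma formE v w : form v w =
  gdot v w + rdot v (fun r => (W r)%:C * w r) - Omega * rdot v (ang w).
Proof. by []. Qed.

Lemma formDr u v w : H1 u -> H1 v -> H1 w ->
  form w (fun r => u r + v r) = form w u + form w v.
Proof.
move=> Hu Hv Hw; have Lu := H1_L2 Hu; have Lv := H1_L2 Hv; have Lw := H1_L2 Hw.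
rewrite /form (gdotDr oD DL Hu Hv Hw) (rdot_angD oD DL i j Lw Hu Hv).
have -> : (fun r => (W r)%:C * (u r + v r)) = fun r => (W r)%:C * u r + (W r)%:C * v r.
  by apply/funext => r; rewrite mulrDr.
rewrite (rdotDr oD (L2_W Lu) (L2_W Lv) Lw) mulrDr.
by rewrite [X in X - _]addrACA opprD [LHS]addrACA.
Qed.

Lemma formZr (c : R) u w : H1 u -> H1 w ->
  form w (fun r => c%:C * u r) = c * form w u.
Proof.
move=> Hu Hw; have Lu := H1_L2 Hu; have Lw := H1_L2 Hw.
rewrite /form (gdotZr oD DL c Hu Hw) (rdot_angZ oD DL i j c Lw Hu).
have -> : (fun r => (W r)%:C * (c%:C * u r)) = fun r => c%:C * ((W r)%:C * u r).
  by apply/funext => r; rewrite mulrCA.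
rewrite (rdotZr oD _ (L2_W Lu) Lw).
move: (gdot w u) (rdot w (fun r => (W r)%:C * u r)) (rdot w (ang u)) => x y z; ring.
Qed.

Lemma form_sym u v : H01 u -> H01 v -> form u v = form v u.
Proof.
move=> Hu Hv; rewrite /form (rdot_ang_sym oD L0 DL ij (H01_H1 Hu) Hv).
by rewrite (rdotC D (ang u)) -rdot_mul (rdotC D (fun r => (W r)%:C * u r)) (gdotC D u).
Qed.

Lemma trap_le u (c := (1 + K) / 4 * Omega ^+ 2) : L2 D u ->
  c * rdot (fun r => (r ord0 i)%:C * u r) (fun r => (r ord0 i)%:C * u r) +
  c * rdot (fun r => (r ord0 j)%:C * u r) (fun r => (r ord0 j)%:C * u r) <=
  rdot u (fun r => (W r)%:C * u r).
Proof.
move=> Lu; pose m r := W r - c * (r ord0 i ^+ 2 + r ord0 j ^+ 2).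
have m0 r : D r -> 0 <= m r by move=> /trap; rewrite subr_ge0.
have := rdot_mul_ge0 u m0.
have Li := L2_coorM oD DL i Lu; have Lj := L2_coorM oD DL j Lu.
have Lii := L2_coorM oD DL i Li; have Ljj := L2_coorM oD DL j Lj.
have -> : (fun r => (m r)%:C * u r) = fun r =>
    (W r)%:C * u r + ((- c)%:C * ((r ord0 i)%:C * ((r ord0 i)%:C * u r)) +
                      (- c)%:C * ((r ord0 j)%:C * ((r ord0 j)%:C * u r))).
  apply/funext => r; rewrite /m; move: (W r) (u r) (r ord0 i) (r ord0 j) => a [x y] p q.
  by apply/eqP; rewrite eq_complex /=; apply/andP; split; apply/eqP; ring.
have Zi := L2Z oD (- c)%:C Lii; have Zj := L2Z oD (- c)%:C Ljj.
rewrite (rdotDr oD (L2_W Lu) (L2D oD Zi Zj) Lu) (rdotDr oD Zi Zj Lu).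
rewrite (rdotZr oD _ Lii Lu) (rdotZr oD _ Ljj Lu).
rewrite -(rdot_mul D (fun r : 'rV[R]_n.+1 => r ord0 i) u (fun r => (r ord0 i)%:C * u r)).
rewrite -(rdot_mul D (fun r : 'rV[R]_n.+1 => r ord0 j) u (fun r => (r ord0 j)%:C * u r)).
set a := rdot _ _; set b := rdot _ _; set e := rdot _ _.
by move: a b e => a b e; lra.
Qed.

Lemma rdot_rotE v f g : L2 D v -> L2 D f -> L2 D g ->
  rdot v (fun r => (r ord0 i)%:C * f r + (-1)%:C * ((r ord0 j)%:C * g r)) =
  rdot (fun r => (r ord0 i)%:C * v r) f - rdot (fun r => (r ord0 j)%:C * v r) g.
Proof.
move=> Lv Lf Lg; have Xf := L2_coorM oD DL i Lf; have Xg := L2_coorM oD DL j Lg.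
rewrite (rdotDr oD Xf (L2Z oD _ Xg) Lv) (rdotZr oD _ Xg Lv) mulN1r.
by congr (_ - _); symmetry; [exact: (rdot_mul D (fun r : 'rV[R]_n.+1 => r ord0 i))
  |exact: (rdot_mul D (fun r : 'rV[R]_n.+1 => r ord0 j))].
Qed.

Lemma ang_form_arith (A B P Q p q g w t c : R) :
  - Omega * A <= t * p + c * P -> Omega * B <= t * q + c * Q ->
  c * P + c * Q <= w -> t * (q + p) <= t * g ->
  Omega * - (A - B) <= w + t * g.
Proof. lra. Qed.

(* Young's inequality with weight [1 / (1 + K)] produces exactly the potential
   [(1 + K) / 4 * Omega ^ 2 * (x ^ 2 + y ^ 2)] of the trapping condition. *)
Lemma rdot_ang_le u : H1 u ->
  Omega * rdot u (ang u) <= rdot u (fun r => (W r)%:C * u r) + (1 + K)^-1 * gdot u u.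
Proof.
move=> Hu; have Lu := H1_L2 Hu; have LJ := L2Z oD (- 'i) Lu.
have t0 : 0 < (1 + K)^-1 by rewrite invr_gt0 addr_gt0.
have Li := wpartial_L2 i Hu; have Lj := wpartial_L2 j Hu.
have Xj := L2_coorM oD DL i Lj; have Xi := L2_coorM oD DL j Li.
have young k (f : 'rV[R]_n.+1 -> R[i]) (c : R) : L2 D f ->
    c * rdot (fun r => (r ord0 k)%:C * (- 'i * u r)) f <=
    (1 + K)^-1 * rdot f f + c ^+ 2 / (4 * (1 + K)^-1) *
      rdot (fun r => (r ord0 k)%:C * u r) (fun r => (r ord0 k)%:C * u r).
  move=> Lf; have Lk := L2_coorM oD DL k Lu; have LJk := L2_coorM oD DL k LJ.
  have E : (fun r : 'rV[R]_n.+1 => (r ord0 k)%:C * (- 'i * u r)) = fun r => - 'i * ((r ord0 k)%:C * u r).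
    by apply/funext => r; rewrite mulrCA.
  have <- := rdot_mulNi2 oD Lk Lk; rewrite -E.
  exact: (young_le _ (rdot_ge0 D _) (rdot_ge0 D _) t0 (rdot_cauchy_schwarz oD LJk Lf)).
have Yj := young i _ (- Omega) Lj; have Yi := young j _ Omega Li.
rewrite angE (rdot_mulNi oD Lu (L2_rot oD DL i j Hu)).
rewrite (rdot_rotE LJ Lj Li).
have T := trap_le Lu; have G := gdot2_le D ij u.
have c4 (x : R) : x / (4 * (1 + K)^-1) = (1 + K) / 4 * x.
  by field; rewrite gt_eqF// addr_gt0.
rewrite c4 sqrrN in Yj; rewrite c4 in Yi.
exact: (ang_form_arith Yj Yi T (ler_wpM2l (ltW t0) G)).
Qed.

(** [rdot_ang_le] spends the whole potential term and the fraction 1 / (1 + K) of the gradient term;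
    the fraction K / (1 + K) remains. *)
Lemma form_coercive u : H1 u -> K / (1 + K) * gdot u u <= form u u.
Proof.
move=> Hu; have := rdot_ang_le Hu; rewrite /form.
have -> : K / (1 + K) = 1 - (1 + K)^-1 by field; rewrite gt_eqF// addr_gt0.
by move: (gdot u u) (rdot u (fun r => (W r)%:C * u r)) (Omega * _) => x y z; nra.
Qed.

Lemma form_ge0 u : H1 u -> 0 <= form u u.
Proof.
move=> Hu; apply: le_trans (form_coercive Hu); apply: mulr_ge0; last exact: gdot_ge0.
by apply: divr_ge0; [exact: ltW|rewrite addr_ge0// ltW].
Qed.

Lemma rdot_W_le u : L2 D u -> rdot u (fun r => (W r)%:C * u r) <= M * rdot u u.
Proof.
move=> Lu; have m0 r : D r -> 0 <= M - W r.
  by move=> /WM /(le_trans (ler_norm _)); rewrite subr_ge0.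
have := rdot_mul_ge0 u m0.
have -> : (fun r => (M - W r)%:C * u r) = fun r => M%:C * u r + (-1)%:C * ((W r)%:C * u r).
  by apply/funext => r; rewrite rmorphB mulrBl rmorphN rmorph1 mulN1r.
rewrite (rdotDr oD (L2Z oD _ Lu) (L2Z oD _ (L2_W Lu)) Lu).
rewrite (rdotZr oD _ Lu Lu) (rdotZr oD _ (L2_W Lu) Lu) mulN1r subr_ge0.
exact.
Qed.

(** Young with weight 1 bounds the angular term by Omega^2 / 4 |u|^2 + |ang u|^2, and [ang_le]
    bounds the latter by 2 L^2 |grad u|^2. Poincare, with 64 L^2, converts the terms in |u|^2. *)
Definition form_cst : R := 1 + (M + Omega ^+ 2 / 4) * (64 * L ^+ 2) + 2 * L ^+ 2.

Lemma form_cst_gt0 : 0 < form_cst.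
Proof.
apply: ltr_wpDr; first by apply: mulr_ge0; [exact: ler0n|exact: sqr_ge0].
apply: ltr_wpDr => //; apply: mulr_ge0.
  by apply: addr_ge0 => //; apply: divr_ge0; [exact: sqr_ge0|exact: ler0n].
by apply: mulr_ge0; [exact: ler0n|exact: sqr_ge0].
Qed.

Lemma form_le_arith (g r a x l w : R) : r <= 64 * l * g -> a <= 2 * l * g -> w <= M * r ->
  - Omega * x <= 1 * a + (- Omega) ^+ 2 / (4 * 1) * r ->
  g + w - Omega * x <= (1 + (M + Omega ^+ 2 / 4) * (64 * l) + 2 * l) * g.
Proof.
rewrite sqrrN mulr1 mul1r => H1 H2 H3 H4.
have c0 : 0 <= M + Omega ^+ 2 / 4.
  by apply: addr_ge0 => //; apply: divr_ge0; [exact: sqr_ge0|exact: ler0n].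
have := ler_wpM2l c0 H1; move: (Omega ^+ 2 / 4) H4 => o H4; lra.
Qed.

Lemma form_le u : H01 u -> form u u <= form_cst * gdot u u.
Proof.
move=> Hu; have H1u := H01_H1 Hu; have Lu := H1_L2 H1u.
have LA := L2_ang oD DL i j H1u.
have Y := young_le (- Omega) (rdot_ge0 D u) (rdot_ge0 D (ang u)) ltr01
  (rdot_cauchy_schwarz oD Lu LA).
rewrite /form /form_cst; apply: (form_le_arith (H01_poincare oD L0 DL Hu) (ang_le oD L0 DL ij H1u) (rdot_W_le Lu)).
exact: Y.
Qed.

End energy_form.

(** * The quartic form and the derivative of the energy *)

Section quartic_form.
Local Open Scope complex_scope.
Context {R : realType} {n : nat}.
Hypothesis dim23 : n.+1 = 2%N \/ n.+1 = 3%N.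
Variables (D : set 'rV[R]_n.+1) (L : R).
Hypothesis oD : open D.
Hypothesis L0 : 0 <= L.
Hypothesis DL : forall r, D r -> forall j, `|r ord0 j| < L.
Local Notation leb := (lebesgue_measure_rV R n.+1).
Local Notation sqint := (sqint leb D).
Local Notation ip := (ip leb D).
Local Notation rdot := (rdot D).
Local Notation gdot := (gdot D).
Local Notation H01 := (H01 D).
Implicit Types f g u v w : 'rV[R]_n.+1 -> R[i].

Let mD : measurable D. Proof. exact: open_measurable_rV. Qed.

Definition rdens u v (r : 'rV[R]_n.+1) : R :=
  complex.Re (u r) * complex.Re (v r) + complex.Im (u r) * complex.Im (v r).

Lemma rdensC u v : rdens u v = rdens v u.
Proof. by apply/funext => r; rewrite /rdens mulrC [X in _ + X]mulrC. Qed.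

Lemma rdensDl u v w :
  rdens (fun r => u r + v r) w = fun r => rdens u w r + rdens v w r.
Proof.
apply/funext => r; rewrite /rdens; move: (u r) (v r) (w r) => [a b] [c e] [x y] /=; ring.
Qed.

Lemma rdensZl (c : R) u w : rdens (fun r => c%:C * u r) w = fun r => c * rdens u w r.
Proof.
apply/funext => r; rewrite /rdens; move: (u r) (w r) => [a b] [x y] /=; ring.
Qed.

Lemma rdens_csq u : rdens u u = csq u.
Proof. by apply/funext => r; rewrite /rdens /csq !expr2. Qed.

Lemma rdens_sqr_le u v r : rdens u v r * rdens u v r <= csq u r * csq v r.
Proof.
rewrite /rdens /csq; move: (u r) (v r) => [a b] [x y] /=.
have := sqr_ge0 (a * y - b * x); nra.
Qed.

Lemma measurable_rdens u v : L2 D u -> L2 D v -> measurable_fun D (rdens u v).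
Proof.
move=> [ur ui _] [vr vi _].
exact: measurable_funD (measurable_funM ur vr) (measurable_funM ui vi).
Qed.

Lemma sqint_csq u : H01 u -> sqint (csq u).
Proof. by move=> Hu; have [] := H01_integral4 oD L0 DL dim23 Hu. Qed.

Lemma sqint_rdens u v : H01 u -> H01 v -> sqint (rdens u v).
Proof.
move=> Hu Hv; apply: (sqint_dominated mD (g := fun r => csq u r * csq v r)).
- exact: (measurable_rdens (H1_L2 (H01_H1 Hu)) (H1_L2 (H01_H1 Hv))).
- exact: (integrableM_sqint mD (sqint_csq Hu) (sqint_csq Hv)).
- by move=> r _; rewrite expr2; exact: rdens_sqr_le.
Qed.

(* [quad D u u u u] is the fourth power of the L^4 norm of [u]. *)
Definition quad a b c e : R := ip (rdens a b) (rdens c e).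

Lemma quadC a b c e : quad a b c e = quad b a c e.
Proof. by rewrite /quad (rdensC a). Qed.

Lemma quadCA a b c e : quad a b c e = quad c e a b.
Proof. exact: ipC. Qed.

Lemma quadDl a a' b c e : H01 a -> H01 a' -> H01 b -> H01 c -> H01 e ->
  quad (fun r => a r + a' r) b c e = quad a b c e + quad a' b c e.
Proof.
move=> Ha Ha' Hb Hc He; rewrite /quad rdensDl.
exact: (ipDl mD (sqint_rdens Ha Hb) (sqint_rdens Ha' Hb) (sqint_rdens Hc He)).
Qed.

Lemma quadZl (t : R) a b c e : H01 a -> H01 b -> H01 c -> H01 e ->
  quad (fun r => t%:C * a r) b c e = t * quad a b c e.
Proof.
move=> Ha Hb Hc He; rewrite /quad rdensZl.
exact: (ipZl mD t (sqint_rdens Ha Hb) (sqint_rdens Hc He)).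
Qed.

Lemma quad_ge0 u : 0 <= quad u u u u.
Proof. exact: ip_ge0. Qed.

Lemma quad_integral4 u : H01 u ->
  quad u u u u ^+ 2 <= ladyzhenskaya_cst L * (rdot u u * gdot u u ^+ 3).
Proof.
by move=> Hu; rewrite /quad rdens_csq; have [] := H01_integral4 oD L0 DL dim23 Hu.
Qed.

Lemma quad2_le a b : H01 a -> H01 b ->
  0 <= quad a b a b <= ip (csq a) (csq b).
Proof.
move=> Ha Hb; apply/andP; split; first exact: ip_ge0.
apply: (le_ip mD (sqint_rdens Ha Hb) (sqint_rdens Ha Hb) (sqint_csq Ha) (sqint_csq Hb)).
by move=> r _; exact: rdens_sqr_le.
Qed.

(** Cauchy-Schwarz twice: between the two densities, then between squared moduli by way of
    [quad2_le]. The fourth power avoids roots. *)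
Lemma quad_le a b c e : H01 a -> H01 b -> H01 c -> H01 e ->
  quad a b c e ^+ 4 <=
  quad a a a a * quad b b b b * (quad c c c c * quad e e e e).
Proof.
move=> Ha Hb Hc He; rewrite (exprM _ 2 2).
have key x y : H01 x -> H01 y -> quad x y x y ^+ 2 <= quad x x x x * quad y y y y.
  move=> Hx Hy; have /andP[q0 qi] := quad2_le Hx Hy.
  apply: (@le_trans _ _ (ip (csq x) (csq y) ^+ 2)).
    by rewrite lerXn2r ?nnegrE// (le_trans q0).
  rewrite /quad !rdens_csq; exact: (ip_cauchy_schwarz mD (sqint_csq Hx) (sqint_csq Hy)).
have H : quad a b c e ^+ 2 <= quad a b a b * quad c e c e.
  exact: (ip_cauchy_schwarz mD (sqint_rdens Ha Hb) (sqint_rdens Hc He)).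
apply: (@le_trans _ _ ((quad a b a b * quad c e c e) ^+ 2)).
  rewrite lerXn2r ?nnegrE// ?sqr_ge0//.
  by apply: mulr_ge0; exact: ip_ge0.
rewrite exprMn; apply: ler_pM; [exact: sqr_ge0|exact: sqr_ge0|exact: key|exact: key].
Qed.

End quartic_form.

Section real_part_integral.
Local Open Scope complex_scope.
Context {R : realType} {n : nat}.
Variables (D : set 'rV[R]_n).
Hypothesis oD : open D.
Local Notation leb := (lebesgue_measure_rV R n).
Local Notation "f ^re" := (fun r => complex.Re (f r)) (at level 2, format "f ^re").
Implicit Types f g F G : 'rV[R]_n -> R[i].

Let mD : measurable D. Proof. exact: open_measurable_rV. Qed.

(** The value travels with integrability, which the additivity of the integral requires; of the
    complex integral only the real part is ever evaluated. *)
Definition has_rint F (x : R) := leb.-integrable D (EFin \o F^re) /\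
  complex.Re (cintegral D F) = x.

Lemma has_rintD F G x y : has_rint F x -> has_rint G y ->
  has_rint (fun r => F r + G r) (x + y).
Proof.
move=> [iF FE] [iG GE].
have E : (fun r => complex.Re (F r + G r)) = fun r => complex.Re (F r) + complex.Re (G r).
  by apply/funext => r; rewrite raddfD.
split.
  rewrite (_ : EFin \o _ = (EFin \o F^re) \+ (EFin \o G^re))%E; first exact: integrableD.
  by apply/funext => r /=; rewrite raddfD.
by rewrite /cintegral /= -FE -GE E RintegralD.
Qed.

Lemma has_rint_sum (I : Type) (s : seq I) (F : I -> 'rV[R]_n -> R[i]) (x : I -> R) :
  (forall i, has_rint (F i) (x i)) ->
  has_rint (fun r => \sum_(i <- s) F i r) (\sum_(i <- s) x i).
Proof.
move=> H; elim: s => [|i s IH].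
  rewrite big_nil; have -> : (fun r => \sum_(i <- [::]) F i r) = fun=> 0 by apply/funext => r; rewrite big_nil.
  split; first exact: integrable0.
  by rewrite /cintegral /= Rintegral_cst// mul0r.
rewrite big_cons; have -> : (fun r => \sum_(j <- i :: s) F j r) =
    fun r => F i r + \sum_(j <- s) F j r by apply/funext => r; rewrite big_cons.
exact: has_rintD.
Qed.

Lemma Re_mulJ (z w : R[i]) : complex.Re (z^* * w) =
  complex.Re z * complex.Re w + complex.Im z * complex.Im w.
Proof. by case: z w => [a b] [c e] /=; ring. Qed.

Lemma has_rint_rdot f g : L2 D f -> L2 D g ->
  has_rint (fun r => (f r)^* * g r) (rdot D f g).
Proof.
move=> Lf Lg; have /(L2P oD)[fr fi] := Lf; have /(L2P oD)[gr gi] := Lg.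
split; last exact: (Re_L2dot oD Lf Lg).
rewrite (_ : EFin \o _ = (EFin \o (fun r => (complex.Re (f r) * complex.Re (g r))%R)) \+
  (EFin \o (fun r => (complex.Im (f r) * complex.Im (g r))%R)))%E.
  by apply: integrableD => //; apply: integrableM_sqint.
by apply/funext => r /=; rewrite Re_mulJ.
Qed.

End real_part_integral.

Section energy_derivative.
Local Open Scope complex_scope.
Context {R : realType} {d : nat}.
Hypothesis dim23 : d.+2 = 2%N \/ d.+2 = 3%N.
Variables (D : set 'rV[R]_d.+2) (L : R).
Hypothesis oD : open D.
Hypothesis L0 : 0 <= L.
Hypothesis DL : forall r, D r -> forall j, `|r ord0 j| < L.
Variables (V W : 'rV[R]_d.+2 -> R) (M K beta Omega : R).
Hypothesis mV : measurable_fun D V.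
Hypothesis mW : measurable_fun D W.
Hypothesis WM : forall r, D r -> `|W r| <= M.
Local Opaque rdot wpartial ang.
Local Notation leb := (lebesgue_measure_rV R d.+2).
Hypothesis VW : \forall r \ae leb, D r -> V r = W r.
Local Notation form := (form D (0 : 'I_d.+2) 1 W Omega).
Local Notation ang := (ang D (0 : 'I_d.+2) 1).
Implicit Types f g u v w : 'rV[R]_d.+2 -> R[i].

Let mD : measurable D. Proof. exact: open_measurable_rV. Qed.

Lemma LzE u : Lz D u = ang u.
Proof. by apply/funext => r; rewrite /Lz angE /rot rmorphN rmorph1 mulN1r. Qed.

Lemma L2_V f : L2 D f -> L2 D (fun r => (V r)%:C * f r).
Proof.
move=> Lf; have [mr mi _] := Lf; have /(L2P oD)[WR WI] := L2_W oD mW WM Lf.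
apply/(L2P oD); split.
  apply: (sqint_ae mD _ _ WR); last by apply: filterS VW => r E Dr; rewrite (E Dr).
  by under eq_fun do rewrite complex_ReM /= mul0r subr0; exact: measurable_funM.
apply: (sqint_ae mD _ _ WI); last by apply: filterS VW => r E Dr; rewrite (E Dr).
by under eq_fun do rewrite complex_ImM /= mul0r addr0; exact: measurable_funM.
Qed.

Lemma rdot_V f g : L2 D f -> L2 D g ->
  rdot D f (fun r => (V r)%:C * g r) = rdot D f (fun r => (W r)%:C * g r).
Proof.
move=> Lf Lg; apply: (rdot_ae oD (aeW _ (fun _ _ => erefl)) _ Lf (L2_V Lg) Lf (L2_W oD mW WM Lg)).
by apply: filterS VW => r E Dr; rewrite (E Dr).
Qed.

Lemma Re_a0dot v w : H1 D v -> H1 D w -> complex.Re (a0dot D V Omega v w) = form v w.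
Proof.
move=> Hv Hw; have Lv := H1_L2 Hv; have Lw := H1_L2 Hw.
have LA := L2_ang oD DL 0 1 Hw.
have S := has_rint_sum oD (index_enum 'I_d.+2)
  (fun i => has_rint_rdot oD (wpartial_L2 i Hv) (wpartial_L2 i Hw)).
have P := has_rint_rdot oD Lv (L2_V Lw).
have A := has_rint_rdot oD Lv (L2Z oD (- Omega)%:C LA).
have [_] := has_rintD oD (has_rintD oD S P) A.
rewrite formE gdotE (rdotZr oD _ LA Lv) (rdot_V Lv Lw) mulNr => <-.
rewrite /a0dot; congr (complex.Re (cintegral D _)); apply/funext => r.
rewrite LzE; congr (_ + _ + _).
  by rewrite mulrCA mulrA.
by rewrite -mulrA [RHS]mulrCA -mulNr rmorphN.
Qed.

Lemma has_rint_quartic u v : H01 D u -> H01 D v ->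
  has_rint D (fun r => ((beta * normc (u r) ^+ 2)%:C * u r)^* * v r) (beta * quad D u u u v).
Proof.
move=> Hu Hv; have Lc := sqint_rdens dim23 oD L0 DL Hu Hu.
have Ld := sqint_rdens dim23 oD L0 DL Hu Hv.
have E r : complex.Re (((beta * normc (u r) ^+ 2)%:C * u r)^* * v r) =
    beta * (rdens u u r * rdens u v r).
  rewrite normc_sqr /rdens.
  by move: (u r) (v r) => [a b] [x y] /=; ring.
have I := integrableM_sqint mD Lc Ld.
split.
  rewrite (_ : EFin \o _ = (fun r => beta%:E * (EFin \o (fun r => (rdens u u r * rdens u v r)%R)) r))%E.
    exact: (integrableZl mD).
  by apply/funext => r /=; rewrite E EFinM.
rewrite /cintegral /=; under eq_Rintegral do rewrite E.
by rewrite RintegralZl.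
Qed.

(** [dE] applies the angular momentum to [u], [form] applies it to [v]; [rdot_ang_sym] reconciles
    them. *)
Lemma dEE u v : H01 D u -> H01 D v -> dE D V beta Omega u v = form u v + beta * quad D u u u v.
Proof.
move=> H0u H0v; have Hu := H01_H1 H0u; have Hv := H01_H1 H0v.
have Lu := H1_L2 Hu; have Lv := H1_L2 Hv; have LA := L2_ang oD DL 0 1 Hu.
have i01 : (0 : 'I_d.+2) != 1 by [].
have G : complex.Re (\sum_(i < d.+2) L2dot D (wpartial D i u) (wpartial D i v)) = gdot D u v.
  rewrite raddf_sum gdotE; apply: eq_bigr => i _.
  exact: (Re_L2dot oD (wpartial_L2 i Hu) (wpartial_L2 i Hv)).
rewrite /dE G.
have P := has_rint_rdot oD (L2_V Lu) Lv.
have A := has_rint_rdot oD (L2Z oD (- Omega)%:C LA) Lv.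
have [_] := has_rintD oD (has_rintD oD P (has_rint_quartic H0u H0v)) A.
have -> : (fun r => ((V r)%:C * u r)^* * v r +
      ((beta * normc (u r) ^+ 2)%:C * u r)^* * v r + ((- Omega)%:C * ang u r)^* * v r) =
    fun r => ((V r)%:C * u r + (beta * normc (u r) ^+ 2)%:C * u r - Omega%:C * Lz D u r)^* * v r.
  apply/funext => r; rewrite LzE [in RHS]rmorphB [in RHS]rmorphD [RHS]mulrBl [X in _ = X - _]mulrDl.
  by congr (_ + _); rewrite [(- Omega)%:C]rmorphN mulNr rmorphN mulNr.
rewrite /L2dot => ->.
rewrite (rdotZl oD _ LA Lv) (rdot_mul D V) (rdot_V Lu Lv).
rewrite -(rdot_ang_sym oD L0 DL i01 Hu H0v) formE.
move: (gdot D u v) (rdot D u (fun r => (W r)%:C * v r)) (rdot D u (ang v)) (quad D u u u v).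
move=> x y z q; ring.
Qed.

End energy_derivative.

(** * Projected gradient descent in a Hilbert space *)

Lemma cvg0_sqr (R : realType) (x y : nat -> R) : (forall n, x n ^+ 2 <= y n) ->
  y n @[n --> \oo] --> (0 : R) -> x n @[n --> \oo] --> (0 : R).
Proof.
move=> xy /cvgrPdist_lt cy; apply/cvgrPdist_lt => e e0.
have e2 : 0 < e ^+ 2 by exact: exprn_gt0.
apply: filterS (cy _ e2) => n; rewrite !sub0r !normrN => yn.
have : `|x n| ^+ 2 < e ^+ 2.
  by rewrite real_normK ?num_real//; apply: le_lt_trans (xy n) (le_lt_trans (ler_norm _) yn).
by rewrite ltr_pXn2r// nnegrE// ltW.
Qed.

Lemma cvg0_squeeze (R : realType) (x y : nat -> R) : (forall n, 0 <= x n <= y n) ->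
  y n @[n --> \oo] --> (0 : R) -> x n @[n --> \oo] --> (0 : R).
Proof.
move=> xy cy; apply: squeeze_cvgr cy; first by apply: nearW => n; exact: xy.
exact: cvg_cst.
Qed.

(** [f] is nonincreasing and bounded below, so it converges and its decrements tend to 0. *)
Lemma cvg_decrements (R : realType) (f x : nat -> R) : (forall n, 0 <= x n) ->
  (forall n, 0 <= f n) -> (forall n, x n <= f n - f n.+1) ->
  x n @[n --> \oo] --> (0 : R).
Proof.
move=> x0 f0 xf; apply: (@cvg0_squeeze _ _ (fun n => f n - f n.+1)).
  by move=> n; rewrite x0 xf.
have nf : nonincreasing_seq f.
  apply/nonincreasing_seqP => n; rewrite -subr_ge0; exact: le_trans (x0 n) (xf n).
have cf : cvgn f by apply: nonincreasing_is_cvgn => //; exists 0 => _ [n _ <-].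
have cS : f n.+1 @[n --> \oo] --> limn f by rewrite (cvg_shiftS f).
by rewrite -(subrr (limn f)); exact: cvgB cf cS.
Qed.

Lemma cvg_subsequence (R : realType) (f : nat -> R) (l : R) (s : nat -> nat) :
  {homo s : m n / (m < n)%N} -> f n @[n --> \oo] --> l -> f (s n) @[n --> \oo] --> l.
Proof.
move=> hs; apply: cvg_comp => A [N _ NA]; exists N => // k /= Nk; apply: NA => /=.
apply: (leq_trans Nk); elim: k {Nk} => [//|k IH].
exact: leq_ltn_trans IH (hs _ _ (ltnSn k)).
Qed.

(* [H] stands for H^1_0, [a] and [b] for the real parts of the a0 and L^2 inner
   products, [q] for the four-linear form [quad]. *)
Section hilbert_quartic.
Context (R : realType) (T : Type) (H : T -> Prop).
Context (add : T -> T -> T) (scal : R -> T -> T).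
Context (a b : T -> T -> R) (q : T -> T -> T -> T -> R) (Cb Cq beta : R).
Hypothesis HD : forall u v, H u -> H v -> H (add u v).
Hypothesis HZ : forall t u, H u -> H (scal t u).
Hypothesis aC : forall u v, H u -> H v -> a u v = a v u.
Hypothesis aD : forall w u v, H w -> H u -> H v -> a w (add u v) = a w u + a w v.
Hypothesis aZ : forall w t u, H w -> H u -> a w (scal t u) = t * a w u.
Hypothesis a_ge0 : forall u, H u -> 0 <= a u u.
Hypothesis bC : forall u v, H u -> H v -> b u v = b v u.
Hypothesis bD : forall w u v, H w -> H u -> H v -> b w (add u v) = b w u + b w v.
Hypothesis bZ : forall w t u, H w -> H u -> b w (scal t u) = t * b w u.
Hypothesis b_ge0 : forall u, H u -> 0 <= b u u.
Hypothesis Cb0 : 0 <= Cb.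
Hypothesis ba : forall u, H u -> b u u <= Cb * a u u.
Hypothesis qC : forall x y z w, q x y z w = q y x z w.
Hypothesis qCA : forall x y z w, q x y z w = q z w x y.
Hypothesis qD : forall x x' y z w, H x -> H x' -> H y -> H z -> H w ->
  q (add x x') y z w = q x y z w + q x' y z w.
Hypothesis qZ : forall t x y z w, H x -> H y -> H z -> H w ->
  q (scal t x) y z w = t * q x y z w.
Hypothesis q_ge0 : forall u, H u -> 0 <= q u u u u.
Hypothesis q_le : forall x y z w, H x -> H y -> H z -> H w ->
  q x y z w ^+ 4 <= q x x x x * q y y y y * (q z z z z * q w w w w).
Hypothesis Cq0 : 0 <= Cq.
Hypothesis q4_le : forall u, H u -> q u u u u ^+ 2 <= Cq * (b u u * a u u ^+ 3).
Hypothesis beta0 : 0 <= beta.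
Implicit Types u v w x y z p h : T.

Let axpy t u p := add u (scal t p).

Lemma H_axpy t u p : H u -> H p -> H (axpy t u p).
Proof. by move=> Hu Hp; apply: HD => //; exact: HZ. Qed.

Lemma a_axpyr w t u p : H w -> H u -> H p -> a w (axpy t u p) = a w u + t * a w p.
Proof. by move=> Hw Hu Hp; rewrite aD ?aZ//; exact: HZ. Qed.

Lemma a_axpy t u p : H u -> H p ->
  a (axpy t u p) (axpy t u p) = a u u + 2 * t * a u p + t ^+ 2 * a p p.
Proof.
move=> Hu Hp; have Hv := H_axpy t Hu Hp.
rewrite a_axpyr// (aC Hv Hu) (aC Hv Hp) !a_axpyr// (aC Hp Hu); ring.
Qed.

Lemma b_axpyr w t u p : H w -> H u -> H p -> b w (axpy t u p) = b w u + t * b w p.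
Proof. by move=> Hw Hu Hp; rewrite bD ?bZ//; exact: HZ. Qed.

Lemma b_axpy t u p : H u -> H p ->
  b (axpy t u p) (axpy t u p) = b u u + 2 * t * b u p + t ^+ 2 * b p p.
Proof.
move=> Hu Hp; have Hv := H_axpy t Hu Hp.
rewrite b_axpyr// (bC Hv Hu) (bC Hv Hp) !b_axpyr// (bC Hp Hu); ring.
Qed.

Lemma a_cauchy_schwarz u v : H u -> H v -> a u v ^+ 2 <= a u u * a v v.
Proof.
move=> Hu Hv; apply: discriminant_le; first exact: a_ge0.
by move=> t; have := a_ge0 (H_axpy t Hu Hv); rewrite a_axpy//; lra.
Qed.

Lemma b_cauchy_schwarz u v : H u -> H v -> b u v ^+ 2 <= b u u * b v v.
Proof.
move=> Hu Hv; apply: discriminant_le; first exact: b_ge0.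
by move=> t; have := b_ge0 (H_axpy t Hu Hv); rewrite b_axpy//; lra.
Qed.

(** From q^2 <= Cq b a^3 <= Cq Cb a^4; adding 1 makes the constant positive and gives Cq Cb <= C^2,
    so that no root is taken. *)
Definition quartic_cst := Cq * Cb + 1.
Local Notation C := quartic_cst.

Lemma quartic_cst_gt0 : 0 < C.
Proof. by rewrite ltr_wpDl// mulr_ge0. Qed.

Lemma quartic_le u : H u -> q u u u u <= C * a u u ^+ 2.
Proof.
move=> Hu; have C0 := quartic_cst_gt0; have a0 := a_ge0 Hu.
rewrite -(@ler_pXn2r _ 2) ?nnegrE ?q_ge0//; last by rewrite mulr_ge0 ?sqr_ge0// ltW.
apply: (le_trans (q4_le Hu)).
have H1 : b u u * a u u ^+ 3 <= Cb * a u u ^+ 4.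
  by rewrite [in leRHS]exprS mulrA; apply: ler_wpM2r; [exact: exprn_ge0|exact: ba].
apply: (le_trans (ler_wpM2l Cq0 H1)).
rewrite mulrA exprMn -exprM; apply: ler_wpM2r; first exact: exprn_ge0.
by rewrite /C; have : 0 <= Cq * Cb by [exact: mulr_ge0]; nra.
Qed.

Lemma quartic_form_le x y z w : H x -> H y -> H z -> H w ->
  q x y z w ^+ 2 <= C ^+ 2 * (a x x * a y y * (a z z * a w w)).
Proof.
move=> Hx Hy Hz Hw; have C0 := ltW quartic_cst_gt0.
have a0 u : H u -> 0 <= a u u := @a_ge0 u.
rewrite -(@ler_pXn2r _ 2) ?nnegrE ?sqr_ge0//; last first.
  by rewrite mulr_ge0 ?sqr_ge0// !mulr_ge0 ?a0.
rewrite -exprM; apply: (le_trans (q_le Hx Hy Hz Hw)).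
have -> : (C ^+ 2 * (a x x * a y y * (a z z * a w w))) ^+ 2 =
  (C * a x x ^+ 2) * (C * a y y ^+ 2) * ((C * a z z ^+ 2) * (C * a w w ^+ 2)) by ring.
have le2 u v : H u -> H v -> q u u u u * q v v v v <= (C * a u u ^+ 2) * (C * a v v ^+ 2).
  by move=> Hu Hv; apply: ler_pM; rewrite ?q_ge0 ?quartic_le.
by apply: ler_pM; rewrite ?le2// mulr_ge0 ?q_ge0.
Qed.

Lemma q_axpy1 t u p y z w : H u -> H p -> H y -> H z -> H w ->
  q (axpy t u p) y z w = q u y z w + t * q p y z w.
Proof. by move=> Hu Hp Hy Hz Hw; rewrite qD ?qZ//; exact: HZ. Qed.

Lemma q_axpy2 t u p y z w : H u -> H p -> H y -> H z -> H w ->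
  q y (axpy t u p) z w = q y u z w + t * q y p z w.
Proof. by move=> Hu Hp Hy Hz Hw; rewrite qC q_axpy1// (qC u) (qC p). Qed.

Lemma q_axpy3 t u p y z w : H u -> H p -> H y -> H z -> H w ->
  q y z (axpy t u p) w = q y z u w + t * q y z p w.
Proof. by move=> Hu Hp Hy Hz Hw; rewrite qCA q_axpy1// (qCA u) (qCA p). Qed.

Lemma q_axpy4 t u p y z w : H u -> H p -> H y -> H z -> H w ->
  q y z w (axpy t u p) = q y z w u + t * q y z w p.
Proof. by move=> Hu Hp Hy Hz Hw; rewrite qCA q_axpy2// (qCA w u) (qCA w p). Qed.

Lemma quartic_axpy t u p : H u -> H p ->
  q (axpy t u p) (axpy t u p) (axpy t u p) (axpy t u p) =
  q u u u u + 4 * t * q u u u p + t ^+ 2 * (2 * q u u p p + 4 * q u p u p) +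
  4 * t ^+ 3 * q u p p p + t ^+ 4 * q p p p p.
Proof.
move=> Hu Hp; have Hv := H_axpy t Hu Hp.
rewrite q_axpy1// !q_axpy2// !q_axpy3// !q_axpy4//.
rewrite (qC p u u u) (qC p u u p) (qC p u p u) (qC p u p p).
rewrite (qCA p p u u) (qCA p p u p) (qCA p p p u) (qC p u p p).
rewrite (qCA u p u u) (qCA u u p u) (qC p u u u) (qCA u p u u).
have E : q u p p u = q u p u p by rewrite qCA qC.
rewrite E; ring.
Qed.

Definition energy_of u := a u u / 2 + beta / 4 * q u u u u.

Lemma energy_of_ge u : H u -> a u u / 2 <= energy_of u.
Proof. by move=> Hu; rewrite lerDl mulr_ge0 ?divr_ge0 ?q_ge0. Qed.

Lemma energy_of_ge0 u : H u -> 0 <= energy_of u.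
Proof. by move=> Hu; apply: le_trans (energy_of_ge Hu); rewrite divr_ge0// a_ge0. Qed.

(** Second-order coefficient of the energy along u + t p for |t| <= 1, with x and y standing for a u
    u and a p p. The quartic part collects 6 x from t^2, 2 (x + y) from t^3, where the root of x y
    is replaced by the mean, and y from t^4. *)
Definition descent_cst (x y : R) := 2^-1 + beta / 4 * (C * (8 * x + 3 * y)).

Lemma energy_axpy_le u p t : H u -> H p -> -1 <= t <= 1 ->
  energy_of (axpy t u p) <= energy_of u + t * (a u p + beta * q u u u p) +
    t ^+ 2 * a p p * descent_cst (a u u) (a p p).
Proof.
move=> Hu Hp /andP[t1 t2]; rewrite /energy_of a_axpy// quartic_axpy// /descent_cst.
have C0 := quartic_cst_gt0; have ap0 := a_ge0 Hp; have au0 := a_ge0 Hu.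
have le1 (x y : R) : 0 <= y -> x ^+ 2 <= y ^+ 2 -> `|x| <= y.
  by move=> y0; rewrite -(real_normK (num_real x)) ler_pXn2r ?nnegrE.
have k1 : q u u p p <= C * (a u u * a p p).
  apply: (le_trans (ler_norm _)); apply: le1; first by rewrite !mulr_ge0// ltW.
  by apply: (le_trans (quartic_form_le Hu Hu Hp Hp)); rewrite le_eqVlt; apply/orP; left; apply/eqP; ring.
have k2 : q u p u p <= C * (a u u * a p p).
  apply: (le_trans (ler_norm _)); apply: le1; first by rewrite !mulr_ge0// ltW.
  by apply: (le_trans (quartic_form_le Hu Hp Hu Hp)); rewrite le_eqVlt; apply/orP; left; apply/eqP; ring.
have k3 : `|q u p p p| <= C * ((a u u + a p p) / 2 * a p p).
  apply: le1.
    by apply: mulr_ge0; [exact: ltW|apply: mulr_ge0 => //; apply: divr_ge0 => //; exact: addr_ge0].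
  apply: (le_trans (quartic_form_le Hu Hp Hp Hp)).
  rewrite exprMn; apply: ler_wpM2l; first exact: sqr_ge0.
  have -> : a u u * a p p * (a p p * a p p) = (a u u * a p p) * a p p ^+ 2 by ring.
  rewrite exprMn; apply: ler_wpM2r; first exact: sqr_ge0.
  by have := sqr_ge0 (a u u - a p p); nra.
have k4 := quartic_le Hp.
have t20 := sqr_ge0 t.
have t21 : t ^+ 2 <= 1 by nra.
have K3 : t ^+ 3 * q u p p p <= t ^+ 2 * (C * ((a u u + a p p) / 2 * a p p)).
  rewrite exprSr -mulrA; apply: ler_wpM2l => //.
  apply: (le_trans (ler_norm _)); rewrite normrM.
  apply: le_trans k3; rewrite -[leRHS]mul1r; apply: ler_wpM2r => //.
  by rewrite ler_norml t1.
have K4 : t ^+ 4 * q p p p p <= t ^+ 2 * (C * a p p ^+ 2).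
  apply: ler_pM => //; [exact: exprn_even_ge0|exact: q_ge0|].
  by rewrite (exprD _ 2 2) -[leRHS]mulr1; apply: ler_wpM2l.
have K1 := ler_wpM2l t20 k1; have K2 := ler_wpM2l t20 k2.
have b4 : 0 <= beta / 4 by rewrite divr_ge0.
have S : t ^+ 2 * (2 * q u u p p + 4 * q u p u p) + 4 * t ^+ 3 * q u p p p + t ^+ 4 * q p p p p
    <= t ^+ 2 * a p p * (C * (8 * a u u + 3 * a p p)).
  move: K1 K2 K3 K4; move: (q u u p p) (q u p u p) (q u p p p) (q p p p p) (t ^+ 3) (t ^+ 4) (t ^+ 2) => *.
  lra.
have {}S := ler_wpM2l b4 S.
move: S; move: (q u u p p) (q u p u p) (q u p p p) (q p p p p) (t ^+ 3) (t ^+ 4) (t ^+ 2) => *.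
lra.
Qed.

Definition gradient_bound (x : R) := 2 * x + 2 * beta ^+ 2 * C ^+ 2 * x ^+ 3.

Lemma gradient_cst_ge0 : 0 <= 2 * beta ^+ 2 * C ^+ 2.
Proof. by apply: mulr_ge0 (sqr_ge0 _); apply: mulr_ge0 => //; exact: sqr_ge0. Qed.

Lemma gradient_bound_ge0 (x : R) : 0 <= x -> 0 <= gradient_bound x.
Proof.
move=> x0; apply: addr_ge0; first exact: mulr_ge0.
by apply: mulr_ge0; [exact: gradient_cst_ge0|exact: exprn_ge0].
Qed.

(** The right-hand side of the identity is linear in [p]: squaring and dividing by a p p leaves a
    bound in [u] alone. Since [a] is only semidefinite here, a p p = 0 is treated apart. *)
Lemma gradient_le u p : H u -> H p -> a p p = a u p + beta * q u u u p ->
  a p p <= gradient_bound (a u u).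
Proof.
move=> Hu Hp E; have ap0 := a_ge0 Hp; have au0 := a_ge0 Hu.
have Q := quartic_form_le Hu Hu Hu Hp; have A := a_cauchy_schwarz Hu Hp.
have [ap|ap] := eqVneq (a p p) 0.
  by rewrite ap gradient_bound_ge0.
have {}ap0 : 0 < a p p by rewrite lt_def ap.
rewrite -(ler_pM2r ap0) -expr2.
apply: (@le_trans _ _ (2 * a u p ^+ 2 + 2 * beta ^+ 2 * q u u u p ^+ 2)).
  by rewrite E -mulrA -exprMn; have := sqr_ge0 (a u p - beta * q u u u p); nra.
have B : 0 <= 2 * beta ^+ 2 by rewrite mulr_ge0 ?sqr_ge0.
have {}Q := ler_wpM2l B Q.
rewrite /gradient_bound [leRHS]mulrDl.
apply: lerD; first by rewrite -mulrA ler_pM2l.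
by apply: (le_trans Q); rewrite le_eqVlt; apply/orP; left; apply/eqP; ring.
Qed.

Lemma gradient_bound_le (x y : R) : 0 <= x <= y -> gradient_bound x <= gradient_bound y.
Proof.
move=> /andP[x0 xy]; apply: lerD; first by rewrite ler_pM2l.
apply: ler_wpM2l; first exact: gradient_cst_ge0.
by rewrite lerXn2r ?nnegrE// (le_trans x0).
Qed.

(** A bound of [descent_cst] on the sublevel set F0 of the energy, where a u u <= 2 F0. *)
Definition step_cst (F0 : R) := descent_cst (2 * F0) (gradient_bound (2 * F0)).

Lemma descent_cst_ge (x y : R) : 0 <= x -> 0 <= y -> 2^-1 <= descent_cst x y.
Proof.
move=> x0 y0; have C0 := ltW quartic_cst_gt0.
by rewrite lerDl !mulr_ge0 ?divr_ge0 ?addr_ge0 ?mulr_ge0.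
Qed.

Lemma step_cst_gt0 F0 : 0 <= F0 -> 0 < step_cst F0.
Proof.
move=> F00; have x0 : 0 <= 2 * F0 by rewrite mulr_ge0.
have := descent_cst_ge x0 (gradient_bound_ge0 x0).
by apply: lt_le_trans; rewrite invr_gt0.
Qed.

Lemma energy_of_scal c u : H u -> 0 <= c <= 1 -> energy_of (scal c u) <= energy_of u.
Proof.
move=> Hu /andP[c0 c1]; have Hc := HZ c Hu.
have c2 : c ^+ 2 <= 1 by rewrite exprn_ile1.
have c4 : c ^+ 4 <= 1 by rewrite exprn_ile1.
have Ea : a (scal c u) (scal c u) = c ^+ 2 * a u u.
  by rewrite aZ// (aC Hc Hu) aZ// mulrA.
have Eq : q (scal c u) (scal c u) (scal c u) (scal c u) = c ^+ 4 * q u u u u.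
  rewrite qZ// (qC u) qZ// qCA qZ// (qC u) qZ//; ring.
rewrite /energy_of Ea Eq; apply: lerD.
  by rewrite ler_pM2r ?invr_gt0// -[leRHS]mul1r; apply: ler_wpM2r => //; exact: a_ge0.
apply: ler_wpM2l; first by rewrite divr_ge0.
by rewrite -[leRHS]mul1r; apply: ler_wpM2r => //; exact: q_ge0.
Qed.

(** With t at most 1 / (2 step_cst F0), the second-order term consumes at most half of the
    first-order decrease t a p p. *)
Lemma descent_step u p F0 t : H u -> H p -> b u u = 1 -> b u p = 0 ->
  a p p = a u p + beta * q u u u p -> energy_of u <= F0 -> 0 < t <= 1 ->
  t <= (2 * step_cst F0)^-1 ->
  let v := axpy (- t) u p in
  let u' := scal (Num.sqrt (b v v))^-1 v in
  [/\ H u', b u' u' = 1 & t / 2 * a p p <= energy_of u - energy_of u'].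
Proof.
move=> Hu Hp b1 b0 E uF /andP[t0 t1] tc v u'; have Hv : H v by exact: H_axpy.
have bv : b v v = 1 + t ^+ 2 * b p p by rewrite /v b_axpy// b1 b0; ring.
have bv1 : 1 <= b v v by rewrite bv lerDl mulr_ge0 ?sqr_ge0 ?b_ge0.
have s1 : 1 <= Num.sqrt (b v v) by rewrite -[leLHS]sqrtr1 ler_wsqrtr.
have s0 : 0 < Num.sqrt (b v v) by rewrite (lt_le_trans ltr01).
have c1 : 0 <= (Num.sqrt (b v v))^-1 <= 1 by rewrite invr_ge0 ltW//= invf_le1.
have Hu' : H u' by exact: HZ.
split => //.
  rewrite /u' bZ// (bC Hu' Hv) bZ// mulrA -expr2 exprVn sqr_sqrtr ?mulVf//.
    by rewrite gt_eqF// (lt_le_trans ltr01).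
  by rewrite (le_trans ler01).
have au0 := a_ge0 Hu; have ap0 := a_ge0 Hp.
have F00 : 0 <= F0 by apply: le_trans uF; exact: energy_of_ge0.
have auF : a u u <= 2 * F0 by have := energy_of_ge Hu; lra.
have apF : a p p <= gradient_bound (2 * F0).
  by apply: (le_trans (gradient_le Hu Hp E)); apply: gradient_bound_le; rewrite au0.
have dS : descent_cst (a u u) (a p p) <= step_cst F0.
  rewrite lerD2l; apply: ler_wpM2l; first by rewrite divr_ge0.
  apply: ler_wpM2l; first exact: ltW quartic_cst_gt0.
  by apply: lerD; rewrite ler_pM2l.
have S0 := step_cst_gt0 F00.
have tS : t * step_cst F0 <= 2^-1.
  by move: tc; rewrite -ler_pdivlMr// -invfM mulrC.
have := energy_of_scal Hv c1; rewrite -/u'.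
have t11 : -1 <= - t <= 1 by rewrite lerN2 t1 lerNl (le_trans _ (ltW t0))// lerN10.
have := energy_axpy_le Hu Hp t11; rewrite -/v -E sqrrN.
have X : t ^+ 2 * a p p * descent_cst (a u u) (a p p) <= t * a p p * 2^-1.
  have -> : t ^+ 2 * a p p * descent_cst (a u u) (a p p) =
    t * a p p * (t * descent_cst (a u u) (a p p)) by ring.
  apply: ler_wpM2l; first by rewrite mulr_ge0// ltW.
  by apply: le_trans tS; apply: ler_wpM2l => //; exact: ltW.
move: X; move: (energy_of u) (energy_of v) (energy_of u') (t ^+ 2 * _ * _) => e ev eu' z; lra.
Qed.

Section iteration.
Variables (u p : nat -> T) (t : nat -> R) (tmin F0 : R).
Hypothesis Hp : forall n, H (p n).
Hypothesis Hu0 : H (u 0%N).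
Hypothesis b0 : b (u 0%N) (u 0%N) = 1.
Hypothesis F0u : energy_of (u 0%N) <= F0.
Hypothesis tmin0 : 0 < tmin.
Hypothesis tmin_le : forall n, tmin <= t n.
Hypothesis t_le : forall n, t n <= Num.min 1 (2 * step_cst F0)^-1.
Hypothesis p_tangent : forall n, H (u n) -> b (u n) (u n) = 1 -> b (u n) (p n) = 0.
Hypothesis p_gradient : forall n, H (u n) -> b (u n) (u n) = 1 ->
  a (p n) (p n) = a (u n) (p n) + beta * q (u n) (u n) (u n) (p n).
Hypothesis uS : forall n, H (u n) -> u n.+1 =
  scal (Num.sqrt (b (axpy (- t n) (u n) (p n)) (axpy (- t n) (u n) (p n))))^-1
    (axpy (- t n) (u n) (p n)).

(** A joint induction: the decrease at [n] needs the first three properties, and the energy bound at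
    n + 1, which keeps the step admissible, needs the decrease. *)
Lemma iteration_invariant n : [/\ H (u n), b (u n) (u n) = 1, energy_of (u n) <= F0 &
  t n / 2 * a (p n) (p n) <= energy_of (u n) - energy_of (u n.+1)].
Proof.
have step k : H (u k) -> b (u k) (u k) = 1 -> energy_of (u k) <= F0 ->
    [/\ H (u k.+1), b (u k.+1) (u k.+1) = 1 &
      t k / 2 * a (p k) (p k) <= energy_of (u k) - energy_of (u k.+1)].
  move=> Hk bk Fk; rewrite uS//; have := t_le k; rewrite le_min => /andP[t1 tc].
  have t01 : 0 < t k <= 1 by rewrite (lt_le_trans tmin0 (tmin_le k)).
  exact: (descent_step Hk (Hp k) bk (p_tangent Hk bk) (p_gradient Hk bk) Fk t01 tc).
have inv : [/\ H (u n), b (u n) (u n) = 1 & energy_of (u n) <= F0].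
  elim: n => [//|n [Hn bn Fn]]; have [Hn1 bn1 dn] := step _ Hn bn Fn; split => //.
  have : 0 <= t n / 2 * a (p n) (p n).
    apply: mulr_ge0; last exact: a_ge0.
    by rewrite divr_ge0// (le_trans (ltW tmin0)).
  lra.
by have [Hn bn Fn] := inv; have [_ _ dn] := step _ Hn bn Fn.
Qed.

Lemma iteration_gradient_cvg0 : a (p n) (p n) @[n --> \oo] --> (0 : R).
Proof.
have t2 : 0 < tmin / 2 by rewrite divr_gt0.
have key : tmin / 2 * a (p n) (p n) @[n --> \oo] --> (0 : R).
  apply: (@cvg_decrements _ (fun n => energy_of (u n))) => n.
  - by apply: mulr_ge0; [exact: ltW|exact: a_ge0].
  - by have [Hn _ _ _] := iteration_invariant n; exact: energy_of_ge0.
  - have [_ _ _] := iteration_invariant n; apply: le_trans.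
    by apply: ler_wpM2r; [exact: a_ge0|rewrite ler_pM2r ?invr_gt0].
have -> : (fun n => a (p n) (p n)) = fun n => (tmin / 2)^-1 * (tmin / 2 * a (p n) (p n)).
  by apply/funext => n; rewrite mulKf// gt_eqF.
by rewrite -[X in _ --> X](mulr0 (tmin / 2)^-1); apply: cvgM key; exact: cvg_cst.
Qed.

End iteration.

(** * Weak limits of the iterates *)

Section weak_limit.
Variables (u p : nat -> T) (gamma : nat -> R) (us : T) (A : R).
Hypothesis Hu : forall n, H (u n).
Hypothesis Hp : forall n, H (p n).
Hypothesis Hus : H us.
Hypothesis bu : forall n, b (u n) (u n) = 1.
Hypothesis uA : forall n, a (u n) (u n) <= A.
Hypothesis p_gradient : forall n h, H h ->
  a (p n) h = a (u n) h + beta * q (u n) (u n) (u n) h - gamma n * b (u n) h.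
Hypothesis p_cvg0 : a (p n) (p n) @[n --> \oo] --> (0 : R).
Hypothesis u_weak : forall h, H h -> a h (u n) @[n --> \oo] --> a h us.
Let e n := axpy (-1) (u n) us.
Hypothesis e_cvg0 : b (e n) (e n) @[n --> \oo] --> (0 : R).

Let He n : H (e n). Proof. exact: H_axpy. Qed.
Let A0 : 0 <= A. Proof. exact: le_trans (a_ge0 (Hu 0%N)) (uA 0%N). Qed.

Lemma error_le n : a (e n) (e n) <= 2 * A + 2 * a us us.
Proof.
rewrite /e a_axpy//; have := a_ge0 (H_axpy 1 (Hu n) Hus); rewrite a_axpy//.
by have := uA n; lra.
Qed.

(** In q^2 <= Cq b a^3 the factor a stays bounded while b tends to 0. *)
Lemma quartic_error_cvg0 : q (e n) (e n) (e n) (e n) @[n --> \oo] --> (0 : R).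
Proof.
set B := 2 * A + 2 * a us us.
have B0 : 0 <= B by rewrite addr_ge0// mulr_ge0// a_ge0.
apply: (@cvg0_sqr _ _ (fun n => Cq * B ^+ 3 * b (e n) (e n))).
  move=> n; apply: (le_trans (q4_le (He n))).
  rewrite -mulrA; apply: ler_wpM2l => //; rewrite mulrC.
  apply: ler_wpM2r; first exact: b_ge0.
  by rewrite lerXn2r ?nnegrE ?a_ge0//; exact: error_le.
by rewrite -[X in _ --> X](mulr0 (Cq * B ^+ 3)); apply: cvgM e_cvg0; exact: cvg_cst.
Qed.

(** One small argument suffices: [q_le] bounds the fourth power by a constant times the quartic term
    of the error, and two uses of [cvg0_sqr] remove the power. *)
Lemma quartic_form_error_cvg0 (x y z : nat -> T) (B : R) :
  (forall n, H (x n) /\ a (x n) (x n) <= B) -> (forall n, H (y n) /\ a (y n) (y n) <= B) ->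
  (forall n, H (z n) /\ a (z n) (z n) <= B) ->
  q (e n) (x n) (y n) (z n) @[n --> \oo] --> (0 : R).
Proof.
move=> Hx Hy Hz; have C0 := ltW quartic_cst_gt0.
have QB w : H w /\ a w w <= B -> H w /\ q w w w w <= C * B ^+ 2.
  move=> [Hw wB]; split=> //; apply: (le_trans (quartic_le Hw)); apply: ler_wpM2l => //.
  by rewrite lerXn2r ?nnegrE ?a_ge0// (le_trans (a_ge0 Hw)).
have D0 : 0 <= C * B ^+ 2 by rewrite mulr_ge0// sqr_ge0.
set M := C * B ^+ 2 in QB D0.
apply: (@cvg0_sqr _ _ (fun n => q (e n) (x n) (y n) (z n) ^+ 2)) => //.
apply: (@cvg0_sqr _ _ (fun n => M * (M * M) * q (e n) (e n) (e n) (e n))).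
  move=> n; have [Hxn qx] := QB _ (Hx n); have [Hyn qy] := QB _ (Hy n).
  have [Hzn qz] := QB _ (Hz n).
  rewrite -exprM; apply: (le_trans (q_le (He n) Hxn Hyn Hzn)).
  rewrite [leRHS]mulrC [leRHS]mulrA; apply: ler_pM.
  - by rewrite mulr_ge0 ?q_ge0.
  - by rewrite mulr_ge0 ?q_ge0.
  - by apply: ler_wpM2l; rewrite ?q_ge0.
  - by apply: ler_pM; rewrite ?q_ge0.
rewrite -[X in _ --> X](mulr0 (M * (M * M))); apply: cvgM quartic_error_cvg0; exact: cvg_cst.
Qed.

(* The difference telescopes into three terms linear in the error [e n]. *)
Lemma quartic_derivative_cvg (h : nat -> T) (B : R) :
  (forall n, H (h n) /\ a (h n) (h n) <= B) ->
  q (u n) (u n) (u n) (h n) - q us us us (h n) @[n --> \oo] --> (0 : R).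
Proof.
move=> Hh; pose B' := A + a us us + B.
have B0 : 0 <= B by have [Hn] := Hh 0%N; apply: le_trans; exact: a_ge0.
have us0 := a_ge0 Hus.
have bu' n : H (u n) /\ a (u n) (u n) <= B' by split=> //; have := uA n; rewrite /B'; lra.
have bs (n : nat) : H us /\ a us us <= B' by split=> //; rewrite /B'; have := A0; lra.
have bh n : H (h n) /\ a (h n) (h n) <= B'.
  have [Hn hB] := Hh n; split=> //; apply: (le_trans hB).
  by rewrite /B' lerDr; apply: addr_ge0; [exact: A0|exact: us0].
have c1 := quartic_form_error_cvg0 bu' bu' bh.
have c2 := quartic_form_error_cvg0 bs bu' bh.
have c3 := quartic_form_error_cvg0 bh bs bs.
have c : q (e n) (u n) (u n) (h n) + q (e n) us (u n) (h n) + q (e n) (h n) us us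
    @[n --> \oo] --> (0 + 0 + 0 : R) by apply: cvgD c3; exact: cvgD c1 c2.
rewrite !addr0 in c.
have -> : (fun n => q (u n) (u n) (u n) (h n) - q us us us (h n)) = fun n =>
    q (e n) (u n) (u n) (h n) + q (e n) us (u n) (h n) + q (e n) (h n) us us.
  apply/funext => n; have [Hn _] := Hh n; have Hun := Hu n.
  rewrite /e (q_axpy1 (-1) Hun Hus Hun Hun Hn) (q_axpy1 (-1) Hun Hus Hus Hun Hn).
  rewrite (q_axpy1 (-1) Hun Hus Hn Hus Hus).
  rewrite (qC (u n) us) (qCA (u n) (h n) us us) (qCA us (h n) us us); ring.
exact: c.
Qed.

Lemma b_weak_cvg h : H h -> b (u n) h @[n --> \oo] --> b us h.
Proof.
move=> Hh; have c : b (e n) h @[n --> \oo] --> (0 : R).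
  apply: (@cvg0_sqr _ _ (fun n => b h h * b (e n) (e n))).
    by move=> n; rewrite mulrC; exact: b_cauchy_schwarz.
  by rewrite -[X in _ --> X](mulr0 (b h h)); apply: cvgM e_cvg0; exact: cvg_cst.
have -> : (fun n => b (u n) h) = fun n => b (e n) h + b us h.
  by apply/funext => n; rewrite (bC (He n) Hh) b_axpyr// (bC Hh (Hu n)) (bC Hh Hus); ring.
by rewrite -[X in _ --> X]add0r; apply: cvgD c _; exact: cvg_cst.
Qed.

Lemma b_weak_limit : b us us = 1.
Proof.
have c1 := b_weak_cvg Hus.
have c2 : 1 + 2 * -1 * b (u n) us + (-1) ^+ 2 * b us us @[n --> \oo] -->
    1 + 2 * -1 * b us us + (-1) ^+ 2 * b us us.
  apply: cvgD; last exact: cvg_cst.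
  by apply: cvgD; [exact: cvg_cst|apply: cvgM c1; exact: cvg_cst].
have E : (fun n => 1 + 2 * -1 * b (u n) us + (-1) ^+ 2 * b us us) = fun n => b (e n) (e n).
  by apply/funext => n; rewrite b_axpy// bu.
rewrite E in c2; have Hx : 1 + 2 * -1 * b us us + (-1) ^+ 2 * b us us = 0 :=
  cvg_unique (@Rhausdorff R) c2 e_cvg0.
by rewrite (_ : _ + _ = 1 - b us us) in Hx; [apply/eqP; rewrite eq_sym -subr_eq0 Hx|ring].
Qed.

Let dEn n h := a (u n) h + beta * q (u n) (u n) (u n) h.
Let lambda := a us us + beta * q us us us us.

Lemma a_weak_cvg h : H h -> a (u n) h @[n --> \oo] --> a us h.
Proof.
move=> Hh; rewrite (aC Hus Hh); have := u_weak Hh.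
by have -> : (fun n => a h (u n)) = fun n => a (u n) h by apply/funext => n; exact: aC.
Qed.

Lemma gradient_bounded_cvg0 (h : nat -> T) B :
  (forall n, H (h n) /\ a (h n) (h n) <= B) -> a (p n) (h n) @[n --> \oo] --> (0 : R).
Proof.
move=> Hh; apply: (@cvg0_sqr _ _ (fun n => B * a (p n) (p n))).
  move=> n; have [Hn hB] := Hh n; apply: (le_trans (a_cauchy_schwarz (Hp n) Hn)).
  by rewrite mulrC; apply: ler_wpM2r => //; exact: a_ge0.
by rewrite -[X in _ --> X](mulr0 B); apply: cvgM p_cvg0; exact: cvg_cst.
Qed.

Lemma dEn_cvg h : H h -> dEn n h @[n --> \oo] --> a us h + beta * q us us us h.
Proof.
move=> Hh; have cq := quartic_derivative_cvg (h := fun=> h) (fun n => conj Hh (lexx _)).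
have -> : (fun n => dEn n h) = fun n => a (u n) h +
    beta * ((q (u n) (u n) (u n) h - q us us us h) + q us us us h).
  by apply/funext => n; rewrite /dEn subrK.
apply: cvgD (a_weak_cvg Hh) _; apply: cvgM; first exact: cvg_cst.
by rewrite -[X in _ --> X]add0r; apply: cvgD cq _; exact: cvg_cst.
Qed.

(** The test function is [us] because the limit of a (u n) (u n) is still unknown. Since b (u n) us
    tends to 1, the identity can eventually be solved for [gamma n]. *)
Lemma multiplier_cvg : gamma n @[n --> \oo] --> lambda.
Proof.
have c0 := gradient_bounded_cvg0 (h := fun=> us) (fun n => conj Hus (lexx _)).
have c1 := dEn_cvg Hus; have c2 := b_weak_cvg Hus; rewrite b_weak_limit in c2.
have c3 : (dEn n us - a (p n) us) / b (u n) us @[n --> \oo] --> (lambda - 0) / 1.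
  by apply: cvgM; [exact: cvgB|apply: cvgV => //; exact: oner_neq0].
rewrite subr0 divr1 in c3; apply: cvg_trans c3; apply: near_eq_cvg.
have : \forall n \near \oo, b (u n) us != 0.
  have /cvgrPdist_lt /(_ _ ltr01) := c2; apply: filterS => n.
  by apply: contraTneq => ->; rewrite subr0 normr1 ltxx.
apply: filterS => n b_neq0; rewrite p_gradient//.
by rewrite /dEn opprB addrC subrK mulfK.
Qed.

Lemma weak_limit_stationary h : H h ->
  a us h + beta * q us us us h = lambda * b us h.
Proof.
move=> Hh; apply/eqP; rewrite -subr_eq0; apply/eqP.
have c0 := gradient_bounded_cvg0 (h := fun=> h) (fun n => conj Hh (lexx _)).
have c : dEn n h - gamma n * b (u n) h @[n --> \oo] -->
    a us h + beta * q us us us h - lambda * b us h.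
  by apply: cvgB (dEn_cvg Hh) _; exact: cvgM multiplier_cvg (b_weak_cvg Hh).
have E : (fun n => dEn n h - gamma n * b (u n) h) = fun n => a (p n) h.
  by apply/funext => n; rewrite p_gradient.
by rewrite E in c; exact: (cvg_unique (@Rhausdorff R) c c0).
Qed.

Lemma weak_limit_strong : a (e n) (e n) @[n --> \oo] --> (0 : R).
Proof.
have c0 := gradient_bounded_cvg0 (fun n => conj (Hu n) (uA n)).
have c1 := quartic_derivative_cvg (fun n => conj (Hu n) (uA n)).
have c2 : q us us us (u n) - q us us us us @[n --> \oo] --> (0 : R).
  have := quartic_form_error_cvg0 (B := a us us) (fun n => conj Hus (lexx _))
    (fun n => conj Hus (lexx _)) (fun n => conj Hus (lexx _)).
  have -> // : (fun n => q (e n) us us us) = fun n => q us us us (u n) - q us us us us.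
  apply/funext => n; rewrite (q_axpy1 (-1) (Hu n) Hus Hus Hus Hus).
  by rewrite (qCA us us us (u n)) (qC us (u n)); ring.
have c3 := a_weak_cvg Hus.
(* [F n] is a (e n) (e n) with a (u n) (u n) eliminated by the gradient identity tested with [u n],
   where b (u n) (u n) = 1. Every term now has a known limit, and the limits cancel by the
   definition of [lambda]. *)
pose F n := a (p n) (u n) + gamma n - beta * ((q (u n) (u n) (u n) (u n) - q us us us (u n)) +
  (q us us us (u n) - q us us us us) + q us us us us) + 2 * -1 * a (u n) us + (-1) ^+ 2 * a us us.
have cF : F n @[n --> \oo] -->
    0 + lambda - beta * (0 + 0 + q us us us us) + 2 * -1 * a us us + (-1) ^+ 2 * a us us.
  apply: cvgD; last exact: cvg_cst.
  apply: cvgD; last by apply: cvgM c3; exact: cvg_cst.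
  apply: cvgB; first exact: cvgD c0 multiplier_cvg.
  apply: cvgM; first exact: cvg_cst.
  by apply: cvgD; [exact: cvgD c1 c2|exact: cvg_cst].
have -> : (fun n => a (e n) (e n)) = F.
  apply/funext => n; rewrite a_axpy// /F p_gradient// bu; ring.
suff E0 : 0 + lambda - beta * (0 + 0 + q us us us us) + 2 * -1 * a us us +
  (-1) ^+ 2 * a us us = 0 by rewrite E0 in cF.
by rewrite /lambda; ring.
Qed.

End weak_limit.

Lemma gradient_descent_convergence (x0 : R) : 0 <= x0 ->
  exists2 Calpha : R, 0 < Calpha <= 1 &
    forall (u p : nat -> T) (gamma t : nat -> R) (tmin : R),
    H (u 0%N) -> b (u 0%N) (u 0%N) = 1 -> a (u 0%N) (u 0%N) <= x0 ->
    0 < tmin -> (forall n, tmin <= t n <= Calpha) -> (forall n, H (p n)) ->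
    (forall n, H (u n) -> b (u n) (u n) = 1 -> b (u n) (p n) = 0) ->
    (forall n, H (u n) -> forall h, H h ->
      a (p n) h = a (u n) h + beta * q (u n) (u n) (u n) h - gamma n * b (u n) h) ->
    (forall n, H (u n) -> u n.+1 =
      scal (Num.sqrt (b (axpy (- t n) (u n) (p n)) (axpy (- t n) (u n) (p n))))^-1
        (axpy (- t n) (u n) (p n))) ->
    [/\ forall n, H (u n), forall n, b (u n) (u n) = 1,
      exists A, forall n, a (u n) (u n) <= A &
      forall (s : nat -> nat) us, {homo s : m n / (m < n)%N} -> H us ->
        (forall h, H h -> a h (u (s n)) @[n --> \oo] --> a h us) ->
        b (axpy (-1) (u (s n)) us) (axpy (-1) (u (s n)) us) @[n --> \oo] --> (0 : R) ->
        [/\ b us us = 1,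
          exists lambda, forall h, H h -> a us h + beta * q us us us h = lambda * b us h &
          a (axpy (-1) (u (s n)) us) (axpy (-1) (u (s n)) us) @[n --> \oo] --> (0 : R)]].
Proof.
move=> x00; have C0 := ltW quartic_cst_gt0.
(* By [quartic_le], a bound of the energy of any initial point with a u u <= x0; the step bound thus
   precedes the choice of the sequence. *)
pose F0 := x0 / 2 + beta / 4 * (C * x0 ^+ 2).
have F00 : 0 <= F0.
  by apply: addr_ge0; [exact: divr_ge0|rewrite !mulr_ge0 ?invr_ge0 ?sqr_ge0].
have S0 := step_cst_gt0 F00.
exists (Num.min 1 (2 * step_cst F0)^-1).
  by rewrite lt_min ltr01 invr_gt0 mulr_gt0//= ge_min lexx.
move=> u p gamma t tmin Hu0 b0 ax tmin0 tC Hp tang grad uS.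
have Fu0 : energy_of (u 0%N) <= F0.
  apply: lerD; first by rewrite ler_pM2r ?invr_gt0.
  apply: ler_wpM2l; first by rewrite divr_ge0.
  apply: (le_trans (quartic_le Hu0)); apply: ler_wpM2l => //.
  by rewrite lerXn2r ?nnegrE ?a_ge0.
have tm n : tmin <= t n by have /andP[] := tC n.
have tM n : t n <= Num.min 1 (2 * step_cst F0)^-1 by have /andP[] := tC n.
have grad' n : H (u n) -> b (u n) (u n) = 1 ->
    a (p n) (p n) = a (u n) (p n) + beta * q (u n) (u n) (u n) (p n).
  by move=> Hn bn; rewrite grad// tang// mulr0 subr0.
have inv := iteration_invariant Hp Hu0 b0 Fu0 tmin0 tm tM tang grad' uS.
have p0 := iteration_gradient_cvg0 Hp Hu0 b0 Fu0 tmin0 tm tM tang grad' uS.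
have Hu n : H (u n) by case: (inv n).
have bu n : b (u n) (u n) = 1 by case: (inv n).
have uA n : a (u n) (u n) <= 2 * F0.
  have [_ _ Fn _] := inv n; have := energy_of_ge (Hu n).
  move: (a _ _) (energy_of _) Fn => x y Fn H1.
  by rewrite mulrC -ler_pdivrMr// (le_trans H1).
split=> //; first by exists (2 * F0).
move=> s us hs Hus ws es; have grads n h (Hh : H h) := grad (s n) (Hu (s n)) h Hh.
have p0s := cvg_subsequence hs p0.
have Hus' n := Hu (s n); have Hps n := Hp (s n); have bs n := bu (s n).
have uAs n := uA (s n); split.
- exact: (b_weak_limit Hus' Hus bs es).
- eexists => h Hh; exact: (weak_limit_stationary Hus' Hps Hus bs uAs grads p0s ws es).
- exact: (weak_limit_strong Hus' Hps Hus bs uAs grads p0s ws es).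
Qed.

End hilbert_quartic.

(** * Weak convergence *)

Lemma norm_le_sqrtM (R : rcfType) (x c N : R) : 0 <= c -> 0 <= N ->
  x ^+ 2 <= c * N ^+ 2 -> `|x| <= Num.sqrt c * N.
Proof.
move=> c0 N0 H; have EN : N = Num.sqrt (N ^+ 2) by rewrite sqrtr_sqr ger0_norm.
rewrite [X in _ * X]EN -(sqrtrM _ c0) -sqrtr_sqr.
exact: ler_wsqrtr.
Qed.

Lemma sqrt_sqrD_le (R : rcfType) (x y : R) :
  Num.sqrt (x ^+ 2 + y ^+ 2) <= `|x| + `|y|.
Proof.
rewrite -[leRHS]ger0_norm ?addr_ge0// -(sqrtr_sqr (`|x| + `|y|)) ler_wsqrtr//.
rewrite -(real_normK (num_real x)) -(real_normK (num_real y)).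
by have := mulr_ge0 (normr_ge0 x) (normr_ge0 y); nra.
Qed.

Section weak_convergence.
Local Open Scope complex_scope.
Context {R : realType} {n : nat}.
Variables (D : set 'rV[R]_n.+1) (L : R).
Hypothesis oD : open D.
Hypothesis DL : forall r, D r -> forall j, `|r ord0 j| < L.
Local Opaque rdot wpartial gdot.
Local Notation rdot := (rdot D).
Local Notation gdot := (gdot D).
Local Notation H1 := (H1 D).
Local Notation H01 := (H01 D).
Implicit Types (u v w phi : 'rV[R]_n.+1 -> R[i]) (f : ('rV[R]_n.+1 -> R[i]) -> R).

Lemma gdot_mulNi u : H1 u -> gdot (fun r => - 'i * u r) (fun r => - 'i * u r) = gdot u u.
Proof.
move=> Hu; rewrite !gdotE; apply: eq_bigr => i _.
have Lw := wpartial_L2 i Hu; have ae := wpartialZ oD DL i (- 'i) Hu.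
have Lw' := wpartial_L2 i (H1Z oD DL (- 'i) Hu).
rewrite -(rdot_mulNi2 oD Lw Lw).
exact: (rdot_ae oD ae ae Lw' Lw' (L2Z oD _ Lw) (L2Z oD _ Lw)).
Qed.

Lemma H01_mulNi u : H01 u -> H01 (fun r => - 'i * u r).
Proof.
move=> Hu; have H1u := H01_H1 Hu.
apply: (H01_from_dense oD DL (H1Z oD DL _ H1u)) => e e0.
have [phi tphi de] := H01_dense oD DL Hu e0.
exists (fun r => - 'i * phi r); first exact: test_functionZ.
have Hd := H1B oD DL H1u (test_H1 oD DL tphi); have Ld := H1_L2 Hd.
have -> : (fun r => - 'i * u r - - 'i * phi r) = fun r => - 'i * (u r - phi r).
  by apply/funext => r; rewrite mulrBr.
by rewrite (gdot_mulNi Hd) (rdot_mulNi2 oD Ld Ld).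
Qed.

Definition real_linear f :=
  (forall u v, H01 u -> H01 v -> f (fun r => u r + v r) = f u + f v) /\
  (forall (t : R) u, H01 u -> f (fun r => t%:C * u r) = t * f u).

(* A complex linear functional is determined by its real part. *)
Definition complexified f u : R[i] := f u +i* f (fun r => - 'i * u r).

Lemma complexified_dual f (c : R) : 0 <= c -> real_linear f ->
  (forall u, H01 u -> f u ^+ 2 <= c * gdot u u) -> H01_dual D (complexified f).
Proof.
move=> c0 [fD fZ] fc; split.
- move=> u v Hu Hv; have Ju := H01_mulNi Hu; have Jv := H01_mulNi Hv.
  rewrite /complexified (fD _ _ Hu Hv).
  have -> : (fun r => - 'i * (u r + v r)) = fun r => - 'i * u r + - 'i * v r.
    by apply/funext => r; rewrite mulrDr.
  by rewrite (fD _ _ Ju Jv).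
- move=> [x y] u Hu; have Ju := H01_mulNi Hu.
  have E1 : (fun r => (x +i* y) * u r) = fun r => x%:C * u r + (- y)%:C * (- 'i * u r).
    apply/funext => r; case: (u r) => p q.
    by apply/eqP; rewrite eq_complex /=; apply/andP; split; apply/eqP; ring.
  have E2 : (fun r => - 'i * ((x +i* y) * u r)) = fun r => x%:C * (- 'i * u r) + y%:C * u r.
    apply/funext => r; case: (u r) => p q.
    by apply/eqP; rewrite eq_complex /=; apply/andP; split; apply/eqP; ring.
  have Z t w (Hw : H01 w) := H01Z oD DL t Hw.
  rewrite /complexified E2 E1 (fD _ _ (Z x _ Hu) (Z (- y) _ Ju)) (fD _ _ (Z x _ Ju) (Z y _ Hu)).
  rewrite (fZ x _ Hu) (fZ (- y) _ Ju) (fZ x _ Ju) (fZ y _ Hu).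
  move: (f u) (f (fun r => - 'i * u r)) => p q; apply/eqP; rewrite eq_complex /=; apply/andP; split; apply/eqP; ring.
- exists (2 * Num.sqrt c) => u Hu; have Ju := H01_mulNi Hu.
  have H1u := H01_H1 Hu.
  have N0 : 0 <= H01norm D u by exact: sqrtr_ge0.
  have k1 := fc _ Hu; have k2 := fc _ Ju; rewrite (gdot_mulNi H1u) in k2.
  rewrite -(H01norm_sqr oD H1u) in k1 k2.
  have {}k1 := norm_le_sqrtM c0 N0 k1; have {}k2 := norm_le_sqrtM c0 N0 k2.
  apply: (le_trans (sqrt_sqrD_le _ _)).
  by move: k1 k2; move: (f u) (f (fun r => - 'i * u r)) (H01norm D u) => p q N; lra.
Qed.

Lemma normc_ge_Re (z : R[i]) : `|complex.Re z| <= normc z.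
Proof.
case: z => a b /=; rewrite -sqrtr_sqr ler_wsqrtr//.
by rewrite lerDl sqr_ge0.
Qed.

(** Weak convergence is tested with complex functionals; a real one is the real part of its
    complexification, which is bounded because multiplication by - i preserves the gradient norm. *)
Lemma weak_cvg_real (u : nat -> 'rV[R]_n.+1 -> R[i]) us f (c : R) : 0 <= c ->
  real_linear f -> (forall u, H01 u -> f u ^+ 2 <= c * gdot u u) ->
  weak_cvg_H01 D u us -> f (u k) @[k --> \oo] --> f us.
Proof.
move=> c0 lf fc [_ /(_ _ (complexified_dual c0 lf fc))] /cvgrPdist_lt H.
apply/cvgrPdist_lt => e /H; apply: filterS => k.
rewrite sub0r normrN => /(le_lt_trans (ler_norm _)); apply: le_lt_trans.
by apply: le_trans (normc_ge_Re _); rewrite raddfB /= distrC.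
Qed.

End weak_convergence.

Section strong_convergence.
Local Open Scope complex_scope.
Context {R : realType} {n : nat}.
Variables (D : set 'rV[R]_n.+1) (L : R).
Hypothesis oD : open D.
Hypothesis L0 : 0 <= L.
Hypothesis DL : forall r, D r -> forall j, `|r ord0 j| < L.
Local Notation leb := (lebesgue_measure_rV R n.+1).
Local Notation sqint := (sqint leb D).
Local Notation ip := (ip leb D).
Local Notation rdot := (rdot D).
Local Notation gdot := (gdot D).
Local Notation H01 := (H01 D).
Local Notation average := (average D).
Local Notation "f ^re" := (fun r => complex.Re (f r)) (at level 2, format "f ^re").
Local Notation "f ^im" := (fun r => complex.Im (f r)) (at level 2, format "f ^im").
Implicit Types (u v w phi : 'rV[R]_n.+1 -> R[i]) (f : ('rV[R]_n.+1 -> R[i]) -> R).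

Lemma ip_re_le u : L2 D u -> ip u^re u^re <= rdot u u.
Proof. by move=> Lu; rewrite /rdot lerDl; exact: ip_ge0. Qed.

Lemma ip_im_le u : L2 D u -> ip u^im u^im <= rdot u u.
Proof. by move=> Lu; rewrite /rdot lerDr; exact: ip_ge0. Qed.

Definition re_average h (x : 'rV[R]_n.+1) u := average h u^re x.
Definition im_average h (x : 'rV[R]_n.+1) u := average h u^im x.

Lemma reD u v : (fun r => u r + v r)^re = fun r => u^re r + v^re r.
Proof. by apply/funext => r; rewrite raddfD. Qed.

Lemma imD u v : (fun r => u r + v r)^im = fun r => u^im r + v^im r.
Proof. by apply/funext => r; rewrite raddfD. Qed.

Lemma reZ (t : R) u : (fun r => t%:C * u r)^re = fun r => t * u^re r.
Proof. by apply/funext => r; rewrite complex_ReM /= mul0r subr0. Qed.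

Lemma imZ (t : R) u : (fun r => t%:C * u r)^im = fun r => t * u^im r.
Proof. by apply/funext => r; rewrite complex_ImM /= mul0r addr0. Qed.

Lemma H01_sqint u : H01 u -> sqint u^re /\ sqint u^im.
Proof. by move=> Hu; apply/(L2P oD); exact: H1_L2 (H01_H1 Hu). Qed.

Lemma re_average_linear h x : 0 < h -> real_linear D (re_average h x).
Proof.
move=> h0; split=> [u v Hu Hv|t u Hu]; have [ur _] := H01_sqint Hu.
  have [vr _] := H01_sqint Hv.
  by rewrite /re_average reD; exact: (averageD oD DL h0 x ur vr).
by rewrite /re_average reZ; exact: (averageZ oD DL h0 t x ur).
Qed.

Lemma im_average_linear h x : 0 < h -> real_linear D (im_average h x).
Proof.
move=> h0; split=> [u v Hu Hv|t u Hu]; have [_ ui] := H01_sqint Hu.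
  have [_ vi] := H01_sqint Hv.
  by rewrite /im_average imD; exact: (averageD oD DL h0 x ui vi).
by rewrite /im_average imZ; exact: (averageZ oD DL h0 t x ui).
Qed.

Lemma average_energy_le h x (f : 'rV[R]_n.+1 -> R) u : 0 < h -> sqint f -> H01 u ->
  ip f f <= rdot u u ->
  average h f x ^+ 2 <= average_cst D h * (64 * L ^+ 2) * gdot u u.
Proof.
move=> h0 Lf Hu fu; apply: (le_trans (average_sqr_le oD DL h0 x Lf)).
rewrite -mulrA; apply: ler_wpM2l; first exact: average_cst_ge0.
exact: (le_trans fu (H01_poincare oD L0 DL Hu)).
Qed.

(** The average at a given point of a real or imaginary part is a bounded real functional on H^1_0,
    so weak convergence supplies the pointwise hypotheses of [rellich]. *)
Lemma weak_cvg_L2 (u : nat -> 'rV[R]_n.+1 -> R[i]) us M :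
  (forall k, H01 (u k)) -> (forall k, gdot (u k) (u k) <= M) -> weak_cvg_H01 D u us ->
  rdot (fun r => u k r + (-1)%:C * us r) (fun r => u k r + (-1)%:C * us r)
    @[k --> \oo] --> (0 : R).
Proof.
move=> Hu uM wu; have Hus : H01 us by case: wu.
have Hs := H01Z oD DL (-1) Hus.
have c0 h : 0 <= average_cst D h * (64 * L ^+ 2).
  apply: mulr_ge0; first exact: average_cst_ge0.
  by apply: mulr_ge0; [exact: ler0n|exact: sqr_ge0].
have key f (c : R) : 0 <= c -> real_linear D f ->
    (forall u, H01 u -> f u ^+ 2 <= c * gdot u u) ->
    f (fun r => u k r + (-1)%:C * us r) @[k --> \oo] --> (0 : R).
  move=> c1 lf fc; have w := weak_cvg_real oD DL c1 lf fc wu.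
  have -> : (fun k => f (fun r => u k r + (-1)%:C * us r)) = fun k => f (u k) - f us.
    apply/funext => k; case: lf => fD fZ.
    by rewrite (fD _ _ (Hu k) Hs) (fZ _ _ Hus) mulN1r.
  by rewrite -(subrr (f us)); apply: cvgB w _; exact: cvg_cst.
have Hd k := H01D oD DL (Hu k) Hs.
apply: (rellich oD L0 DL (M := 2 * M + 2 * gdot (fun r => (-1)%:C * us r)
  (fun r => (-1)%:C * us r)) Hd).
- move=> k; apply: (le_trans (gdotD_le oD DL (H01_H1 (Hu k)) (H01_H1 Hs))).
  by rewrite lerD2r ler_pM2l.
- move=> h x h0; apply: (key _ _ (c0 h) (re_average_linear x h0)) => w Hw.
  have [wr _] := H01_sqint Hw.
  exact: (average_energy_le x h0 wr Hw (ip_re_le (H1_L2 (H01_H1 Hw)))).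
- move=> h x h0; apply: (key _ _ (c0 h) (im_average_linear x h0)) => w Hw.
  have [_ wi] := H01_sqint Hw.
  exact: (average_energy_le x h0 wi Hw (ip_im_le (H1_L2 (H01_H1 Hw)))).
Qed.

End strong_convergence.

(** * The a0 scheme *)

Section potential.
Context {R : realType} {n : nat}.
Variables (D : set 'rV[R]_n) (L : R).
Hypothesis DL : forall r, D r -> forall j, `|r ord0 j| < L.
Local Notation leb := (lebesgue_measure_rV R n).

Lemma Linfty_ae_bounded (V : 'rV[R]_n -> R) : Linfty D V ->
  exists2 M, 0 <= M & \forall r \ae leb, D r -> V r <= M.
Proof.
move=> [mV]; rewrite /finite_norm unlock /Lnorm.
case: ifPn => [_ fin|n0 _]; last first.
  (* In a space of measure 0 the norm carries no information, and any bound holds almost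
     everywhere. *)
  exists 0 => //; exists setT; split => //.
  by apply/eqP; rewrite eq_le measure_ge0 andbT leNgt.
have [M HM] := @ess_supr_bounded _ _ _ leb (fun r => `|(V \_ D) r|) fin.
exists (Num.max M 0); first by rewrite le_max lexx orbT.
apply: filterS HM => r; rewrite patchE => H Dr; move: H; rewrite mem_set// => H.
by rewrite le_max (le_trans (ler_norm _) H).
Qed.

(* [V] is bounded and above the trap only almost everywhere; [W] is so everywhere
   on [D]. *)
Lemma bounded_version (V : 'rV[R]_n -> R) (c : R) (i j : 'I_n) : Linfty D V -> 0 <= c ->
  0 <= L ->
  (\forall r \ae leb, D r -> c * (r ord0 i ^+ 2 + r ord0 j ^+ 2) <= V r) ->
  exists (W : 'rV[R]_n -> R) (M : R), [/\ measurable_fun D W, 0 <= M, forall r, D r -> `|W r| <= M,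
    forall r, D r -> c * (r ord0 i ^+ 2 + r ord0 j ^+ 2) <= W r &
    \forall r \ae leb, D r -> V r = W r].
Proof.
move=> LV c0 L0 cV; have [M M0 VM] := Linfty_ae_bounded LV; have [mV _] := LV.
pose trap (r : 'rV[R]_n) := c * (r ord0 i ^+ 2 + r ord0 j ^+ 2) : R.
have trap0 r : 0 <= trap r by rewrite mulr_ge0// addr_ge0// sqr_ge0.
have trapL r : D r -> trap r <= c * (L ^+ 2 + L ^+ 2).
  move=> Dr; apply: ler_wpM2l => //.
  by apply: lerD; rewrite -(real_normK (num_real (r ord0 _))) lerXn2r ?nnegrE// ltW// DL.
have mtrap : measurable_fun D trap.
  apply: measurable_funM; first exact: measurable_cst.
  by apply: measurable_funD; apply: measurable_funX; apply: measurable_funTS; exact: measurable_coor.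
exists (fun r => Num.max (trap r) (Num.min (V r) M)), (c * (L ^+ 2 + L ^+ 2) + M); split.
- apply: measurable_maxr => //; apply: measurable_minr => //; exact: measurable_cst.
- by rewrite addr_ge0// mulr_ge0// addr_ge0// sqr_ge0.
- move=> r Dr; rewrite ger0_norm; last by rewrite le_max trap0.
  rewrite ge_max; apply/andP; split.
    by apply: (le_trans (trapL _ Dr)); rewrite lerDl.
  rewrite ge_min; apply/orP; right; rewrite lerDr.
  by rewrite mulr_ge0// addr_ge0// sqr_ge0.
- by move=> r Dr; rewrite le_max lexx.
- apply: filterS2 VM cV => r VM cV Dr.
  by rewrite (min_idPl (VM Dr)) (max_idPr (cV Dr)).
Qed.

End potential.

Lemma bounded_domain_coor (R : realType) (n : nat) (D : set 'rV[R]_n) : bounded_set D ->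
  exists2 L, 0 <= L & forall r, D r -> forall j, `|r ord0 j| < L.
Proof.
(* [HM] yields the bound M + 1; M + 2 makes it strict, and the maximum with 0 ensures 0 <= L. *)
move=> [M [_ HM]]; exists (Num.max 0 (M + 2)); first by rewrite le_max lexx.
move=> r Dr j; apply: (le_lt_trans (coor_le_norm r j)).
have M1 : M < M + 1 by rewrite ltrDl.
apply: (le_lt_trans (HM _ M1 _ Dr)).
by rewrite lt_max (ltrD2l M) ltr1n orbT.
Qed.

Section rotating_scheme.
Local Open Scope complex_scope.
Context {R : realType} {d : nat}.
Hypothesis dim23 : d.+2 = 2%N \/ d.+2 = 3%N.
Variables (D : set 'rV[R]_d.+2) (L : R).
Hypothesis oD : open D.
Hypothesis L0 : 0 <= L.
Hypothesis DL : forall r, D r -> forall j, `|r ord0 j| < L.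
Variables (V W : 'rV[R]_d.+2 -> R) (M K beta Omega : R).
Hypothesis mV : measurable_fun D V.
Hypothesis mW : measurable_fun D W.
Hypothesis M0 : 0 <= M.
Hypothesis WM : forall r, D r -> `|W r| <= M.
Hypothesis K0 : 0 < K.
Let i0 : 'I_d.+2 := 0.
Let i1 : 'I_d.+2 := 1.
Hypothesis trap : forall r, D r ->
  (1 + K) / 4 * Omega ^+ 2 * (r ord0 i0 ^+ 2 + r ord0 i1 ^+ 2) <= W r.
Hypothesis VW : \forall r \ae lebesgue_measure_rV R d.+2, D r -> V r = W r.
Hypothesis beta0 : 0 <= beta.
Local Opaque rdot gdot wpartial form quad.
Local Notation rdot := (rdot D).
Local Notation gdot := (gdot D).
Local Notation H01 := (H01 D).
Local Notation form := (form D i0 i1 W Omega).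
Local Notation quad := (quad D).
Local Notation T := ('rV[R]_d.+2 -> R[i]).
Implicit Types u v w p h : T.

Let i01 : i0 != i1. Proof. by []. Qed.

Definition vadd u v : T := fun r => u r + v r.
Definition vscal (t : R) u : T := fun r => t%:C * u r.

Let formC u v (Hu : H01 u) (Hv : H01 v) : form u v = form v u :=
  form_sym oD L0 DL i01 W Omega Hu Hv.

Let formD w u v (Hw : H01 w) (Hu : H01 u) (Hv : H01 v) :
    form w (vadd u v) = form w u + form w v :=
  formDr oD DL i0 i1 Omega mW WM (H01_H1 Hu) (H01_H1 Hv) (H01_H1 Hw).

Let formZ w (t : R) u (Hw : H01 w) (Hu : H01 u) : form w (vscal t u) = t * form w u :=
  formZr oD DL i0 i1 Omega mW WM t (H01_H1 Hu) (H01_H1 Hw).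

Let form_nneg u (Hu : H01 u) : 0 <= form u u :=
  form_ge0 oD DL i01 mW WM K0 trap (H01_H1 Hu).

Lemma gdot_le_form u : H01 u -> gdot u u <= (1 + K) / K * form u u.
Proof.
move=> Hu; have K1 : 0 < (1 + K) / K by rewrite divr_gt0// addr_gt0.
rewrite -ler_pdivrMl// invf_div.
exact: (form_coercive oD DL i01 mW WM K0 trap (H01_H1 Hu)).
Qed.

Lemma form_cauchy_schwarz h u : H01 h -> H01 u -> form h u ^+ 2 <= form h h * form u u.
Proof.
exact: (a_cauchy_schwarz (fun u v => H01D oD DL (u := u) (v := v))
  (fun t u => H01Z oD DL t (u := u)) formC formD formZ form_nneg).
Qed.

Lemma form_weak_cvg (u : nat -> T) us h : H01 h -> weak_cvg_H01 D u us ->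
  form h (u k) @[k --> \oo] --> form h us.
Proof.
move=> Hh; have hh := form_nneg Hh; have c0 := ltW (form_cst_gt0 L Omega M0).
apply: (weak_cvg_real oD DL (c := form h h * form_cst L M Omega)).
- exact: mulr_ge0.
- split=> [v w Hv Hw|t v Hv]; [exact: formD|exact: formZ].
- move=> v Hv; apply: (le_trans (form_cauchy_schwarz Hh Hv)).
  rewrite -mulrA; apply: ler_wpM2l => //.
  exact: (form_le oD L0 DL i01 Omega mW M0 WM Hv).
Qed.

Let ReA v w (Hv : H01 v) (Hw : H01 w) : complex.Re (a0dot D V Omega v w) = form v w :=
  Re_a0dot oD DL Omega mV mW WM VW (H01_H1 Hv) (H01_H1 Hw).

Let ReL v w (Hv : H01 v) (Hw : H01 w) : complex.Re (L2dot D v w) = rdot v w :=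
  Re_L2dot oD (H1_L2 (H01_H1 Hv)) (H1_L2 (H01_H1 Hw)).

Lemma a0norm_sqr v : H01 v -> a0norm D V Omega v ^+ 2 = form v v.
Proof. by move=> Hv; rewrite /a0norm (ReA Hv Hv) sqr_sqrtr//; exact: form_nneg. Qed.

(** [g] represents the L^2 product with [u], so subtracting c g from the Sobolev gradient subtracts
    c (u, .) from the derivative: the coefficient of the projection is the multiplier. Orthogonality
    of [p] to [g] in a0 is tangency in L^2. *)
Lemma projected_gradientP u p : H01 u -> is_projected_gradient D V beta Omega u p ->
  exists gamma : R,
    (rdot u u = 1 -> rdot u p = 0) /\
    forall h, H01 h -> form p h = form u h + beta * quad u u u h - gamma * rdot u h.
Proof.
move=> Hu [g [w [[Hg gP] [Hw wP] ->]]].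
have gE h : H01 h -> form g h = rdot u h.
  by move=> Hh; rewrite -(ReA Hg Hh) (gP _ Hh); exact: ReL.
have wE h : H01 h -> form w h = form u h + beta * quad u u u h.
  move=> Hh; rewrite -(ReA Hw Hh) (wP _ Hh).
  exact: (dEE dim23 oD L0 DL beta Omega mV mW WM VW Hu Hh).
pose c := form w g / form g g.
have pE : a0_projection D V Omega g w = vadd w (vscal (- c) g).
  apply/funext => r; rewrite /a0_projection /vadd /vscal (a0norm_sqr Hg) (ReA Hw Hg).
  by rewrite rmorphN mulNr.
have Hcg := H01Z oD DL (- c) Hg; have Hp := H01D oD DL Hw Hcg.
exists c; rewrite pE; split=> [u1|h Hh].
  (* Otherwise Cauchy-Schwarz would contradict form g u = rdot u u = 1. *)
  have gg : form g g != 0.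
    apply/eqP => gg; have := form_cauchy_schwarz Hg Hu.
    by rewrite (gE _ Hu) u1 gg mul0r expr1n ler10.
  rewrite -(gE _ Hp) (formD Hg Hw Hcg) (formZ _ Hg Hg) (formC Hg Hw) /c.
  by rewrite mulNr divfK// subrr.
rewrite (formC Hp Hh) (formD Hh Hw Hcg) (formZ _ Hh Hg) (formC Hh Hw) (formC Hh Hg).
by rewrite (gE _ Hh) (wE _ Hh) mulNr.
Qed.

Lemma projected_gradient_H01 u p : is_projected_gradient D V beta Omega u p -> H01 p.
Proof. by move=> [g [w [[Hg _] [Hw _] ->]]]; exact: (H01_sub_scale oD DL). Qed.

Lemma retractionE u p (t : R) : H01 u -> H01 p ->
  retraction D (fun r => u r - t%:C * p r) =
  vscal (Num.sqrt (rdot (vadd u (vscal (- t) p)) (vadd u (vscal (- t) p))))^-1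
    (vadd u (vscal (- t) p)).
Proof.
move=> Hu Hp; have -> : (fun r => u r - t%:C * p r) = vadd u (vscal (- t) p).
  by apply/funext => r; rewrite /vadd /vscal rmorphN mulNr.
have Hv := H01D oD DL Hu (H01Z oD DL (- t) Hp).
by rewrite /retraction /L2norm (ReL Hv Hv).
Qed.

Lemma scheme_convergence (rho : R) : exists2 Calpha : R, 0 < Calpha <= 1 &
  forall u0, manifold D u0 -> H01norm D u0 = rho ->
  forall (alpha : nat -> R) (alpha_min alpha_max : R),
    0 < alpha_min -> (forall n, alpha_min <= alpha n <= alpha_max) ->
    alpha_max <= Calpha ->
  forall u : nat -> T, u 0%N = u0 -> a0_scheme D V beta Omega alpha u ->
  forall us, weak_limit_point D u us ->
    stationary D V beta Omega us /\
    exists s : nat -> nat, {homo s : m n / (m < n)%N} /\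
      a0norm D V Omega (fun r => u (s n) r - us r) @[n --> \oo] --> 0.
Proof.
have K1 : 0 <= (1 + K) / K by rewrite divr_ge0 ?ltW// addr_gt0.
(* The constants [Cb] and [Cq]: the Poincare and L^4 constants, with (1 + K) / K for each factor
   [gdot] that coercivity converts into [form]. *)
have Cb0 : 0 <= 64 * L ^+ 2 * ((1 + K) / K).
  by apply: mulr_ge0 => //; apply: mulr_ge0; [exact: ler0n|exact: sqr_ge0].
have lad0 := ladyzhenskaya_cst_ge0 L.
have Cq0 : 0 <= ladyzhenskaya_cst L * ((1 + K) / K) ^+ 3.
  by apply: mulr_ge0 => //; exact: exprn_ge0.
(* This bounds the form at the initial point through its H^1_0 norm [rho] alone, so the step bound
   depends on the initial point only in this way. *)
have x0 : 0 <= form_cst L M Omega * rho ^+ 2.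
  by apply: mulr_ge0; [exact: ltW (form_cst_gt0 L Omega M0)|exact: sqr_ge0].
have rform u : H01 u -> rdot u u <= 64 * L ^+ 2 * ((1 + K) / K) * form u u.
  move=> Hu; apply: (le_trans (H01_poincare oD L0 DL Hu)).
  rewrite -[leRHS]mulrA; apply: ler_wpM2l; last exact: gdot_le_form.
  by apply: mulr_ge0; [exact: ler0n|exact: sqr_ge0].
have qform u : H01 u -> quad u u u u ^+ 2 <=
    ladyzhenskaya_cst L * ((1 + K) / K) ^+ 3 * (rdot u u * form u u ^+ 3).
  move=> Hu; apply: (le_trans (quad_integral4 dim23 oD L0 DL Hu)).
  rewrite -[leRHS]mulrA; apply: ler_wpM2l => //.
  rewrite [leRHS]mulrCA -exprMn; apply: ler_wpM2l; first exact: rdot_ge0.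
  have f0 := form_nneg Hu; have g0 := gdot_ge0 D u.
  by apply: lerXn2r; rewrite ?nnegrE; [exact: g0|exact: mulr_ge0|exact: gdot_le_form].
have [Calpha C01 HC] := gradient_descent_convergence
  (H := H01) (add := vadd) (scal := vscal) (a := form) (b := rdot) (q := quad)
  (beta := beta)
  (fun u v => H01D oD DL (u := u) (v := v)) (fun t u => H01Z oD DL t (u := u))
  formC formD formZ form_nneg
  (fun u v _ _ => rdotC D u v)
  (fun w u v Hw Hu Hv => rdotDr oD (H1_L2 (H01_H1 Hu)) (H1_L2 (H01_H1 Hv)) (H1_L2 (H01_H1 Hw)))
  (fun w t u Hw Hu => rdotZr oD t (H1_L2 (H01_H1 Hu)) (H1_L2 (H01_H1 Hw)))
  (fun u _ => rdot_ge0 D u) Cb0 rform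
  (quadC D) (quadCA D)
  (fun x x' y z w Hx Hx' Hy Hz Hw => quadDl dim23 oD L0 DL Hx Hx' Hy Hz Hw)
  (fun t x y z w Hx Hy Hz Hw => quadZl dim23 oD L0 DL t Hx Hy Hz Hw)
  (fun u _ => quad_ge0 D u)
  (fun x y z w Hx Hy Hz Hw => quad_le dim23 oD L0 DL Hx Hy Hz Hw)
  Cq0 qform beta0 x0.
exists Calpha => //.
move=> u0 [Hu0 nu0] gu0 alpha amin amax amin0 alpha_in amaxC u uu0 su us [s [hs wu]].
have Hus : H01 us by case: wu.
have unit_rdot v : H01 v -> L2norm D v = 1 -> rdot v v = 1.
  by move=> Hv nv; rewrite -(L2norm_sqr oD (H1_L2 (H01_H1 Hv))) nv expr1n.
have /choice[p Pp] : forall n, exists p : T,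
    is_projected_gradient D V beta Omega (u n) p /\
    u n.+1 = retraction D (fun r => u n r - (alpha n)%:C * p r).
  by move=> n; have [p ? ?] := su n; exists p.
have Hp n : H01 (p n) by have [/projected_gradient_H01] := Pp n.
have /choice[gamma Pg] : forall n, exists c : R, H01 (u n) ->
    (rdot (u n) (u n) = 1 -> rdot (u n) (p n) = 0) /\
    forall h, H01 h -> form (p n) h =
      form (u n) h + beta * quad (u n) (u n) (u n) h - c * rdot (u n) h.
  (* That [u n] lies in H^1_0 is a conclusion of the descent argument, whereas the multipliers must
     be given to it beforehand; where membership fails, 0 is a dummy value. *)
  move=> n; have [Hun|nHun] := pselect (H01 (u n)); last by exists 0.
  by have [c Pc] := projected_gradientP Hun (Pp n).1; exists c.
have alphaC n : amin <= alpha n <= Calpha.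
  by have /andP[-> /= aM] := alpha_in n; exact: le_trans aM amaxC.
have Hu0' : H01 (u 0%N) by rewrite uu0.
have b0 : rdot (u 0%N) (u 0%N) = 1 by rewrite uu0; exact: unit_rdot.
have a0 : form (u 0%N) (u 0%N) <= form_cst L M Omega * rho ^+ 2.
  rewrite uu0 -gu0 (H01norm_sqr oD (H01_H1 Hu0)).
  exact: (form_le oD L0 DL i01 Omega mW M0 WM Hu0).
have tang n (Hun : H01 (u n)) (bn : rdot (u n) (u n) = 1) : rdot (u n) (p n) = 0.
  exact: (Pg n Hun).1 bn.
have uS n (Hun : H01 (u n)) := etrans (Pp n).2 (retractionE (alpha n) Hun (Hp n)).
have [Hu bu [A uA] HS] := HC u p gamma alpha amin Hu0' b0 a0 amin0 alphaC Hp tang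
  (fun n Hun => (Pg n Hun).2) uS.
have uM n : gdot (u (s n)) (u (s n)) <= (1 + K) / K * A.
  by apply: (le_trans (gdot_le_form (Hu _))); exact: ler_wpM2l.
have es := weak_cvg_L2 oD L0 DL (fun n => Hu (s n)) uM wu.
have [bus [lambda statl] strong] := HS s us hs Hus (fun h Hh => form_weak_cvg Hh wu) es.
split.
  split.
    split => //; rewrite /L2norm (ReL Hus Hus) bus; exact: sqrtr1.
  exists lambda => v Hv; rewrite (ReL Hus Hv) -(statl _ Hv).
  exact: (dEE dim23 oD L0 DL beta Omega mV mW WM VW Hus Hv).
exists s; split => //.
have He n : H01 (fun r => u (s n) r - us r) := H01B oD DL (Hu (s n)) Hus.
apply: cvg0_sqr strong => n; rewrite (a0norm_sqr (He n)).
have -> // : (fun r => u (s n) r - us r) = vadd (u (s n)) (vscal (-1) us).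
by apply/funext => r; rewrite /vadd /vscal rmorphN rmorph1 mulN1r.
Qed.

End rotating_scheme.

Theorem theorem3p5 (R : realType) (d : nat)
    (dim23 : d.+2 = 2%N \/ d.+2 = 3%N)
    (D : set 'rV[R]_d.+2) (domD : domain D) (bndD : bounded_set D)
    (V : 'rV[R]_d.+2 -> R) (beta Omega : R)
    (V_Linfty : Linfty D V)
    (V_ge0 : \forall r \ae lebesgue_measure_rV R d.+2, D r -> 0 <= V r)
    (beta_gt0 : 0 < beta) (Omega_ge0 : 0 <= Omega)
    (V_trap : exists2 K : R, 0 < K &
      \forall r \ae lebesgue_measure_rV R d.+2, D r ->
        (1 + K) / 4 * Omega ^+ 2 * (r 0 0 ^+ 2 + r 0 1 ^+ 2) <= V r)
    (rho : R) :
  exists2 Calpha : R, 0 < Calpha <= 1 &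
    forall u0, manifold D u0 -> H01norm D u0 = rho ->
    forall (alpha : nat -> R) (alpha_min alpha_max : R),
      0 < alpha_min ->
      (forall n, alpha_min <= alpha n <= alpha_max) ->
      alpha_max <= Calpha ->
    forall u, u 0%N = u0 -> a0_scheme D V beta Omega alpha u ->
    forall us, weak_limit_point D u us ->
      stationary D V beta Omega us /\
      exists s : nat -> nat, {homo s : m n / (m < n)%N} /\
        a0norm D V Omega (fun r => u (s n) r - us r) @[n --> \oo] --> 0.
Proof.
have [K K0 trapV] := V_trap; have [_ oD _] := domD; have [mV _] := V_Linfty.
have [L L0 DL] := bounded_domain_coor bndD.
have c0 : 0 <= (1 + K) / 4 * Omega ^+ 2.
  by rewrite mulr_ge0 ?sqr_ge0// divr_ge0// addr_ge0// ltW.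
have [W [M [mW M0 WM trapW VW]]] := bounded_version DL V_Linfty c0 L0 trapV.
exact: (scheme_convergence dim23 oD L0 DL mV mW M0 WM K0 trapW VW (ltW beta_gt0) rho).
Qed.
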